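(* Consider the plant, for $(x,t)\in[0,1]\times\mathbb{R}_+$, $$\partial_tu=-\lambda\,\partial_xu,\qquad \partial_tv=\mu\,\partial_xv+c(x)u,\qquad u(0,t)=r\,v(0,t),\qquad v(1,t)=U(t),$$ with unknown coefficient $c$ and with parameters as in the context. There exists $\mathcal{E}_0>0$ such that for all neural operator approximations $\hat K^u,\hat K^v$ of the kernels $\breve K^u,\breve K^v$ (see context) of accuracy $\mathcal{E}\in(0,\mathcal{E}_0)$, the following holds. Let the plant be in feedback with the adaptive control law $$U(t)=\int_0^1\left(\hat K^u(1,\xi,t)\hat u(\xi,t)+\hat K^v(1,\xi,t)\hat v(\xi,t)\right)d\xi,$$ with the update law $$\hat c_t(x,t)=\operatorname{Proj}_{\bar c}\left\{\gamma_1e^{\gamma x}\epsilon(x,t)u(x,t),\hat c(x,t)\right\}$$ with any Lipschitz initial condition $\hat c_0=\hat c(\cdot,0)$ such that $\|\hat c_0\|_\infty\le\bar c$, and with the passive identifier $$\partial_t\hat u=-\lambda\,\partial_x\hat u+\rho\,e(x,t)\|\varpi(t)\|^2,\qquad \partial_t\hat v=\mu\,\partial_x\hat v+\hat c(x,t)u(x,t)+\rho\,\epsilon(x,t)\|\varpi(t)\|^2,$$ $$\hat u(0,t)=r\hat v(0,t),\qquad \hat v(1,t)=U(t),$$ with any initial conditions $\hat u_0=\hat u(\cdot,0)$, $\hat v_0=\hat v(\cdot,0)$ such that $\|\hat u_0\|<\infty$, $\|\hat v_0\|<\infty$. Then: (i) the functions of time $\|u\|,\|v\|,\|\hat u\|,\|\hat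 v\|,\|u\|_\infty,\|v\|_\infty,\|\hat u\|_\infty,\|\hat v\|_\infty$ belong to $L_2\cap L_\infty$; (ii) $\|u\|_\infty,\|v\|_\infty,\|\hat u\|_\infty,\|\hat v\|_\infty\to0$ as $t\to\infty$; (iii) for the equilibrium $(u,v,\hat u,\hat v,\hat c)=(0,0,0,0,c)$ the following global stability estimate holds: there are strictly positive constants $k_1,k_2,\theta_1,\theta_2$ such that $$S(t)\le 2\frac{k_2}{k_1}\theta_2\,S(0)\,e^{\theta_1k_2S(0)},\qquad t>0,$$ where $S(t):=\|u\|^2+\|v\|^2+\|\hat u\|^2+\|\hat v\|^2+\|\tilde c\|^2$ and $\tilde c(x,t)=c(x)-\hat c(x,t)$.
   Context: Parameters (linearized ARZ traffic model in Riemann coordinates on the normalized domain $[0,1]$): $\lambda=v_1^*>0$, $\mu=\gamma_0p_1^*-v_1^*>0$, $r=\frac{\rho_1^*V(\rho_1^* )+v_1^*}{v_1^*}$, $c(x)=-\frac1\tau\exp\left(-\frac{x}{\tau v_1^*}\right)$, where $\tau>0$ is the unknown relaxation time, $p_1^*=c_0(\rho_1^* )^{\gamma_0}$ with $c_0,\gamma_0>0$, $V(\rho_1)=v_f\left(1-(\rho_1/\rho_m)^{\gamma_0}\right)$ with $v_f,\rho_m>0$, and $(\rho_1^*,v_1^* )$ is an equilibrium with $v_1^*=V(\rho_1^* )$. The coefficient $c\in C^1([0,1])$ satisfies $\|c\|_\infty\le\bar c$ for a known constant $\bar c>0$. Notation: $\rho,\gamma,\gamma_1>0$ are scalar design gains.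 $e=u-\hat u$ and $\epsilon=v-\hat v$ are the identifier errors; $\varpi(x,t)=[u(x,t),v(x,t)]^T$. $\|\cdot\|$ is the $L^2([0,1])$ norm in $x$ (so $\|\varpi(t)\|^2=\int_0^1(u^2+v^2)\,dx$), and $\|\cdot\|_\infty$ is the supremum norm in $x\in[0,1]$; $L_2$ and $L_\infty$ in (i) refer to functions of time $t\in[0,\infty)$. $\operatorname{Proj}_{\bar c}$ is the standard projection operator: $\operatorname{Proj}_{\bar c}\{\sigma,\omega\}=0$ if $|\omega|\ge\bar c$ and $\sigma\omega\ge0$, and $\operatorname{Proj}_{\bar c}\{\sigma,\omega\}=\sigma$ otherwise (applied pointwise in $x$). Exact kernels: on $\mathcal{T}=\{(x,\xi):0\le\xi\le x\le1\}$, for each $t\ge0$, $(\breve K^u,\breve K^v)(\cdot,\cdot,t)=:\mathcal{K}(\hat c)(\cdot,t)$ is the unique $(C^1(\mathcal{T}))^2$ solution of $$\mu\breve K^u_x(x,\xi,t)=\lambda\breve K^u_\xi(x,\xi,t)+\hat c(\xi,t)\breve K^v(x,\xi,t),\qquad \mu\breve K^v_x(x,\xi,t)=-\mu\breve K^v_\xi(x,\xi,t),$$ $$\breve K^u(x,x,t)=-\frac{\hat c(x,t)}{\lambda+\mu},\qquad \breve K^v(x,0,t)=\frac{\lambda r}{\mu}\breve K^u(x,0,t).$$ Neural operator approximations of accuracy $\mathcal{E}$: $(\hat K^u,\hat K^v)(\cdot,\cdot,t)=\hat{\mathcal{K}}(\hat c)(\cdot,t)$, where $\hat{\mathcal{K}}:C^1([0,1])\to(C^1(\mathcal{T}))^2$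 is a neural operator (DeepONet) such that $|\mathcal{K}(\hat c)(x,\xi,t)-\hat{\mathcal{K}}(\hat c)(x,\xi,t)|\le\mathcal{E}$ for all $(x,\xi)\in\mathcal{T}$ and all $t\ge0$. A DeepONet is an operator each of whose output components has the form $\sum_{i=1}^bg^{\mathcal N}(\mathbf{u}_a;\vartheta^{(i)})f^{\mathcal N}(y;\theta^{(i)})$, $y=(x,\xi)$, where $\mathbf{u}_a$ is the vector of values of the input function at finitely many points of $[0,1]$ and $g^{\mathcal N}(\cdot;\vartheta^{(i)})$, $f^{\mathcal N}(\cdot;\theta^{(i)})$ are real-valued neural networks with parameters $\vartheta^{(i)},\theta^{(i)}$.
   Formalization: The initial profiles of u, v, û, v̂ are also assumed bounded (solutions bounded on [0,1]×[0,T] for each T), not merely of finite L² norm; for unbounded L² data the claim in (i) that the sup norms belong to L_∞ is false, as an unbounded profile is transported. *)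

(* Defs.v *)
From HB Require Import structures.
From mathcomp Require Export all_boot all_order all_algebra.
From mathcomp Require Export all_classical all_reals all_analysis.

Set Implicit Arguments.
Unset Strict Implicit.
Unset Printing Implicit Defensive.
Import Order.TTheory GRing.Theory Num.Theory.
Import numFieldNormedType.Exports.

Local Open Scope classical_set_scope.
Local Open Scope ring_scope.

(* Functions of (x, t) are total functions R -> R -> R; only their values on
   [0, 1] * [0, +oo) are ever used. *)

Section norms.
Context {R : realType}.
Implicit Types f phi : R -> R.

Definition enormL2 f : \bar R :=
  ('N[@lebesgue_measure R]_(2%:E) [EFin \o patch (fun=> 0%R) `[0%R, 1%R] f])%E.
Definition normL2 f : R := fine (enormL2 f).

Definition enormoo f : \bar R :=
  ereal_sup [set `|f x|%:E | x in `[0%R, 1%R]].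
Definition normoo f : R := fine (enormoo f).

(* phi, extended by 0 to negative times, is in L_2 and in L_oo for the Lebesgue
   measure. *)
Definition time_L2_Loo phi : Prop :=
  patch (fun=> 0) `[0, +oo[ phi \in Lfun (@lebesgue_measure R) 2%:E /\
  patch (fun=> 0) `[0, +oo[ phi \in Lfun (@lebesgue_measure R) +oo%E.

End norms.

Section kernels.
Context {R : realType}.
Implicit Types (c : R -> R) (K : R -> R -> R).

Definition tri : set (R * R) := [set p | 0 <= p.2 <= p.1 /\ p.1 <= 1].

(* On a closed set, C^1 means: C^1 in the interior, with derivatives that extend
   continuously to the closed set. *)
Definition C1_01 c : Prop :=
  exists c' : R -> R,
    [/\ {within `[0, 1], continuous c}, {within `[0, 1], continuous c'} &
        forall x : R, 0 < x < 1 -> is_derive x 1 c (c' x)].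

Definition C1_tri_with K Kx Kxi : Prop :=
  [/\ {within tri, continuous (fun p => K p.1 p.2)},
      {within tri, continuous (fun p => Kx p.1 p.2)},
      {within tri, continuous (fun p => Kxi p.1 p.2)} &
      forall x xi : R, 0 < xi -> xi < x -> x < 1 ->
        is_derive x 1 (fun y => K y xi) (Kx x xi) /\
        is_derive xi 1 (fun y => K x y) (Kxi x xi)].

Definition C1_tri K : Prop := exists Kx Kxi, C1_tri_with K Kx Kxi.

Definition C1_kernel (lambda mu r : R) c Ku Kv : Prop :=
  exists Kux Kuxi Kvx Kvxi : R -> R -> R,
    [/\ C1_tri_with Ku Kux Kuxi, C1_tri_with Kv Kvx Kvxi,
        (forall x xi : R, 0 <= xi <= x -> x <= 1 ->
           mu * Kux x xi = lambda * Kuxi x xi + c xi * Kv x xi /\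
           mu * Kvx x xi = - mu * Kvxi x xi) &
        (forall x : R, 0 <= x <= 1 ->
           Ku x x = - c x / (lambda + mu) /\
           Kv x 0 = lambda * r / mu * Ku x 0)].

(* Since Ku x x = - c x / (lambda + mu), a C^1 kernel exists only if c is C^1.
   A Lipschitz initial condition and the projection give estimates that are in
   general only continuous in x; for these the kernel is the uniform limit of the
   C^1 kernels of C^1 coefficients that converge uniformly to c. For c of class
   C^1, [kernel] and [C1_kernel] agree, as the kernel depends continuously on c. *)
Definition kernel (lambda mu r : R) c Ku Kv : Prop :=
  forall d : R, 0 < d -> exists c' Ku' Kv',
    [/\ C1_kernel lambda mu r c' Ku' Kv',
        (forall x : R, 0 <= x <= 1 -> `|c' x - c x| <= d) &
        (forall x xi : R, 0 <= xi <= x -> x <= 1 ->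
           `|Ku' x xi - Ku x xi| <= d /\ `|Kv' x xi - Kv x xi| <= d)].

Lemma C1_kernelW (lambda mu r : R) c Ku Kv :
  C1_kernel lambda mu r c Ku Kv -> kernel lambda mu r c Ku Kv.
Proof.
move=> cK d d0; exists c, Ku, Kv; split => // [x _|x xi _ _].
  by rewrite subrr normr0 ltW.
by rewrite !subrr !normr0; split; exact: ltW.
Qed.

End kernels.

Section deeponet.
Context {R : realType}.

(* Parameters of a real-valued feed-forward network with n inputs and hidden
   layers of widths hs: weights and biases of each hidden layer, followed by
   those of the affine output layer. *)
Fixpoint nn_param (n : nat) (hs : seq nat) : Type :=
  if hs is h :: hs' then ('M[R]_(n, h) * 'rV[R]_h * nn_param h hs')%type
  else ('cV[R]_n * R)%type.

Fixpoint nn_eval (act : R -> R) (n : nat) (hs : seq nat) :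
    nn_param n hs -> 'rV[R]_n -> R :=
  match hs with
  | [::] => fun th y => (y *m th.1) 0 0 + th.2
  | h :: hs' => fun th y =>
      nn_eval act th.2 (map_mx act (y *m th.1.1 + th.1.2))
  end.

(* One real-valued output component; an operator into pairs of kernels is a pair
   of these. *)
Record deeponet := DeepONet {
  don_m : nat;
  don_sensor : 'I_don_m -> R;
  don_sensor01 : forall j, 0 <= don_sensor j <= 1;
  don_branch_act : R -> R;
  don_trunk_act : R -> R;
  don_branch_layers : seq nat;
  don_trunk_layers : seq nat;
  don_b : nat;
  don_branch : 'I_don_b -> nn_param don_m don_branch_layers;
  don_trunk : 'I_don_b -> nn_param 2 don_trunk_layers }.

Definition don_eval (N : deeponet) (c : R -> R) (x xi : R) : R :=
  \sum_(i < don_b N)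
    nn_eval (don_branch_act N) (don_branch i) (\row_j c (don_sensor j)) *
    nn_eval (don_trunk_act N) (don_trunk i)
      (\row_(j < 2) (if j == 0 then x else xi)).

Definition don_C1 (N : deeponet) : Prop :=
  forall c, C1_01 c -> C1_tri (don_eval N c).

Definition don_accurate (Nu Nv : deeponet) (E : R) (c : R -> R)
    (Ku Kv : R -> R -> R) : Prop :=
  forall x xi : R, 0 <= xi <= x -> x <= 1 ->
    `|Ku x xi - don_eval Nu c x xi| <= E /\
    `|Kv x xi - don_eval Nv c x xi| <= E.

End deeponet.

Section closed_loop.
Context {R : realType}.
Implicit Types w f u v uh vh ch : R -> R -> R.
Local Notation leb := (@lebesgue_measure R).

(* Boundedness on [0, 1] * [0, T], in particular of the initial data, cannot be
   dropped: an unbounded initial profile is transported, so that the sup norm is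
   infinite at small times. *)
Definition locally_bounded_measurable w : Prop :=
  measurable_fun ((`[0, 1] : set R) `*` (`[0, +oo[ : set R))
    (fun p : measurableTypeR R * measurableTypeR R => w p.1 p.2) /\
  forall T : R, exists M : R,
    forall x t : R, 0 <= x <= 1 -> 0 <= t <= T -> `|w x t| <= M.

(* Broad solution of w_t + a w_x = f on [0, 1] * [0, +oo): along every
   characteristic segment inside the domain, w is absolutely continuous with
   derivative f. Classical solutions are broad solutions; discontinuous initial
   data, incompatible with the boundary conditions at t = 0, are allowed. *)
Definition transport (a : R) w f : Prop :=
  forall x t h : R, 0 <= t -> 0 <= h -> 0 <= x <= 1 -> 0 <= x + a * h <= 1 ->
    w (x + a * h) (t + h) =
    w x t + \int[leb]_(s in `[0, h]) f (x + a * s) (t + s).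

(* No compatibility at the corners is imposed: the boundary conditions hold for
   t > 0. *)
Definition plant (lambda mu r : R) (c U : R -> R) u v : Prop :=
  [/\ transport lambda u (fun _ _ => 0),
      transport (- mu) v (fun x t => c x * u x t),
      (forall t : R, 0 < t -> u 0 t = r * v 0 t) &
      (forall t : R, 0 < t -> v 1 t = U t)].

Definition normvarpi2 u v (t : R) : R :=
  \int[leb]_(x in `[0, 1]) (u x t ^+ 2 + v x t ^+ 2).

Definition identifier (lambda mu r rho : R) (U : R -> R) u v uh vh ch : Prop :=
  [/\ transport lambda uh
        (fun x t => rho * (u x t - uh x t) * normvarpi2 u v t),
      transport (- mu) vh
        (fun x t => ch x t * u x t
                    + rho * (v x t - vh x t) * normvarpi2 u v t),
      (forall t : R, 0 < t -> uh 0 t = r * vh 0 t) &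
      (forall t : R, 0 < t -> vh 1 t = U t)].

Definition Proj (cbar sigma omega : R) : R :=
  if (cbar <= `|omega|) && (0 <= sigma * omega) then 0 else sigma.

(* Proj is discontinuous, so that the ODE is understood in the sense of
   Caratheodory. *)
Definition update_law (gamma gamma1 cbar : R) u v vh ch : Prop :=
  forall x t : R, 0 <= x <= 1 -> 0 <= t ->
    ch x t = ch x 0 +
      \int[leb]_(s in `[0, t])
        Proj cbar (gamma1 * expR (gamma * x) * (v x s - vh x s) * u x s)
          (ch x s).

Definition control (Nu Nv : deeponet) uh vh ch (t : R) : R :=
  \int[leb]_(xi in `[0, 1])
    (don_eval Nu (ch ^~ t) 1 xi * uh xi t + don_eval Nv (ch ^~ t) 1 xi * vh xi t).

Definition S_fun (c : R -> R) u v uh vh ch (t : R) : R :=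
  normL2 (u ^~ t) ^+ 2 + normL2 (v ^~ t) ^+ 2 +
  normL2 (uh ^~ t) ^+ 2 + normL2 (vh ^~ t) ^+ 2 +
  normL2 (fun x => c x - ch x t) ^+ 2.

End closed_loop.

Definition V_eq {R : realType} (vf rhom gamma0 rho1 : R) : R :=
  vf * (1 - (rho1 / rhom) `^ gamma0).

(* Main.v *)
(* The state is a functional of the outlet trace y(t) = v(0, t), continued to
   [-1/lambda, 0] by the initial profile of u: u(x, t) = r y(t - x/lambda), and v is
   y at later times plus a Volterra term along characteristics. Hence ||varpi(t)||^2
   is equivalent to Q(t - 1/lambda, t + 1/mu), where Q(a, b) is the integral of y^2.

   The weighted functional of epsilon and c~ decreases, which bounds, by the initial
   data, ||epsilon|| and epsilon(0, .) in L_2 and the integral of ||varpi||^2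
   ||epsilon||^2. The kernel equations, integrated along characteristics, become
   Volterra equations for kappa(x - xi) = K^v(x, xi) and K^u(1, .); in this form they
   pass to uniform limits and need no smoothness of c^. They show that the exact
   control would cancel the value of y one period h = 1/mu later, up to the
   identifier errors and to the integrals of (c - c^(., t)) u along characteristics.
   By the equation of epsilon these integrals consist of values of epsilon, of
   rho epsilon ||varpi||^2, and of the variation of c^ over one period, which the
   update law bounds by the integral of epsilon^2 ||varpi||^2.

   With S_n = Q(-1/lambda, (n + 1) h) this gives S_{n+1} - S_n <= 12 E^2 M_n + b_n
   + a_n (S_n + Z), where sum M_n <= C S_n, sum b_n <= C Z and sum a_n <= C Z for the
   size Z of the initial data. For small E the first term is absorbed and the discrete
   Gronwall lemma bounds Q(-1/lambda, oo) by C Z exp(theta Z), which is the stability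
   estimate. Pointwise values at time t are bounded by Q over a window of fixed length
   around t, which is integrable in t and tends to 0. *)

(* The usual route, a Lyapunov functional of the backstepping target system, differentiates the
   kernels in time. Here c^ is only absolutely continuous in time, with a discontinuous right-hand
   side, and its kernels are only uniform limits of C^1 ones; working with the scalar function y and
   with integral identities replaces all such derivatives.

   Identification is nonlinear in the state: the Lyapunov functional bounds the integral of
   ||varpi||^2 ||epsilon||^2, not epsilon against a fixed rate. The learning error of a period is
   thus estimated by that integral times the largest ||varpi||^2 of the period, which is itself
   unknown. This product is what forces a Gronwall argument over the periods and puts S(0) into the
   exponent.

   The approximation error carries no summable factor: it is E^2 times the energy of the period, and
   only its sum over all periods is comparable to S_n. The constant in this comparison depends on
   lambda, mu, r and cbar alone, because the projection keeps |c^| <= cbar; so the admissible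
   accuracy is fixed before any trajectory is. *)
Require Import Defs.
From mathcomp Require Import measurable_realfun ring lra.

Set Implicit Arguments.
Unset Strict Implicit.
Unset Printing Implicit Defensive.
Import Order.TTheory GRing.Theory Num.Theory.
Import numFieldNormedType.Exports.
Local Open Scope classical_set_scope.
Local Open Scope ring_scope.

(** * Locally bounded measurable functions *)

Section locally_bounded.
Context {R : realType} {d : measure_display} {T : measurableType d}.
Variable n : T -> R.
Implicit Types f g : T -> R.

(* Locally bounded and measurable: n is the norm, or [psize] on products. *)
Definition lbm f := measurable_fun setT f /\
  forall M : R, exists B : R, forall z, n z <= M -> `|f z| <= B.

Lemma lbm_cst k : lbm (fun=> k).
Proof. by split=> // M; exists `|k|. Qed.

Lemma lbmD f g : lbm f -> lbm g -> lbm (fun z => f z + g z).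
Proof.
move=> [mf bf] [mg bg]; split; first exact: measurable_funD.
move=> M; have [A hA] := bf M; have [B hB] := bg M; exists (A + B) => z hz.
by rewrite (le_trans (ler_normD _ _))// lerD ?hA ?hB.
Qed.

Lemma lbmN f : lbm f -> lbm (fun z => - f z).
Proof.
move=> [mf bf]; split; first exact: measurable_funN.
by move=> M; have [A hA] := bf M; exists A => z hz; rewrite normrN hA.
Qed.

Lemma lbmM f g : lbm f -> lbm g -> lbm (fun z => f z * g z).
Proof.
move=> [mf bf] [mg bg]; split; first exact: measurable_funM.
move=> M; have [A hA] := bf M; have [B hB] := bg M; exists (A * B) => z hz.
by rewrite normrM ler_pM ?hA ?hB.
Qed.

Lemma lbmX f k : lbm f -> lbm (fun z => f z ^+ k).
Proof.
move=> [mf bf]; split; first exact: measurable_funX.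
move=> M; have [A hA] := bf M; exists (A ^+ k) => z hz.
by rewrite normrX lerXn2r ?nnegrE ?hA// (le_trans _ (hA _ hz)).
Qed.

Lemma lbm_norm f : lbm f -> lbm (fun z => `|f z|).
Proof.
move=> [mf bf]; split; first exact: measurableT_comp.
by move=> M; have [A hA] := bf M; exists A => z hz; rewrite normr_id hA.
Qed.

Lemma lbm_exp f : lbm f -> lbm (fun z => expR (f z)).
Proof.
move=> [mf bf]; split; first exact: measurableT_comp.
move=> M; have [A hA] := bf M; exists (expR A) => z hz.
by rewrite ger0_norm ?expR_ge0// ler_expR (le_trans (ler_norm _)) ?hA.
Qed.

(** Conditions are carried as 0/1-valued functions, so that [lbm_if] reduces case distinctions to
    sums and products. *)
Lemma lbm_le f g : lbm f -> lbm g -> lbm (fun z => (f z <= g z)%R%:R).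
Proof.
move=> [mf bf] [mg bg]; split; last first.
  by exists 1 => z _; case: (f z <= g z)%R; rewrite /= ?normr1 ?normr0 ?ler01.
rewrite (_ : (fun _ => _) = (fun z => if f z <= g z then 1 else 0 : R)).
  apply: measurable_fun_if => //; exact: measurable_fun_ler.
by apply/funext => z; case: (_ <= _).
Qed.

Lemma lbm_lt f g : lbm f -> lbm g -> lbm (fun z => (f z < g z)%R%:R).
Proof.
move=> lf lg.
rewrite (_ : (fun _ => _) = (fun z => 1 + - (g z <= f z)%R%:R)).
  by apply: lbmD; [exact: lbm_cst|apply: lbmN; exact: lbm_le].
by apply/funext => z; rewrite ltNge; case: (_ <= _) => /=; rewrite ?subrr// oppr0 addr0.
Qed.

Lemma lbm_if (b : T -> bool) f g : lbm (fun z => (b z)%:R) -> lbm f -> lbm g ->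
  lbm (fun z => if b z then f z else g z).
Proof.
move=> lb lf lg.
rewrite (_ : (fun _ => _) = (fun z => (b z)%:R * f z + (1 + - (b z)%:R) * g z)).
  by apply: lbmD; apply: lbmM => //; apply: lbmD; [exact: lbm_cst|exact: lbmN].
by apply/funext => z; case: (b z); rewrite /= ?subrr ?oppr0 ?addr0 ?(mul0r, mul1r, addr0, add0r).
Qed.

Lemma lbm_and (b1 b2 : T -> bool) : lbm (fun z => (b1 z)%:R) ->
  lbm (fun z => (b2 z)%:R) -> lbm (fun z => (b1 z && b2 z)%:R).
Proof.
move=> l1 l2; rewrite (_ : (fun _ => _) = (fun z => (b1 z)%:R * (b2 z)%:R)).
  exact: lbmM.
by apply/funext => z; case: (b1 z) => /=; rewrite ?mul1r// mul0r.
Qed.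

Lemma lbm_ext f g : f =1 g -> lbm f -> lbm g.
Proof. by move=> /funext ->. Qed.

End locally_bounded.

(** Iterated, it gives a size on products of several lines, so that [lbm] also covers integrands
    with several parameters. *)
Definition psize {R : realType} {T : Type} (n : T -> R) : T * R -> R :=
  fun p => Num.max (n p.1) `|p.2|.

Section composition.
Context {R : realType} {d : measure_display} {T : measurableType d}.
Local Notation TR := (measurableTypeR R).
Variable n : T -> R.
Local Notation lbm1 := (lbm (T := TR) (@Num.norm _ R)).
Local Notation lbm2 := (lbm (T := (TR * TR)%type) (psize (@Num.norm _ R))).

Lemma lbm_id : lbm1 (fun x => x).
Proof. by split; [exact: measurable_id|move=> M; exists M]. Qed.

Lemma lbm_comp1 (f : R -> R) (g : T -> R) : lbm1 f -> lbm n g ->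
  lbm n (fun z => f (g z)).
Proof.
move=> [mf bf] [mg bg]; split; first exact: (measurableT_comp mf).
move=> M; have [A hA] := bg M; have [B hB] := bf A.
by exists B => z /hA /hB.
Qed.

Lemma lbm_comp2 (F : R -> R -> R) (g1 g2 : T -> R) :
  lbm2 (fun p => F p.1 p.2) -> lbm n g1 -> lbm n g2 ->
  lbm n (fun z => F (g1 z) (g2 z)).
Proof.
move=> [mF bF] [m1 b1] [m2 b2]; split.
  by apply: (@measurableT_comp _ _ _ _ _ _ _ _ (fun z => (g1 z, g2 z)) mF);
    apply: measurable_fun_pair.
move=> M; have [A hA] := b1 M; have [B hB] := b2 M.
have [C hC] := bF (Num.max A B).
exists C => z hz; apply: (hC (g1 z, g2 z)).
by rewrite /psize/= ge_max !le_max hA// hB// orbT.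
Qed.

Lemma lbm_fst (f : T -> R) : lbm n f -> lbm (T := (T * TR)%type) (psize n) (fun p => f p.1).
Proof.
move=> [mf bf]; split; first exact: (measurableT_comp mf).
move=> M; have [A hA] := bf M; exists A => -[z x]; rewrite /psize/= ge_max.
by move=> /andP[/hA].
Qed.

Lemma lbm_snd : lbm (T := (T * TR)%type) (psize n) (fun p => p.2).
Proof.
split; first exact: measurable_snd.
by move=> M; exists M => -[z x]; rewrite /psize/= ge_max => /andP[].
Qed.

End composition.
Notation lbm1 := (lbm (T := measurableTypeR _) (@Num.norm _ _)).
Notation lbm2 F := (lbm (T := (measurableTypeR _ * measurableTypeR _)%type)
  (psize (@Num.norm _ _)) (fun p => F p.1 p.2)).

(** A hook, redefined once integrals with variable limits are known to stay in the class. *)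
Ltac lbm_leaf := fail.
Ltac lbm_step :=
  lazymatch goal with
  | |- lbm _ (fun _ => ?k) => apply: lbm_cst
  | |- lbm _ (fun z => z) => apply: lbm_id
  | |- lbm _ (fun z => z.1) => apply: (lbm_fst (f := fun q => q))
  | |- lbm _ (fun z => z.1.1) => apply: (lbm_fst (f := fun q => q.1))
  | |- lbm _ (fun z => z.1.2) => apply: (lbm_fst (f := fun q => q.2))
  | |- lbm _ (fun z => z.2) => apply: lbm_snd
  | |- lbm _ (fun z => _ + _) => apply: lbmD
  | |- lbm _ (fun z => - _) => apply: lbmN
  | |- lbm _ (fun z => _ * _) => apply: lbmM
  | |- lbm _ (fun z => _ ^+ _) => apply: lbmX
  | |- lbm _ (fun z => `|_|) => apply: lbm_norm
  | |- lbm _ (fun z => expR _) => apply: lbm_exp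
  | |- lbm _ (fun z => (nat_of_bool (_ && _))%:R) => apply: lbm_and
  | |- lbm _ (fun z => (nat_of_bool (_ <= _))%:R) => apply: lbm_le
  | |- lbm _ (fun z => (nat_of_bool (_ < _))%:R) => apply: lbm_lt
  | |- lbm _ (fun z => if _ then _ else _) => apply: lbm_if
  | |- _ => first
    [ lbm_leaf
    | match goal with
      | H : lbm _ ?f |- lbm _ ?f => exact H
      | H : lbm _ ?f |- lbm _ (fun z => ?f (@?g z)) => apply: (lbm_comp1 (g := g) H)
      | H : lbm _ (fun p => ?F p.1 p.2) |- lbm _ (fun z => ?F (@?g z) (@?h z)) =>
        apply: (lbm_comp2 (g1 := g) (g2 := h) H)
      | |- lbm ?n (?F ?x) => change (lbm n (fun z => F x z))
      end
    | assumption
    | apply: lbm_fst ]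
  end.
Ltac lbm := cbv beta; repeat (lbm_step; cbv beta).

(** * Integrals over segments *)

Section itg.
Context {R : realType}.
Local Notation leb := (@lebesgue_measure R).
Local Notation TR := (measurableTypeR R).
Implicit Types (f g : R -> R) (a b c k l : R).

(** Not an oriented integral: the value is 0 when b < a. *)
Definition itg a b f : R := \int[leb]_(s in `[a, b]) f s.

Lemma norm_le_max a x b : a <= x <= b -> `|x| <= Num.max `|a| `|b|.
Proof.
move=> /andP[ax xb]; rewrite le_max; have [x0|x0] := leP 0 x.
  by rewrite (ger0_norm x0) (ger0_norm (le_trans x0 xb)) xb orbT.
by rewrite (ltr0_norm x0) (ltr0_norm (le_lt_trans ax x0)) lerN2 ax.
Qed.

Lemma lebesgue_itvcc a b : (leb `[a, b] < +oo)%E.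
Proof. by rewrite lebesgue_measure_itv/=; case: ifP => _; rewrite ?ltry// -EFinD ltry. Qed.

Lemma lbm_measurable f (D : set R) : lbm1 f -> measurable_fun D f.
Proof. by case=> mf _; exact: measurable_funTS. Qed.

Lemma lbm_integrable a b f : lbm1 f -> leb.-integrable `[a, b] (EFin \o f).
Proof.
move=> [mf bf]; apply: measurable_bounded_integrable => //.
- exact: lebesgue_itvcc.
- exact: measurable_funTS.
have [B hB] := bf (Num.max `|a| `|b|).
exists B; split; first exact: num_real.
move=> y By x /=; rewrite in_itv/= => axb.
by rewrite (le_trans _ (ltW By))// hB// norm_le_max.
Qed.

Lemma integral_fin_num a b f : lbm1 f ->
  (\int[leb]_(x in `[a, b]) (f x)%:E)%E \is a fin_num.
Proof. by move=> lf; apply: integrable_fin_num => //; exact: lbm_integrable. Qed.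

Lemma itg_ext a b f g : (forall x, a <= x <= b -> f x = g x) -> itg a b f = itg a b g.
Proof.
move=> fg; apply: eq_Rintegral => x; rewrite inE/= in_itv/= => /fg //.
Qed.

Lemma itg_nil a b f : b <= a -> itg a b f = 0.
Proof.
rewrite le_eqVlt => /predU1P[->|ba].
  by rewrite /itg set_itv1 Rintegral_set1.
by rewrite /itg set_itv_ge ?Rintegral_set0// bnd_simp -ltNge.
Qed.

Lemma itgD a b f g : lbm1 f -> lbm1 g ->
  itg a b (fun x => f x + g x) = itg a b f + itg a b g.
Proof. by move=> lf lg; apply: RintegralD => //; exact: lbm_integrable. Qed.

Lemma itgB a b f g : lbm1 f -> lbm1 g ->
  itg a b (fun x => f x - g x) = itg a b f - itg a b g.
Proof. by move=> lf lg; apply: RintegralB => //; exact: lbm_integrable. Qed.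

Lemma itgZ a b k f : lbm1 f -> itg a b (fun x => k * f x) = k * itg a b f.
Proof. by move=> lf; apply: RintegralZl => //; exact: lbm_integrable. Qed.

Lemma itgZr a b k f : lbm1 f -> itg a b (fun x => f x * k) = itg a b f * k.
Proof. by move=> lf; apply: RintegralZr => //; exact: lbm_integrable. Qed.

Lemma itgN a b f : lbm1 f -> itg a b (fun x => - f x) = - itg a b f.
Proof.
move=> lf; rewrite -[RHS]mulN1r -itgZ//.
by apply: itg_ext => x _; rewrite mulN1r.
Qed.

Lemma itg_cst a b k : a <= b -> itg a b (fun=> k) = k * (b - a).
Proof.
move=> ab; rewrite /itg Rintegral_cst//; congr (_ * _).
suff: (leb `[a, b]%classic = (b - a)%:E)%E by move=> /(congr1 fine).
rewrite lebesgue_measure_itv/= lte_fin; case: ltgtP ab => // -> _.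
by rewrite subrr.
Qed.

Lemma itg0 a b : itg a b (fun=> 0) = 0.
Proof. by rewrite /itg Rintegral_cst// mul0r. Qed.

Lemma itg_ge0 a b f : (forall x, a <= x <= b -> 0 <= f x) -> 0 <= itg a b f.
Proof. by move=> f0; apply: Rintegral_ge0 => x; rewrite /= in_itv => /f0. Qed.

Lemma itg_le a b f g : lbm1 f -> lbm1 g ->
  (forall x, a <= x <= b -> f x <= g x) -> itg a b f <= itg a b g.
Proof.
by move=> lf lg fg; apply: le_Rintegral => //; exact: lbm_integrable.
Qed.

Lemma itg_norm a b f : lbm1 f -> `|itg a b f| <= itg a b (fun x => `|f x|).
Proof. by move=> lf; apply: le_normr_Rintegral => //; exact: lbm_integrable. Qed.

(** Endpoints matter below: the boundary conditions hold only for t > 0, and the outlet trace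
    changes its formula at t = 0. *)
Lemma itg_ext_oo a b f g : lbm1 f -> lbm1 g ->
  (forall x, a < x < b -> f x = g x) -> itg a b f = itg a b g.
Proof.
move=> lf lg fg; rewrite /itg /Rintegral; congr fine.
have mE h (D : set R) : lbm1 h -> measurable_fun D (fun x => (h x)%:E).
  by move=> lh; apply/measurable_EFinP; exact: lbm_measurable.
rewrite [LHS]integral_itv_bndoo; last exact: mE.
rewrite [RHS]integral_itv_bndoo; last exact: mE.
by apply: eq_integral => x; rewrite inE/= in_itv/= => /fg ->.
Qed.

Lemma itg_split b a c f : a <= b <= c -> lbm1 f ->
  itg a c f = itg a b f + itg b c f.
Proof.
move=> /andP[ab bc] lf; rewrite /itg.
have /= := @Rintegral_itvB R f (BLeft a) (BRight c) b (lbm_integrable a c lf).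
rewrite !bnd_simp => /(_ ab bc) /eqP; rewrite subr_eq => /eqP ->.
rewrite addrC; congr (_ + _).
rewrite Rintegral_itv_obnd_cbnd//.
by apply: integrableS (lbm_integrable b c lf) => //; apply: subset_itvr; rewrite bnd_simp.
Qed.

Lemma itg_sub a b c k f : c <= a -> b <= k -> lbm1 f ->
  (forall x, c <= x <= k -> 0 <= f x) -> itg a b f <= itg c k f.
Proof.
move=> ca bk lf f0; have [ab|ba] := leP a b; last first.
  by rewrite itg_nil ?(ltW ba)// itg_ge0.
rewrite (@itg_split a c k) ?ca ?(le_trans ab)// (@itg_split b a k) ?ab//.
rewrite addrCA lerDl addr_ge0// itg_ge0// => x /andP[h1 h2]; apply: f0.
  by rewrite h1 (le_trans h2)// (le_trans ab).
by rewrite h2 (le_trans _ h1)// (le_trans ca).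
Qed.

(** Moves variable limits into the integrand, as Fubini on a rectangle requires. *)
Lemma itg_ind a b p q f : lbm1 f -> a <= p -> q <= b ->
  itg p q f = itg a b (fun x => ((p <= x <= q)%R)%:R * f x).
Proof.
move=> lf ap qb; rewrite /itg.
rewrite Rintegral_mkcond [RHS]Rintegral_mkcond; apply: eq_Rintegral => x _.
have memE c k : (x \in `[c, k]%classic) = (c <= x <= k).
  by apply/idP/idP; rewrite inE/= in_itv.
rewrite !patchE !memE; case: ifP => [/andP[px xq]|h]; case: ifP => [h'|h'] //=.
- by rewrite mul1r.
- by move: h'; rewrite (le_trans ap px) (le_trans xq qb).
- by rewrite mul0r.
Qed.

End itg.

(** * Affine changes of variables *)

Section affine.
Context {R : realType}.
Local Notation leb := (@lebesgue_measure R).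
Local Notation TR := (measurableTypeR R).

Definition affine (k l : R) (x : TR) : TR := k * x + l.

Lemma measurable_affine k l : measurable_fun setT (affine k l).
Proof.
apply: (@measurable_funD _ _ _ _ (fun x : TR => k * x) (cst l)) => //.
by apply: measurable_funM => //; exact: measurable_id.
Qed.

Local Notation pushm mphi :=
  (measure_function_pushforward__canonical__measure_function_Measure leb mphi).

(** Both sides are measures that agree on half-open intervals. A negative slope exchanges the closed
    and the open end of the preimage, which does not change its length. *)
Lemma lebesgue_affine (k l : R) (k0 : k != 0) (A : set R) : measurable A ->
  (`|k|%:E * pushforward leb (affine k l) A)%E = leb A.
Proof.
move=> mA; pose kn := NngNum (normr_ge0 k).
transitivity (mscale kn (pushm (measurable_affine k l)) A); first by [].
apply/esym/lebesgue_measure_unique => //= _ [[a b]] _ <-.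
rewrite /mscale/= /pushforward; have [kn0|kp|k00] := ltgtP k 0; last first.
- by rewrite k00 eqxx in k0.
- have -> : affine k l @^-1` `]a, b] = `](a - l) / k, (b - l) / k]%classic.
    apply/seteqP; split => x /=; rewrite !in_itv/= /affine => /andP[ax xb].
      by rewrite ltr_pdivrMr// ler_pdivlMr// ![x * k]mulrC ltrBlDr ax lerBrDr.
    move: ax xb; rewrite ltr_pdivrMr// ler_pdivlMr// ![x * k]mulrC.
    by rewrite ltrBlDr lerBrDr => -> ->.
  rewrite !lebesgue_measure_itv/= !lte_fin.
  rewrite ltr_pM2r ?invr_gt0// ltrD2r; case: ifP => _; last by rewrite mule0.
  by rewrite -!EFinD -EFinM gtr0_norm//; congr EFin; field.
- have -> : affine k l @^-1` `]a, b] = `[(b - l) / k, (a - l) / k[%classic.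
    apply/seteqP; split => x /=; rewrite !in_itv/= /affine => /andP[ax xb].
      by rewrite ltr_ndivlMr// ler_ndivrMr// ![x * k]mulrC ltrBlDr ax lerBrDr xb.
    move: ax xb; rewrite ltr_ndivlMr// ler_ndivrMr// ![x * k]mulrC.
    by rewrite ltrBlDr lerBrDr => -> ->.
  rewrite !lebesgue_measure_itv/= !lte_fin.
  rewrite ltr_nM2r ?invr_lt0// ltrD2r; case: ifP => _; last by rewrite mule0.
  by rewrite -!EFinD -EFinM ltr0_norm//; congr EFin; field.
Qed.

(** Nonnegative integrands are handled in the extended reals; a general f is (f + |f|) - |f|. *)
Lemma itg_pushforward (phi : TR -> TR) (mphi : measurable_fun setT phi) (f : R -> R) (k : R) (k0 : 0 < k) a b p q :
  (forall A : set R, measurable A -> (k%:E * pushforward leb phi A)%E = leb A) ->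
  lbm1 phi -> phi @^-1` `[p, q] = `[a, b]%classic ->
  lbm1 f -> k * itg a b (f \o phi) = itg p q f.
Proof.
move=> kphi lphi pre lf.
have nn g : lbm1 g -> (forall x, 0 <= g x) -> k * itg a b (g \o phi) = itg p q g.
  move=> lg g0; rewrite /itg /Rintegral -pre.
  have mg : measurable_fun [set: TR] (EFin \o g) by apply/measurable_EFinP; case: lg.
  rewrite (_ : (\int[leb]_(x in phi @^-1` `[p, q]) ((g \o phi) x)%:E)%E =
               (\int[pushm mphi]_(x in `[p, q]) (g x)%:E)%E); last first.
    rewrite ge0_integral_pushforward//; first exact: measurable_funTS.
    by move=> x _; rewrite lee_fin.
  pose kn := NngNum (ltW k0).
  have -> : (\int[leb]_(x in `[p, q]) (g x)%:E =
             \int[mscale kn (pushm mphi)]_(x in `[p, q]) (g x)%:E)%E.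
    by apply: eq_measure_integral => A mA _; exact: (esym (kphi A mA)).
  rewrite ge0_integral_mscale//=; first last.
    by move=> x _; rewrite lee_fin.
    exact: measurable_funTS.
  (* [J] could be infinite a priori; the finiteness of k * J together with k > 0 excludes this. *)
  set J := (\int[_]_(x in _) _)%E.
  have := integral_fin_num p q lg.
  have -> : (\int[leb]_(x in `[p, q]) (EFin \o g) x = k%:E * J)%E.
    rewrite -(@ge0_integral_mscale _ _ _ (pushm mphi) _ _ kn)//=; first last.
    - by move=> x _; rewrite lee_fin.
    - exact: measurable_funTS.
    by apply: eq_measure_integral => A mA _; exact: (esym (kphi A mA)).
  have : (0 <= J)%E by rewrite /J; apply: (@integral_ge0 _ _ _ (pushm mphi)) => x hx; rewrite lee_fin.
  clearbody J; move=> J0 Jfin; destruct J as [j| |] => //=; move: Jfin.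
  by rewrite mulry gtr0_sg ?mul1e.
have lf1 : lbm1 (fun x => f x + `|f x|) by lbm.
have lf2 : lbm1 (fun x => `|f x|) by lbm.
rewrite (_ : itg p q f = itg p q (fun x => (f x + `|f x|) - `|f x|)); last first.
  by apply: itg_ext => x _; rewrite addrK.
rewrite (_ : itg a b (f \o phi) =
    itg a b (fun x => ((f (phi x) + `|f (phi x)|) - `|f (phi x)|))); last first.
  by apply: itg_ext => x _; rewrite addrK.
have lfp : lbm1 (fun x => f (phi x)) by exact: lbm_comp1.
rewrite !itgB; [|by lbm|by lbm|by lbm|by lbm].
rewrite mulrBr; congr (_ - _); first (apply: (nn (fun x => f x + `|f x|)) => // x).
  by have := ler_norm (- f x); rewrite normrN; lra.
exact: (nn (fun x => `|f x|)).
Qed.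

Lemma lbm_affine k l : lbm1 (affine k l).
Proof. rewrite /affine; lbm. Qed.

Lemma itg_affine k l a b (f : R -> R) : 0 < k -> lbm1 f ->
  itg a b (fun x => f (k * x + l)) = k^-1 * itg (k * a + l) (k * b + l) f.
Proof.
move=> k0 lf; apply: (mulfI (lt0r_neq0 k0)); rewrite mulrA divff ?mul1r ?gt_eqF//.
apply: (@itg_pushforward (affine k l) (measurable_affine k l) f k k0) => //.
- by move=> A mA; rewrite -[in RHS](@lebesgue_affine k l) ?gt_eqF// gtr0_norm.
- exact: lbm_affine.
apply/seteqP; split => x /=; rewrite !in_itv/= /affine.
  by rewrite !lerD2r !ler_pM2l.
by rewrite !lerD2r !ler_pM2l.
Qed.

Lemma itg_affine_neg k l a b (f : R -> R) : k < 0 -> lbm1 f ->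
  itg a b (fun x => f (k * x + l)) = (- k)^-1 * itg (k * b + l) (k * a + l) f.
Proof.
move=> k0 lf; have nk0 : 0 < - k by rewrite oppr_gt0.
apply: (mulfI (lt0r_neq0 nk0)); rewrite mulrA divff ?mul1r ?gt_eqF//.
apply: (@itg_pushforward (affine k l) (measurable_affine k l) f (- k) nk0) => //.
- by move=> A mA; rewrite -[in RHS](@lebesgue_affine k l) ?lt_eqF// ltr0_norm.
- exact: lbm_affine.
apply/seteqP; split => x /=; rewrite !in_itv/= /affine.
  by rewrite !lerD2r !ler_nM2l// andbC.
by rewrite !lerD2r !ler_nM2l// andbC.
Qed.

Lemma itg_shift a b l (f : R -> R) : lbm1 f -> itg a b (fun x => f (x + l)) = itg (a + l) (b + l) f.
Proof.
move=> lf; have := @itg_affine 1 l a b f ltr01 lf.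
by rewrite !mul1r invr1 mul1r => <-; apply: itg_ext => x _; rewrite mul1r.
Qed.

Lemma itg_refl a b l (f : R -> R) : lbm1 f -> itg a b (fun x => f (l - x)) = itg (l - b) (l - a) f.
Proof.
move=> lf; have := @itg_affine_neg (-1) l a b f (ltrN10 _) lf.
rewrite !mulN1r opprK invr1 mul1r ![_ + l]addrC => <-.
by apply: itg_ext => x _; rewrite mulN1r addrC.
Qed.

End affine.

(** * Integrals depending on parameters, and Fubini's theorem *)

Section fubini.
Context {R : realType}.
Local Notation leb := (@lebesgue_measure R).
Local Notation TR := (measurableTypeR R).

Lemma itgE (f : R -> R) a b : lbm1 f ->
  (itg a b f)%:E = (\int[leb]_(x in `[a, b]) (f x)%:E)%E.
Proof.
move=> lf; rewrite /itg /Rintegral fineK//.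
exact: integral_fin_num.
Qed.

(** Measurability in the parameter comes from Tonelli, applied to the positive and the negative part
    of the integrand restricted to [a, b]. *)
Lemma lbm_itg_fix d (T : measurableType d) (n : T -> R) (F : T -> R -> R) a b :
  lbm (T := (T * TR)%type) (psize n) (fun p => F p.1 p.2) ->
  lbm n (fun z => itg a b (F z)).
Proof.
move=> [mF bF]; have mFz z : measurable_fun setT (F z).
  by apply: (@measurableT_comp _ _ _ _ _ _ _ _ (fun x => (z, x)) mF);
    exact: pair1_measurable.
have lFz z : lbm1 (F z).
  split; first exact: mFz.
  move=> M; have [B hB] := bF (Num.max (n z) M).
  by exists B => x hx; apply: (hB (z, x)); rewrite /psize/= ge_max !le_max lexx hx orbT.
split.
  have mi : measurable_fun setT (fun z => (\int[leb]_(x in `[a, b]) (F z x)%:E)%E).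
    pose G := fun p : T * TR => ((EFin \o F p.1) \_ `[a, b]) p.2.
    have mE : measurable_fun [set: (T * TR)%type] G.
      rewrite /G.
      rewrite (_ : (fun _ => _) =
          ((fun p => (F p.1 p.2)%:E) \_ (setT `*` `[a, b]))); last first.
        apply/funext => -[z x]; rewrite !patchE/=; congr (if _ then _ else _).
        by apply/idP/idP; rewrite !inE//= => -[].
      apply/(measurable_restrictT _ _).1; first exact: measurableX.
      by apply: measurable_funTS; exact/measurable_EFinP.
    rewrite (_ : (fun _ => _) = (fun z =>
        (\int[leb]_x ((EFin \o F z) \_ `[a, b])^\+%E x) -
        (\int[leb]_x ((EFin \o F z) \_ `[a, b])^\-%E x))%E); last first.
      by apply/funext => z; rewrite integral_mkcond integralE.
    apply: emeasurable_funB.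
      have := @measurable_fun_fubini_tonelli_F _ _ T TR R leb (G^\+)%E
        (measurable_funepos mE) (funepos_ge0 G).
      move=> h; apply: eq_measurable_fun h => z _.
      by rewrite /fubini_F; apply: eq_integral => x _; rewrite /G ?(funeposE, funenegE).
    have := @measurable_fun_fubini_tonelli_F _ _ T TR R leb (G^\-)%E
      (measurable_funeneg mE) (funeneg_ge0 G).
    move=> h; apply: eq_measurable_fun h => z _.
      by rewrite /fubini_F; apply: eq_integral => x _; rewrite /G ?(funeposE, funenegE).
  exact: (measurableT_comp (@fine_measurable R setT measurableT)).
move=> M; have [B hB] := bF (Num.max M (Num.max `|a| `|b|)).
have [ba|ab] := leP b a.
  by exists 0 => z _; rewrite itg_nil// normr0.
exists (B * (b - a)) => z hz.
rewrite (le_trans (itg_norm _ _ (lFz z)))//.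
have lz := lFz z; rewrite -itg_cst ?(ltW ab)//; apply: itg_le; [by lbm|by lbm|].
move=> x axb; apply: (hB (z, x)); rewrite /psize/= ge_max !le_max hz/=.
by move/norm_le_max: axb; rewrite le_max => ->; rewrite orbT.
Qed.

End fubini.

Section fubini2.
Context {R : realType}.
Local Notation leb := (@lebesgue_measure R).
Local Notation TR := (measurableTypeR R).

Lemma lbm2_swap (F : R -> R -> R) : lbm2 F -> lbm2 (fun x y => F y x).
Proof. by move=> lF; lbm. Qed.

Lemma itg_fubini (F : R -> R -> R) a b c k : lbm2 F ->
  itg a b (fun x => itg c k (F x)) = itg c k (fun y => itg a b (F ^~ y)).
Proof.
move=> lF; apply: EFin_inj.
have lFx x : lbm1 (F x) by lbm.
have lFy y : lbm1 (F ^~ y) by lbm.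
have lFs : lbm2 (fun y x => F x y) by exact: lbm2_swap.
have h1 : lbm1 (fun x => itg c k (F x)) by exact: (@lbm_itg_fix R _ TR).
have h2 : lbm1 (fun y => itg a b (F ^~ y)).
  exact: (@lbm_itg_fix R _ TR _ (fun y x => F x y)).
rewrite (itgE _ _ h1) (itgE _ _ h2).
under eq_integral do rewrite itgE//.
under [RHS]eq_integral do rewrite itgE//.
pose D := (`[a, b] `*` `[c, k] : set (TR * TR)).
pose G := (fun p : TR * TR => (F p.1 p.2)%:E) \_ D.
have mD : measurable D by exact: measurableX.
have iG : (leb \x leb)%E.-integrable setT G.
  rewrite /G; apply: (integrable_mkcond _ mD).1.
  have := @measurable_bounded_integrable _ (TR * TR)%type R (leb \x leb)%E
    (fun p => F p.1 p.2) D mD.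
  apply.
  - change ((leb \x leb)%E (`[a, b]%classic `*` `[c, k]%classic) < +oo)%E.
    rewrite product_measure1E//; apply: lte_mul_pinfty; first exact: measure_ge0.
      by rewrite ge0_fin_numE ?measure_ge0//; exact: lebesgue_itvcc.
    exact: lebesgue_itvcc.
  - by apply: measurable_funTS; case: lF.
  case: lF => _ /(_ (Num.max (Num.max `|a| `|b|) (Num.max `|c| `|k|)))[B hB].
  exists B; split; first exact: num_real.
  move=> y By [x z] /= [/=]; rewrite !in_itv/= => axb czk.
  rewrite (le_trans _ (ltW By))// (hB (x, z))// /psize/= ge_max.
  rewrite (le_trans (norm_le_max axb)) ?(le_trans (norm_le_max czk))//.
    by rewrite le_max lexx orbT.
  by rewrite le_max lexx.
have := Fubini iG.
have -> : (\int[leb]_x \int[leb]_y G (x, y) =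
           \int[leb]_(x in `[a, b]) \int[leb]_(y in `[c, k]) (F x y)%:E)%E.
  rewrite [RHS]integral_mkcond; apply: eq_integral => x _; rewrite !patchE.
  case: ifPn => xab.
    rewrite [RHS]integral_mkcond; apply: eq_integral => y _.
    rewrite /G !patchE /D; case: ifPn => h; case: ifPn => h' //.
      by move: h h'; rewrite !notin_setE !in_setE/= => -[].
    by move: h h' xab; rewrite notin_setE !in_setE/= => h h' xab; exfalso; apply: h.
  rewrite -[RHS](integral0 leb setT); apply: eq_integral => y _.
  by rewrite /G patchE ifF//; apply/negbTE; move: xab; rewrite !notin_setE /D/= => h [].
have -> : (\int[leb]_y \int[leb]_x G (x, y) =
           \int[leb]_(y in `[c, k]) \int[leb]_(x in `[a, b]) (F x y)%:E)%E.
  rewrite [RHS]integral_mkcond; apply: eq_integral => y _; rewrite !patchE.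
  case: ifPn => yab.
    rewrite [RHS]integral_mkcond; apply: eq_integral => x _.
    rewrite /G !patchE /D; case: ifPn => h; case: ifPn => h' //.
      by move: h h'; rewrite !notin_setE !in_setE/= => -[].
    by move: h h' yab; rewrite notin_setE !in_setE/= => h h' yab; exfalso; apply: h.
  rewrite -[RHS](integral0 leb setT); apply: eq_integral => x _.
  by rewrite /G patchE ifF//; apply/negbTE; move: yab; rewrite !notin_setE /D/= => h [].
by [].
Qed.

(** With an indicator in the integrand the limits can be frozen at -M and M as long as |p| and |q|
    are at most M. Hence the integral is the pointwise limit of the versions over [-k, k], a
    sequence eventually constant at each point. *)
Lemma lbm_itg d (T : measurableType d) (n : T -> R) (F : T -> R -> R) (p q : T -> R) :
  lbm (T := (T * TR)%type) (psize n) (fun p => F p.1 p.2) ->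
  lbm n p -> lbm n q ->
  lbm n (fun z => itg (p z) (q z) (F z)).
Proof.
move=> lF lp lq.
have lFz z : lbm1 (F z).
  split; last first.
    move=> M; have [B hB] := lF.2 (Num.max (n z) M).
    by exists B => x hx; apply: (hB (z, x)); rewrite /psize/= ge_max !le_max lexx hx orbT.
  by apply: (@measurableT_comp _ _ _ _ _ _ _ _ (fun x => (z, x)) lF.1);
    exact: pair1_measurable.
pose G (M : R) z x := ((p z <= x <= q z)%R)%:R * F z x.
have lG M : lbm (T := (T * TR)%type) (psize n) (fun r => G M r.1 r.2).
  rewrite /G; apply: lbmM => //; apply: lbm_and; apply: lbm_le;
    solve [exact: lbm_fst|exact: lbm_snd].
have gE M z : `|p z| <= M -> `|q z| <= M -> itg (p z) (q z) (F z) = itg (- M) M (G M z).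
  move=> hp hq; apply: itg_ind => //; first by move: hp; rewrite ler_norml => /andP[].
  by move: hq; rewrite ler_norml => /andP[].
split.
  apply: (@measurable_fun_cvg _ _ _ _ (fun k z => itg (- k%:R) k%:R (G k%:R z))).
    by move=> k; have [] := lbm_itg_fix (- k%:R) k%:R (lG k%:R).
  move=> z _; apply: cvg_near_cst.
  near=> k; apply/esym/gE.
    by rewrite ltW//; near: k; exact: nbhs_infty_gtr.
  by rewrite ltW//; near: k; exact: nbhs_infty_gtr.
move=> M; have [A hA] := lp.2 M; have [B hB] := lq.2 M.
have [K hK] := (lbm_itg_fix (- Num.max A B) (Num.max A B) (lG 0)).2 M.
by exists K => z hz; rewrite (gE (Num.max A B)) ?le_max ?hA ?hB ?orbT//; exact: hK.
Unshelve. all: by end_near. Qed.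

End fubini2.

Ltac lbm_leaf ::=
  lazymatch goal with |- lbm _ (fun z => itg _ _ _) => apply: lbm_itg end.

(** * Cauchy-Schwarz, product rule and Gronwall for integrals *)

Section calculus.
Context {R : realType}.
Implicit Types (f g : R -> R) (a b c k : R).

Lemma itg_cauchy_schwarz a b f g : lbm1 f -> lbm1 g ->
  itg a b (fun x => f x * g x) ^+ 2 <=
  itg a b (fun x => f x ^+ 2) * itg a b (fun x => g x ^+ 2).
Proof.
move=> lf lg.
set A := itg a b (fun x => f x ^+ 2); set B := itg a b _; set C := itg a b _.
have C0 : 0 <= C by apply: itg_ge0 => x _; exact: sqr_ge0.
have A0 : 0 <= A by apply: itg_ge0 => x _; exact: sqr_ge0.
have Q s : 0 <= A - 2 * s * B + s ^+ 2 * C.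
  have -> : A - 2 * s * B + s ^+ 2 * C = itg a b (fun x => (f x - s * g x) ^+ 2).
    rewrite -!itgZ; [|by lbm|by lbm].
    rewrite -itgB; [|by lbm|by lbm].
    rewrite -itgD; [|by lbm|by lbm].
    by apply: itg_ext => x _; ring.
  by apply: itg_ge0 => x _; exact: sqr_ge0.
have [C00|Cn0] := eqVneq C 0.
  rewrite C00 mulr0.
  have [B0|Bn0] := eqVneq B 0; first by rewrite B0 expr0n.
  (* For C = 0 the quadratic is affine in s, and this s would give it the value -1. *)
  have := Q ((A + 1) / (2 * B)).
  have -> : 2 * ((A + 1) / (2 * B)) * B = A + 1 by field.
  by rewrite C00 mulr0; lra.
have Cp : 0 < C by rewrite lt_def Cn0.
have := Q (B / C).
have -> : A - 2 * (B / C) * B + (B / C) ^+ 2 * C = (A * C - B ^+ 2) / C by field.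
by rewrite pmulr_lge0 ?invr_gt0// subr_ge0.
Qed.

Lemma itg_sqr_le a b f : a <= b -> lbm1 f ->
  itg a b f ^+ 2 <= (b - a) * itg a b (fun x => f x ^+ 2).
Proof.
move=> ab lf; have l1 : lbm1 (fun _ : R => 1 : R) by lbm.
have := itg_cauchy_schwarz a b l1 lf.
rewrite (_ : itg a b (fun=> 1 ^+ 2) = b - a); last first.
  by rewrite expr1n itg_cst// mul1r.
by rewrite (_ : itg a b (fun x => 1 * f x) = itg a b f)//; apply: itg_ext => x _; rewrite mul1r.
Qed.

Lemma itg_triangle (F : R -> R -> R) a b : lbm2 F ->
  itg a b (fun x => itg a x (F x)) = itg a b (fun y => itg y b (F ^~ y)).
Proof.
move=> lF.
transitivity (itg a b (fun x => itg a b (fun y => ((a <= y <= x)%R)%:R * F x y))).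
  by apply: itg_ext => x /andP[ax xb]; apply: itg_ind => //; lbm.
rewrite itg_fubini; last by lbm.
apply: itg_ext => y /andP[ay yb].
rewrite [RHS](@itg_ind _ a b)//; last by lbm.
by apply: itg_ext => x /andP[ax xb]; rewrite ay xb andbT.
Qed.

(** F and G are only primitives of bounded measurable functions, so Fubini on the triangle takes the
    place of differentiation: the two halves of the square [0, h]^2 add up to the product of the two
    increments. *)
Lemma product_rule (F G f g : R -> R) h : 0 <= h -> lbm1 f -> lbm1 g ->
  (forall s, 0 <= s <= h -> F s = F 0 + itg 0 s f) ->
  (forall s, 0 <= s <= h -> G s = G 0 + itg 0 s g) ->
  F h * G h = F 0 * G 0 + itg 0 h (fun s => F s * g s + f s * G s).
Proof.
move=> h0 lf lg hF hG.
rewrite (_ : itg 0 h (fun s => F s * g s + f s * G s) =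
  itg 0 h (fun s => (F 0 * g s + G 0 * f s) +
    (itg 0 s (fun r => f r * g s) + itg 0 s (fun r => f s * g r)))); last first.
  apply: itg_ext => s hs; rewrite hF// [G s]hG// itgZr// itgZ//; ring.
rewrite itgD; [|by lbm|by lbm]; rewrite itgD; [|by lbm|by lbm].
rewrite itgD; [|by lbm|by lbm]; rewrite !itgZ//.
rewrite [X in _ + (_ + (_ + X))](@itg_triangle (fun s r => f s * g r)); last by lbm.
rewrite -itgD; [|by lbm|by lbm].
rewrite (_ : itg 0 h (fun x => _ + _) = itg 0 h f * itg 0 h g); last first.
  rewrite -itgZ//; apply: itg_ext => s hs.
  by rewrite -itgZr// [RHS](@itg_split _ s)//; lbm.
by rewrite hF ?h0 ?lexx// [G h]hG ?h0 ?lexx//; ring.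
Qed.

Lemma sqr_rule (F f : R -> R) h : 0 <= h -> lbm1 f ->
  (forall s, 0 <= s <= h -> F s = F 0 + itg 0 s f) ->
  F h ^+ 2 = F 0 ^+ 2 + itg 0 h (fun s => 2 * (F s * f s)).
Proof.
move=> h0 lf hF; rewrite !expr2 (product_rule h0 lf lf hF hF).
by congr (_ + _); apply: itg_ext => s _; ring.
Qed.

Lemma itg_exp k a b : k != 0 -> a <= b ->
  itg a b (fun x => expR (k * x)) = (expR (k * b) - expR (k * a)) / k.
Proof.
move=> k0; rewrite le_eqVlt => /predU1P[->|ab].
  by rewrite itg_nil// subrr mul0r.
have dF (x : R) : is_derive x 1 (fun x => k^-1 * expR (k * x)) (expR (k * x)).
  apply: is_derive_eq; rewrite /GRing.scale/=; field.
  done.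
have cF : continuous (fun x : R => k^-1 * expR (k * x)).
  by move=> x; apply: differentiable_continuous; apply/derivable1_diffP; case: (dF x).
have cE : continuous (fun x : R => expR (k * x)).
  move=> x; apply: (@continuous_comp _ _ _ (fun x : R => k * x) expR).
    exact: mulrl_continuous.
  exact: continuous_expR.
rewrite /itg /Rintegral (@continuous_FTC2 _ _ (fun x => k^-1 * expR (k * x)))//=.
- by rewrite -mulrBr mulrC.
- by apply: continuous_subspaceT; exact: cE.
- split.
  + by move=> x _; case: (dF x).
  + exact/cvg_at_right_filter/cF.
  + exact/cvg_at_left_filter/cF.
- by move=> x _; rewrite derive1E; case: (dF x).
Qed.

(** Against the weight exp(-2 C t) the Volterra term is at most half of the weighted integral of psi
    and is absorbed; this is the origin of the factor 2 in front. Removing the weight costs exp(2 C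
    T). *)
Lemma gronwall C T (psi b : R -> R) : 0 < C -> 0 <= T -> lbm1 psi -> lbm1 b ->
  (forall t, 0 <= t <= T -> 0 <= psi t) -> (forall t, 0 <= t <= T -> 0 <= b t) ->
  (forall t, 0 <= t <= T -> psi t <= b t + C * itg 0 t psi) ->
  itg 0 T psi <= 2 * expR (2 * C * T) * itg 0 T b.
Proof.
move=> C0 T0 lp lb p0 b0 hp.
pose w t := expR (- (2 * C) * t).
have w0 t : 0 < w t by exact: expR_gt0.
have lw : lbm1 w by rewrite /w; lbm.
set X := itg 0 T (fun t => w t * psi t).
have X1 : X <= itg 0 T (fun t => w t * b t) +
    C * itg 0 T (fun t => itg 0 t (fun s => w t * psi s)).
  rewrite -itgZ; last by lbm.
  rewrite -itgD; [|by lbm|by lbm].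
  apply: itg_le; [by lbm|by lbm|].
  move=> t ht; rewrite itgZ// (mulrCA C) -mulrDr ler_pM2l//; exact: hp.
have X2 : itg 0 T (fun t => itg 0 t (fun s => w t * psi s)) <= X / (2 * C).
  rewrite (@itg_triangle (fun t s => w t * psi s)); last by lbm.
  rewrite /X -itgZr; last by lbm.
  apply: itg_le; [by lbm|by lbm|].
  move=> s hs; rewrite itgZr//; have /andP[s0 sT] := hs.
  rewrite mulrAC ler_wpM2r ?p0// itg_exp//; last first.
    by rewrite oppr_eq0 mulf_neq0// gt_eqF.
  rewrite invrN mulrN -mulNr opprB ler_wpM2r ?invr_ge0//.
    by rewrite mulr_ge0 ?(ltW C0).
  by rewrite lerBlDr /w lerDl expR_ge0.
have X3 : X <= 2 * itg 0 T (fun t => w t * b t).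
  have : X <= itg 0 T (fun t => w t * b t) + C * (X / (2 * C)).
    by apply: (le_trans X1); rewrite lerD2l ler_pM2l.
  have -> : C * (X / (2 * C)) = X / 2 by field; rewrite gt_eqF.
  lra.
have X4 : itg 0 T (fun t => w t * b t) <= itg 0 T b.
  apply: itg_le; [by lbm|by lbm|].
  move=> t ht; rewrite ler_piMl ?b0//.
  rewrite -expR0 ler_expR mulNr oppr_le0; have /andP[t0 _] := ht.
  by rewrite mulr_ge0 ?mulr_ge0 ?(ltW C0).
have X5 : expR (- (2 * C * T)) * itg 0 T psi <= X.
  rewrite -itgZ//; apply: itg_le; [by lbm|by lbm|].
  move=> t ht; rewrite ler_wpM2r ?p0// ler_expR; have /andP[t0 tT] := ht.
  by rewrite mulNr lerN2 ler_pM2l ?mulr_gt0.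
have eE : expR (2 * C * T) * (expR (- (2 * C * T)) * itg 0 T psi) = itg 0 T psi.
  by rewrite mulrA -expRD subrr expR0 mul1r.
rewrite -eE (_ : 2 * _ * _ = expR (2 * C * T) * (2 * itg 0 T b)); last by ring.
rewrite ler_pM2l ?expR_gt0//; lra.
Qed.

End calculus.

(** * The plant: outlet trace and energy *)

Section plant.
Context {R : realType}.
Variables (lambda mu r cbar : R).
Hypotheses (lambda0 : 0 < lambda) (mu0 : 0 < mu) (r0 : 0 < r) (cbar0 : 0 < cbar).
Local Notation d := (lambda^-1).
Local Notation h := (mu^-1).

Variables (c : R -> R) (u v : R -> R -> R).
Hypotheses (lc : lbm1 c) (lu : lbm2 u) (lv : lbm2 v).
Hypothesis cb : forall x, 0 <= x <= 1 -> `|c x| <= cbar.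
Hypothesis tu : forall x t s, 0 <= t -> 0 <= s -> 0 <= x -> x + lambda * s <= 1 ->
  u (x + lambda * s) (t + s) = u x t.
Hypothesis tv : forall x t s, 0 <= t -> 0 <= s -> x <= 1 -> 0 <= x - mu * s ->
  v (x - mu * s) (t + s) =
  v x t + itg 0 s (fun z => c (x - mu * z) * u (x - mu * z) (t + z)).
Hypothesis bu : forall t, 0 < t -> u 0 t = r * v 0 t.

(* The outlet trace of v, continued to negative times by the initial profile
   of u: all of u is a delayed copy of it. *)
Definition trace (t : R) : R :=
  if 0 < t then v 0 t else if - d <= t then u (- (lambda * t)) 0 / r else 0.
Local Notation y := trace.
Definition traceQ a b : R := itg a b (fun t => y t ^+ 2).
Local Notation Q := traceQ.
Definition energy (t : R) : R := itg 0 1 (fun x => u x t ^+ 2 + v x t ^+ 2).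
Local Notation m := energy.

Let ln0 : lambda != 0. Proof. by rewrite gt_eqF. Qed.
Let mn0 : mu != 0. Proof. by rewrite gt_eqF. Qed.
Let rn0 : r != 0. Proof. by rewrite gt_eqF. Qed.
Let d0 : 0 < d. Proof. by rewrite invr_gt0. Qed.
Let h0 : 0 < h. Proof. by rewrite invr_gt0. Qed.

Lemma lbm_trace : lbm1 y.
Proof. rewrite /y; lbm. Qed.
Let ly := lbm_trace.

Lemma lbm_energy : lbm1 m.
Proof. rewrite /m; lbm. Qed.

Lemma u_trace x t : 0 <= x <= 1 -> 0 <= t -> u x t = r * y (t - x * d).
Proof.
move=> /andP[x0 x1] t0; rewrite /y; case: ifPn => [tx|].
  rewrite -bu//; have := @tu 0 (t - x * d) (x * d) (ltW tx).
  rewrite add0r subrK mulrCA divff// mulr1; apply => //.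
  by rewrite mulr_ge0// ltW.
rewrite -leNgt => tx; rewrite ifT; last first.
  by have : x * d <= d; [rewrite ler_piMl// ltW|lra].
rewrite mulrCA divff// mulr1.
have e1 : - (lambda * (t - x * d)) = x - lambda * t by field.
rewrite e1; have := @tu (x - lambda * t) 0 t (lexx _) t0.
rewrite subrK add0r; apply => //.
by rewrite -e1 oppr_ge0 pmulr_rle0.
Qed.

Lemma trace_v x t : 0 <= x <= 1 -> 0 <= t -> 0 < t + x * h ->
  y (t + x * h) = v x t +
    itg 0 (x * h) (fun z => c (x - mu * z) * u (x - mu * z) (t + z)).
Proof.
move=> /andP[x0 x1] t0 tx; rewrite /y tx.
have := @tv x t (x * h) t0; have e1 : x - mu * (x * h) = 0 by field.
by rewrite e1; apply => //; rewrite mulr_ge0// ltW.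
Qed.

Lemma traceQ_ge0 a b : 0 <= Q a b.
Proof. by apply: itg_ge0 => t _; exact: sqr_ge0. Qed.

Lemma traceQ_sub a b a' b' : a' <= a -> b <= b' -> Q a b <= Q a' b'.
Proof.
move=> aa bb; have ly' := ly; apply: itg_sub => //; first by lbm.
by move=> t _; exact: sqr_ge0.
Qed.

Lemma traceQ_split b a e : a <= b <= e -> Q a e = Q a b + Q b e.
Proof. by move=> ab; have ly' := ly; apply: itg_split => //; lbm. Qed.

Lemma u_sqr_int t : 0 <= t -> itg 0 1 (fun x => u x t ^+ 2) = r ^+ 2 * lambda * Q (t - d) t.
Proof.
move=> t0; have ly' := ly.
rewrite (_ : itg 0 1 _ = itg 0 1 (fun x => r ^+ 2 * (fun z => y z ^+ 2) (- d * x + t))); last first.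
  apply: itg_ext => x hx; rewrite u_trace// exprMn; congr (_ * y _ ^+ 2).
  by rewrite mulNr addrC mulrC.
rewrite itgZ; last by lbm.
rewrite (@itg_affine_neg _ (- d) t 0 1 (fun z => y z ^+ 2)) ?oppr_lt0//; last by lbm.
by rewrite opprK invrK mulr0 mulr1 add0r (addrC _ t) mulrA.
Qed.

(** Along a characteristic of v the delayed argument of the trace advances at the rate k = 1 + mu /
    lambda >= 1, so the change of variables costs a factor at most 1. *)
Lemma char_u_sqr t s : 0 <= t -> 0 <= s <= h ->
  itg 0 s (fun z => u (mu * (s - z)) (t + z) ^+ 2) <= r ^+ 2 * Q (t - d) (t + s).
Proof.
move=> t0 /andP[s0 sh]; have ly' := ly.
have ms : mu * s <= 1 by rewrite -(ler_pM2l mu0) divff in sh.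
pose k := 1 + mu * d.
have k1 : 1 <= k by rewrite lerDl mulr_ge0 ?ltW.
have kp : 0 < k by apply: lt_le_trans k1.
rewrite (_ : itg 0 s _ = itg 0 s (fun z => r ^+ 2 * (fun q => y q ^+ 2) (k * z + (t - mu * s * d)))); last first.
  apply: itg_ext => z /andP[z0 zs]; rewrite u_trace; last first.
    by rewrite addr_ge0.
    by rewrite mulr_ge0 ?subr_ge0 ?(ltW mu0)//= (le_trans _ ms)// ler_pM2l// gerBl.
  by rewrite exprMn; congr (_ * y _ ^+ 2); rewrite /k; ring.
rewrite itgZ; last by lbm.
rewrite ler_pM2l ?exprn_gt0// (@itg_affine _ k _ 0 s (fun z => y z ^+ 2)); [|by []|by lbm].
apply: (@le_trans _ _ (itg (k * 0 + (t - mu * s * d)) (k * s + (t - mu * s * d)) (fun z => y z ^+ 2))).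
  rewrite ler_piMl ?invf_le1//; apply: itg_ge0 => x _; exact: sqr_ge0.
apply: traceQ_sub.
  by rewrite mulr0 add0r lerD2l lerN2 ler_piMl// ltW.
by rewrite le_eqVlt; apply/orP; left; apply/eqP; rewrite /k; ring.
Qed.

Lemma char_cu_sqr (w : R -> R) t s : 0 <= t -> 0 <= s <= h ->
  lbm1 w -> (forall x, 0 <= x <= 1 -> `|w x| <= cbar) ->
  itg 0 s (fun z => w (mu * (s - z)) * u (mu * (s - z)) (t + z)) ^+ 2 <=
  h * cbar ^+ 2 * r ^+ 2 * Q (t - d) (t + s).
Proof.
move=> t0 /[dup] hs /andP[s0 sh] lw wb.
have ms : mu * s <= 1 by rewrite -(ler_pM2l mu0) divff in sh.
apply: (le_trans (itg_sqr_le s0 _)); first by lbm.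
rewrite subr0 (_ : _ * Q _ _ = h * (cbar ^+ 2 * (r ^+ 2 * Q (t - d) (t + s)))); last by ring.
apply: ler_pM => //.
  by apply: itg_ge0 => x _; exact: sqr_ge0.
apply: (@le_trans _ _ (cbar ^+ 2 * itg 0 s (fun z => u (mu * (s - z)) (t + z) ^+ 2))).
  rewrite -itgZ; last by lbm.
  apply: itg_le; [by lbm|by lbm|] => z /andP[z0 zs].
  rewrite exprMn ler_wpM2r ?sqr_ge0// -[X in X <= _]real_normK ?num_real//.
  rewrite lerXn2r ?nnegrE ?(ltW cbar0)// wb//.
  by rewrite mulr_ge0 ?subr_ge0 ?(ltW mu0)//= (le_trans _ ms)// ler_pM2l// gerBl.
by rewrite ler_pM2l ?exprn_gt0// char_u_sqr.
Qed.

Lemma trace_v_char t s : 0 <= t -> 0 <= s <= h -> 0 < t + s ->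
  y (t + s) = v (mu * s) t +
    itg 0 s (fun z => c (mu * (s - z)) * u (mu * (s - z)) (t + z)).
Proof.
move=> t0 /andP[s0 sh] ts.
have ms : mu * s <= 1 by rewrite -(ler_pM2l mu0) divff in sh.
have e1 : mu * s * h = s by field.
have := @trace_v (mu * s) t; rewrite e1 => -> //; last by rewrite mulr_ge0 ?ms// ltW.
by congr (_ + _); apply: itg_ext => z _; rewrite mulrBr.
Qed.

Definition obs_rate : R := 2 * (h * cbar ^+ 2 * r ^+ 2).
Let nn2 (x a b : R) : 0 <= 2 * x ^+ 2 + obs_rate * Q a b.
Proof.
apply: addr_ge0; apply: mulr_ge0 => //; first exact: sqr_ge0.
  by rewrite /obs_rate !mulr_ge0 ?exprn_ge0// ltW.
exact: traceQ_ge0.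
Qed.

(** The first term recovers the past of the outlet from u. The second is the Gronwall factor over
    the travel time h for its future, with v and the known past as data. *)
Definition obs_const : R :=
  (r ^+ 2 * lambda)^-1 +
  2 * expR (2 * obs_rate * h) * (2 * h + h * obs_rate * (r ^+ 2 * lambda)^-1).

Lemma obs_rate_gt0 : 0 < obs_rate.
Proof. by rewrite /obs_rate !mulr_gt0 ?exprn_gt0. Qed.

Lemma v_sqr_int (t : R) : itg 0 h (fun s => v (mu * s) t ^+ 2) = h * itg 0 1 (fun x => v x t ^+ 2).
Proof.
have := @itg_affine _ mu 0 0 h (fun x => v x t ^+ 2) mu0.
rewrite mulr0 !addr0 divff// => <-; last by lbm.
by apply: itg_ext => x _; rewrite addr0.
Qed.

Lemma energy_split t : m t = itg 0 1 (fun x => u x t ^+ 2) + itg 0 1 (fun x => v x t ^+ 2).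
Proof. by rewrite /m itgD//; lbm. Qed.

(** On [t - d, t] the trace is u up to scaling. On [t, t + h] it is v plus an integral of c u along
    a characteristic, and u there depends on the trace up to the time considered: a Volterra
    inequality for y^2. *)
Lemma traceQ_energy t : 0 <= t -> Q (t - d) (t + h) <= obs_const * m t.
Proof.
move=> t0; have ly' := ly; rewrite (@traceQ_split t); last first.
  by rewrite gerBl lerDl !ltW.
have U := u_sqr_int t0.
have U0 : 0 <= itg 0 1 (fun x => u x t ^+ 2) by apply: itg_ge0 => x _; exact: sqr_ge0.
have V0 : 0 <= itg 0 1 (fun x => v x t ^+ 2) by apply: itg_ge0 => x _; exact: sqr_ge0.
have rl : 0 < r ^+ 2 * lambda by rewrite mulr_gt0// exprn_gt0.
have Qp : Q (t - d) t = (r ^+ 2 * lambda)^-1 * itg 0 1 (fun x => u x t ^+ 2).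
  by rewrite U mulrA mulVf ?gt_eqF// mul1r.
pose psi s := if 0 < s then y (t + s) ^+ 2 else 0.
have lpsi : lbm1 psi by rewrite /psi; lbm.
have Qf : Q t (t + h) = itg 0 h psi.
  transitivity (itg 0 h (fun s => y (s + t) ^+ 2)).
    rewrite (@itg_shift _ 0 h t (fun z => y z ^+ 2)); last by lbm.
    by rewrite add0r addrC.
  apply: itg_ext_oo; [by lbm|by []|] => s /andP[s0 _].
  by rewrite /psi s0 addrC.
pose b s := 2 * v (mu * s) t ^+ 2 + obs_rate * Q (t - d) t.
have lb : lbm1 b by rewrite /b; lbm.
have G : itg 0 h psi <= 2 * expR (2 * obs_rate * h) * itg 0 h b.
  apply: gronwall; rewrite ?obs_rate_gt0 ?ltW//.
  - by move=> s _; rewrite /psi; case: ifP => _; rewrite ?sqr_ge0.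
  - by move=> s _; exact: nn2.
  move=> s /andP[s0 sh].
  have Qps : itg 0 s psi = Q t (t + s).
    transitivity (itg 0 s (fun s => y (s + t) ^+ 2)); last first.
      rewrite (@itg_shift _ 0 s t (fun z => y z ^+ 2)); last by lbm.
      by rewrite add0r addrC.
    apply: itg_ext_oo; [by []|by lbm|] => z /andP[z0 _].
    by rewrite /psi z0 addrC.
  rewrite Qps /psi; case: ifPn => [sp|_]; last first.
    rewrite addr_ge0 ?nn2// mulr_ge0 ?(ltW obs_rate_gt0)//; exact: traceQ_ge0.
  rewrite trace_v_char ?s0//; last by rewrite ltr_wpDl.
  set A := v _ _; set B := itg _ _ _.
  have hB : B ^+ 2 <= h * cbar ^+ 2 * r ^+ 2 * Q (t - d) (t + s).
    by apply: char_cu_sqr => //; rewrite s0.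
  have hAB : (A + B) ^+ 2 <= 2 * A ^+ 2 + 2 * B ^+ 2.
    by have := sqr_ge0 (A - B); nra.
  apply: (le_trans hAB); rewrite /b -addrA lerD2l -mulrDr -traceQ_split; last first.
    by rewrite gerBl lerDl s0 ltW.
  by move: hB; rewrite /obs_rate; lra.
have ib : itg 0 h b = 2 * (h * itg 0 1 (fun x => v x t ^+ 2)) + h * obs_rate * Q (t - d) t.
  rewrite /b itgD; [|by lbm|by lbm].
  rewrite itgZ; last by lbm.
  rewrite v_sqr_int itg_cst ?(ltW h0)// subr0; ring.
rewrite Qf energy_split (le_trans (lerD (lexx _) G))// ib Qp /obs_const.
move: U0 V0; set U' := itg _ _ _; set V' := itg _ _ _ => U0 V0.
set E := 2 * expR _; have E0 : 0 <= E by rewrite mulr_ge0 ?expR_ge0.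
set k := _^-1; have k0 : 0 <= k by rewrite /k invr_ge0 ltW.
have hr0 : 0 <= h * obs_rate * k by rewrite mulr_ge0// mulr_ge0 ?(ltW h0)// ltW// obs_rate_gt0.
have p1 : 0 <= k * V' by rewrite mulr_ge0.
have p2 : 0 <= E * (2 * h) * U' by rewrite !mulr_ge0// ltW.
have p3 : 0 <= E * (h * obs_rate * k) * V' by rewrite mulr_ge0// mulr_ge0.
rewrite -subr_ge0.
have -> : (k + E * (2 * h + h * obs_rate * k)) * (U' + V') -
  (k * U' + E * (2 * (h * V') + h * obs_rate * (k * U'))) =
  k * V' + E * (2 * h) * U' + E * (h * obs_rate * k) * V' by ring.
by rewrite !addr_ge0.
Qed.

Definition ctr_const : R := r ^+ 2 * lambda + 2 * mu + 2 * (h * cbar ^+ 2 * r ^+ 2).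

Lemma v_sqr_trace t s : 0 <= t -> 0 <= s <= h -> 0 < t + s ->
  v (mu * s) t ^+ 2 <= 2 * y (t + s) ^+ 2 + obs_rate * Q (t - d) (t + h).
Proof.
move=> t0 /[dup] hs /andP[s0 sh] ts; have := trace_v_char t0 hs ts.
set B := itg _ _ _ => e.
have hB : B ^+ 2 <= h * cbar ^+ 2 * r ^+ 2 * Q (t - d) (t + s) by exact: char_cu_sqr.
have hQ : h * cbar ^+ 2 * r ^+ 2 * Q (t - d) (t + s) <= h * cbar ^+ 2 * r ^+ 2 * Q (t - d) (t + h).
  by rewrite ler_pM2l ?traceQ_sub ?lerD2l// !mulr_gt0 ?exprn_gt0.
have -> : v (mu * s) t = y (t + s) - B by rewrite e addrK.
have : (y (t + s) - B) ^+ 2 <= 2 * y (t + s) ^+ 2 + 2 * B ^+ 2.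
  by have := sqr_ge0 (y (t + s) + B); nra.
rewrite /obs_rate; lra.
Qed.

(** Solved for v, the representation of the trace is explicit: its integral term involves u alone,
    hence values of the trace within the window. *)
Lemma energy_traceQ t : 0 <= t -> m t <= ctr_const * Q (t - d) (t + h).
Proof.
move=> t0; have ly' := ly; rewrite energy_split u_sqr_int//.
have Q1 : Q (t - d) t <= Q (t - d) (t + h) by rewrite traceQ_sub// lerDl ltW.
have Q2 : Q t (t + h) <= Q (t - d) (t + h) by rewrite traceQ_sub// gerBl ltW.
have V : h * itg 0 1 (fun x => v x t ^+ 2) <=
    2 * Q t (t + h) + h * (obs_rate * Q (t - d) (t + h)).
  rewrite -v_sqr_int.
  rewrite (_ : itg 0 h _ = itg 0 h (fun s => if 0 < s then v (mu * s) t ^+ 2 else 0)); last first.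
    by apply: itg_ext_oo; [by lbm|by lbm|] => s /andP[-> _].
  have -> : 2 * Q t (t + h) + h * (obs_rate * Q (t - d) (t + h)) =
      itg 0 h (fun s => 2 * y (s + t) ^+ 2 + obs_rate * Q (t - d) (t + h)).
    rewrite itgD; [|by lbm|by lbm]. rewrite itgZ; last by lbm.
    rewrite itg_cst ?(ltW h0)// subr0 [X in _ + X]mulrC; congr (2 * _ + _).
    rewrite (@itg_shift _ 0 h t (fun z => y z ^+ 2)); last by lbm.
    by rewrite add0r addrC.
  apply: itg_le; [by lbm|by lbm|] => s hs; case: ifPn => [sp|_].
    by rewrite (addrC s t) v_sqr_trace// ltr_wpDl.
  exact: nn2.
have : itg 0 1 (fun x => v x t ^+ 2) <= 2 * mu * Q t (t + h) + obs_rate * Q (t - d) (t + h).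
  rewrite -(ler_pM2l h0) (le_trans V)// mulrDr lerD2r.
  by rewrite (_ : h * (2 * mu * _) = 2 * Q t (t + h))//; field.
have rl : 0 < r ^+ 2 * lambda by rewrite mulr_gt0// exprn_gt0.
move: Q1; rewrite -(ler_pM2l rl) => Q1.
move: Q2; rewrite -(@ler_pM2l _ (2 * mu)) ?mulr_gt0// => Q2.
rewrite /ctr_const -/obs_rate !mulrDl; lra.
Qed.

(* On a short time interval the values of u at x are a piece of the outlet trace
   that the state at any single time of the interval determines. *)
Lemma u_column_energy x a l s : 0 <= a -> 0 <= x -> x + lambda * l <= 1 -> 0 <= l <= h ->
  a <= s <= a + l ->
  itg a (a + l) (fun t => u x t ^+ 2) <= r ^+ 2 * obs_const * m s.
Proof.
move=> a0 x0 xl /andP[l0 lh] /andP[as_ sal]; have ly' := ly.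
have s0 := le_trans a0 as_.
apply: (@le_trans _ _ (r ^+ 2 * Q (s - d) (s + h))); last first.
  by rewrite -mulrA ler_pM2l ?exprn_gt0// traceQ_energy.
rewrite (_ : itg a (a + l) _ = itg a (a + l) (fun t => r ^+ 2 * (fun z => y z ^+ 2) (t + - (x * d)))); last first.
  apply: itg_ext; have x1 : x <= 1 by rewrite (le_trans _ xl)// lerDl mulr_ge0// ltW.
  by move=> t /andP[at_ _]; rewrite u_trace ?x0 ?x1 ?(le_trans a0)// exprMn.
rewrite itgZ; last by lbm.
rewrite ler_pM2l ?exprn_gt0// (itg_shift _ _ _ (f := fun z => y z ^+ 2)); last by lbm.
apply: traceQ_sub.
  rewrite lerBlDr -addrA -[X in _ <= a + (_ + X)]mul1r.
  have : x * d + l <= d.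
    rewrite -(ler_pM2l lambda0) divff// (_ : lambda * (x * d + l) = x + lambda * l)//.
    by field.
  lra.
have : 0 <= x * d by rewrite mulr_ge0// ltW.
lra.
Qed.

End plant.

(** * Identifier errors *)

Section barrier.
Context {R : realType}.
Implicit Types (phi g : R -> R) (s t M : R).

(* At the last time before t at which phi <= M, phi cannot have increased since. *)
Lemma barrier (phi g : R -> R) M t : 0 <= t -> lbm1 g -> phi 0 <= M ->
  (forall s, 0 <= s <= t -> phi s = phi 0 + itg 0 s g) ->
  (forall s, 0 <= s <= t -> M < phi s -> g s <= 0) -> phi t <= M.
Proof.
move=> t0 lg p0 hp hg; rewrite leNgt; apply/negP => Mt.
pose A : set R := [set s | 0 <= s <= t /\ phi s <= M].
have A0 : A 0 by split; rewrite ?lexx.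
have At : has_sup A.
  by split; [exists 0|exists t => s [/andP[]]].
set s0 := sup A.
have s00 : 0 <= s0 by apply: ub_le_sup => //; case: At.
have s0t : s0 <= t by apply: ge_sup; [exists 0|move=> s [/andP[]]].
have [B hB] := lg.2 t.
pose B1 : R := `|B| + 1.
have B10 : 0 < B1 by rewrite ltr_wpDl.
(* A point s of [A] less than [del] before the supremum s0 is used in place of s0 itself; between s
   and s0 the growth of phi is at most half of the excess phi t - M. *)
pose del := (phi t - M) / (2 * B1).
have del0 : 0 < del by rewrite divr_gt0 ?subr_gt0// mulr_gt0.
have [s [/andP[s_ge0 st] sM] ss0] := sup_adherent del0 At.
have s_s0 : s <= s0 by apply: ub_le_sup; [case: At|split; rewrite ?s_ge0].
have late : itg s0 t g <= 0.
  rewrite (@itg_ext_oo _ _ _ _ (fun z => if s0 < z then Num.min (g z) 0 else 0)).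
  - apply: (@le_trans _ _ (itg s0 t (fun=> 0))); last by rewrite itg0.
    apply: itg_le; [|by lbm|].
      apply: (@lbm_ext _ _ _ _ (fun z => if s0 < z then (if g z <= 0 then g z else 0) else 0)).
        by move=> z; case: ifP => // _; case: leP.
      by lbm.
    by move=> z _; case: ifP => _; rewrite ?lexx// ge_min lexx orbT.
  - by [].
  - apply: (@lbm_ext _ _ _ _ (fun z => if s0 < z then (if g z <= 0 then g z else 0) else 0)).
      by move=> z; case: ifP => // _; case: leP.
    by lbm.
  move=> z /andP[z0 zt]; rewrite z0; apply/esym/min_idPl/hg.
    by rewrite (ltW zt) (le_trans s00 (ltW z0)).
  rewrite ltNge; apply/negP => zM.
  have : z <= s0.
    apply: ub_le_sup; [by case: At|split=> //].
    by rewrite (ltW zt) (le_trans s00 (ltW z0)).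
  by rewrite leNgt z0.
have early : itg s s0 g <= B1 * (s0 - s).
  rewrite -itg_cst//; apply: itg_le => //; first by lbm.
  move=> z /andP[sz zs0]; apply: (le_trans (ler_norm _)).
  have : `|g z| <= B.
    by apply: hB; rewrite ger0_norm ?(le_trans s_ge0)// (le_trans zs0).
  by move=> /le_trans; apply; rewrite /B1 (le_trans (ler_norm _))// lerDl.
have := hp t; rewrite t0 lexx => /(_ isT).
rewrite (@itg_split _ s) ?s_ge0// addrA -hp ?s_ge0//.
rewrite (@itg_split _ s0 s t) ?s_s0// => e.
have : phi t <= M + B1 * (s0 - s).
  by rewrite e lerD// -[leRHS]addr0 lerD.
have : B1 * (s0 - s) < B1 * del by rewrite ltr_pM2l// ltrBlDr addrC -ltrBlDr.
have -> : B1 * del = (phi t - M) / 2 by rewrite /del; field; rewrite gt_eqF.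
lra.
Qed.

(** Beyond cbar the projection leaves only inward velocities, so [barrier] applies to phi and to -
    phi. *)
Lemma Proj_bound (cbar : R) (phi sigma : R -> R) t : 0 <= cbar -> 0 <= t ->
  lbm1 (fun s => Proj cbar (sigma s) (phi s)) -> `|phi 0| <= cbar ->
  (forall s, 0 <= s <= t ->
    phi s = phi 0 + itg 0 s (fun s => Proj cbar (sigma s) (phi s))) ->
  `|phi t| <= cbar.
Proof.
move=> cb0 t0 lP; rewrite ler_norml => /andP[pl pu] hp; rewrite ler_norml; apply/andP; split.
  rewrite lerNl; apply: (@barrier (fun s => - phi s)
    (fun s => - Proj cbar (sigma s) (phi s))) => //; first by lbm.
  - by rewrite lerNl.
  - by move=> s hs; rewrite hp// opprD itgN.
  move=> s hs /= cp; have pn : phi s < 0 by rewrite -oppr_gt0 (le_lt_trans cb0).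
  rewrite oppr_le0 /Proj ltr0_norm// (ltW cp)/= nmulr_lge0//.
  by case: ifPn => //; rewrite -ltNge => /ltW.
apply: (@barrier phi _ _ _ t0 lP) => // s hs cp.
have pn : 0 < phi s by rewrite (le_lt_trans cb0).
rewrite /Proj gtr0_norm// (ltW cp)/= pmulr_lge0//.
by case: ifPn => //; rewrite -ltNge => /ltW.
Qed.

(** The projection acts only at omega = cbar or omega = - cbar with sigma pointing outward; then (w
    - omega) * sigma <= 0 for every admissible w, and replacing sigma by 0 can only increase the
    product. *)
Lemma Proj_dissipative (cbar sigma omega w : R) : 0 < cbar -> `|w| <= cbar -> `|omega| <= cbar ->
  (w - omega) * sigma <= (w - omega) * Proj cbar sigma omega.
Proof.
move=> cb0; rewrite /Proj !ler_norml => /andP[w1 w2] /andP[q1 q2].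
case: ifPn => // /andP[co so]; rewrite mulr0.
have [q0|q0] := leP 0 omega.
  have e : omega = cbar by apply/eqP; rewrite eq_le q2 -(ger0_norm q0).
  move: so; rewrite e pmulr_lge0// => s0.
  by rewrite mulr_le0_ge0// subr_le0.
have e : omega = - cbar.
  by apply/eqP; rewrite eq_le q1 andbT lerNr -(ltr0_norm q0).
move: so; rewrite e mulrN oppr_ge0 pmulr_lle0// => s0.
by rewrite mulr_ge0_le0// opprK -lerBlDr sub0r.
Qed.

End barrier.

(** * The Lyapunov functional of the identifier errors *)

Section error.
Context {R : realType}.
Variables (lambda mu r cbar rho gamma gamma1 : R).
Hypotheses (lambda0 : 0 < lambda) (mu0 : 0 < mu) (r0 : 0 < r) (cbar0 : 0 < cbar).
Hypotheses (rho0 : 0 < rho) (gamma0 : 0 < gamma) (gamma10 : 0 < gamma1).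
Local Notation d := (lambda^-1).
Local Notation h := (mu^-1).
Variables (c m : R -> R) (u e ep ch : R -> R -> R).
Hypotheses (lc : lbm1 c) (lm : lbm1 m).
Hypotheses (lu : lbm2 u) (le : lbm2 e) (lep : lbm2 ep) (lch : lbm2 ch).
Hypothesis m0 : forall t, 0 <= m t.
Hypothesis cb : forall x, 0 <= x <= 1 -> `|c x| <= cbar.
Hypothesis chb : forall x t, 0 <= x <= 1 -> 0 <= t -> `|ch x t| <= cbar.
Hypothesis te : forall x t s, 0 <= t -> 0 <= s -> 0 <= x -> x + lambda * s <= 1 ->
  e (x + lambda * s) (t + s) =
  e x t + itg 0 s (fun z => rho * e (x + lambda * z) (t + z) * - m (t + z)).
Hypothesis tep : forall x t s, 0 <= t -> 0 <= s -> x <= 1 -> 0 <= x - mu * s ->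
  ep (x - mu * s) (t + s) =
  ep x t + itg 0 s (fun z => (c (x - mu * z) - ch (x - mu * z) (t + z)) * u (x - mu * z) (t + z)
    - rho * ep (x - mu * z) (t + z) * m (t + z)).
Hypothesis be : forall t, 0 < t -> e 0 t = r * ep 0 t.
Hypothesis bep : forall t, 0 < t -> ep 1 t = 0.
Hypothesis upd : forall x t, 0 <= x <= 1 -> 0 <= t ->
  ch x t = ch x 0 + itg 0 t (fun s =>
    Proj cbar (gamma1 * expR (gamma * x) * ep x s * u x s) (ch x s)).

Let mn0 : mu != 0. Proof. by rewrite gt_eqF. Qed.
Let h0 : 0 < h. Proof. by rewrite invr_gt0. Qed.
Let d0 : 0 < d. Proof. by rewrite invr_gt0. Qed.

Implicit Types (x s t T xi : R).
Local Notation W x := (expR (gamma * x)).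
Local Notation ct x t := (c x - ch x t).

Let lProj x : lbm1 (fun s => Proj cbar (gamma1 * W x * ep x s * u x s) (ch x s)).
Proof. rewrite /Proj; lbm. Qed.

Lemma ctilde_decay x T : 0 <= x <= 1 -> 0 <= T ->
  ct x T ^+ 2 <= ct x 0 ^+ 2 -
    2 * gamma1 * itg 0 T (fun t => ct x t * W x * ep x t * u x t).
Proof.
move=> hx T0; have lP := lProj x.
rewrite (@sqr_rule _ (fun t => ct x t)
  (fun s => - Proj cbar (gamma1 * W x * ep x s * u x s) (ch x s)) T T0); last 2 first.
- by lbm.
- move=> s /andP[s0 _]; rewrite upd// itgN//; ring.
rewrite lerD2l -mulNr -itgZ; last by lbm.
apply: itg_le; [by lbm|by lbm|] => t /andP[t0 tT].
have := @Proj_dissipative _ cbar (gamma1 * W x * ep x t * u x t) (ch x t) (c x) cbar0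
  (cb hx) (chb hx t0).
set P := Proj _ _ _ => hP.
have -> : - (2 * gamma1) * (ct x t * W x * ep x t * u x t) =
  - (2 * (ct x t * (gamma1 * W x * ep x t * u x t))) by ring.
by rewrite mulrN mulrN lerN2 ler_pM2l.
Qed.

(** The derivative of ep^2 exp(gamma x) along a characteristic of v. The term with mu * gamma stems
    from the weight, which decreases as x moves left. *)
Definition ep_density x t : R :=
  W x * (2 * ep x t * (ct x t * u x t) - (mu * gamma + 2 * rho * m t) * ep x t ^+ 2).

Lemma ep_char x t s : 0 <= t -> 0 <= s -> x <= 1 -> 0 <= x - mu * s ->
  ep (x - mu * s) (t + s) ^+ 2 * W (x - mu * s) =
  ep x t ^+ 2 * W x + itg 0 s (fun z => ep_density (x - mu * z) (t + z)).
Proof.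
move=> t0 s0 x1 xs.
pose f z := (ct (x - mu * z) (t + z)) * u (x - mu * z) (t + z)
    - rho * ep (x - mu * z) (t + z) * m (t + z).
pose F z := ep (x - mu * z) (t + z).
have lf : lbm1 f by rewrite /f; lbm.
have lF : lbm1 F by rewrite /F; lbm.
have xz z : 0 <= z <= s -> 0 <= x - mu * z.
  by move=> /andP[z0 zs]; rewrite (le_trans xs)// lerD2l lerN2 ler_pM2l.
have hF z : 0 <= z <= s -> F z = F 0 + itg 0 z f.
  move=> hz; rewrite /F mulr0 subr0 addr0 tep//; first by case/andP: hz.
  exact: xz.
have hF2 z : 0 <= z <= s -> F z ^+ 2 = F 0 ^+ 2 + itg 0 z (fun q => 2 * (F q * f q)).
  move=> /andP[z0 zs]; apply: sqr_rule => // q /andP[q0 qz].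
  by rewrite hF// q0 (le_trans qz).
pose g z := - (mu * gamma) * W (x - mu * z).
have lg : lbm1 g by rewrite /g; lbm.
have hG z : 0 <= z <= s -> W (x - mu * z) = W (x - mu * 0) + itg 0 z g.
  move=> /andP[z0 zs]; rewrite mulr0 subr0.
  rewrite (_ : itg 0 z g = itg 0 z (fun q => (- (mu * gamma) * W x) * expR (- (mu * gamma) * q))); last first.
    apply: itg_ext => q _; rewrite /g -mulrA -expRD; congr (_ * expR _); ring.
  rewrite itgZ; last by lbm.
  rewrite itg_exp// ?oppr_eq0 ?mulf_neq0 ?gt_eqF// mulr0 expR0.
  have -> : W (x - mu * z) = W x * expR (- (mu * gamma) * z).
    by rewrite -expRD; congr expR; ring.
  by field; rewrite !gt_eqF.
have lf2 : lbm1 (fun q => 2 * (F q * f q)) by lbm.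
have := product_rule s0 lf2 lg hF2 hG.
rewrite /F mulr0 subr0 addr0 => ->; congr (_ + _); apply: itg_ext => z _.
rewrite /ep_density /g /f /F; ring.
Qed.

Let ldens : lbm2 ep_density.
Proof. rewrite /ep_density; lbm. Qed.

(** A characteristic of v is labelled by the constant xi = x + mu * t. It enters at t = 0 if xi <= 1
    and through x = 1 otherwise; up to time T it leaves through x = 0 if xi <= mu * T and at t = T
    otherwise. *)
Lemma ep_label T xi : 0 <= T -> 0 <= xi <= 1 + mu * T ->
  (if xi <= mu * T then ep 0 (h * xi) ^+ 2 else ep (xi - mu * T) T ^+ 2 * W (xi - mu * T)) =
  (if xi <= 1 then ep xi 0 ^+ 2 * W xi else 0) +
  itg 0 T (fun t => if (0 <= xi - mu * t <= 1)%R then ep_density (xi - mu * t) t else 0).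
Proof.
move=> T0 /andP[xi0 xi1].
pose t1 := if xi <= mu * T then h * xi else T.
pose t0 := if xi <= 1 then 0 else h * (xi - 1).
have t00 : 0 <= t0.
  by rewrite /t0; case: ifPn => // ; rewrite -ltNge => x1; rewrite mulr_ge0 ?(ltW h0)// subr_ge0 ltW.
have t1T : t1 <= T.
  by rewrite /t1; case: ifPn => // xT; rewrite -(ler_pM2l mu0) mulrA divff// mul1r.
have t01 : t0 <= t1.
  rewrite /t0 /t1; case: ifPn => h1; case: ifPn => h2 //.
  - by rewrite mulr_ge0// ltW.
  - by rewrite ler_pM2l//; lra.
  by rewrite -(ler_pM2l mu0) mulrA divff// mul1r; lra.
have X1 : 0 <= xi - mu * t1.
  rewrite /t1; case: ifPn => [_|]; first by rewrite mulrA divff// mul1r subrr.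
  by rewrite -ltNge => /ltW; rewrite subr_ge0.
have X0 : xi - mu * t0 <= 1.
  rewrite /t0; case: ifPn => [|_]; first by rewrite mulr0 subr0.
  by rewrite mulrA divff// mul1r; lra.
transitivity (ep (xi - mu * t1) t1 ^+ 2 * W (xi - mu * t1)).
  rewrite /t1; case: ifPn => // _.
  by rewrite mulrA divff// mul1r subrr mulr0 expR0 mulr1.
have := @ep_char (xi - mu * t0) t0 (t1 - t0) t00.
rewrite subr_ge0 t01 X0 (_ : xi - mu * t0 - mu * (t1 - t0) = xi - mu * t1); last by ring.
rewrite X1 (_ : t0 + (t1 - t0) = t1); last by ring.
move=> -> //.
congr (_ + _).
  rewrite /t0; case: ifPn => [_|]; first by rewrite mulr0 subr0.
  rewrite -ltNge => x1; rewrite (_ : xi - _ = 1); last by field.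
  by rewrite bep ?expr0n ?mul0r// mulr_gt0// subr_gt0.
have hJ : lbm1 (fun t => if (0 <= xi - mu * t <= 1)%R then ep_density (xi - mu * t) t else 0).
  by have ld := ldens; lbm.
(* Before t0 and after t1 the line with this label lies outside [0, 1], so the conditional integrand
   vanishes there. *)
rewrite [RHS](@itg_split _ t0) ?t00 ?(le_trans t01)// [X in _ = _ + X](@itg_split _ t1) ?t01//.
rewrite [X in _ = X + _](_ : _ = 0); last first.
  transitivity (itg 0 t0 (fun=> 0 : R)); last exact: itg0.
  apply: itg_ext_oo => //; first by lbm.
  move=> t /andP[tp]; rewrite /t0; case: ifPn => [_|_ tx].
    by move=> /(lt_trans tp); rewrite ltxx.
  rewrite ifF//; apply/negbTE/negP => /andP[_].
  move: tx; rewrite -(ltr_pM2l mu0) mulrA divff// mul1r; lra.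
rewrite [X in _ = _ + (_ + X)](_ : _ = 0); last first.
  transitivity (itg t1 T (fun=> 0 : R)); last exact: itg0.
  apply: itg_ext_oo => //; first by lbm.
  move=> t /andP[tp]; move: tp; rewrite /t1; case: ifPn => [_ tx _|_ tx].
    rewrite ifF//; apply/negbTE/negP => /andP[].
    by move: tx; rewrite -(ltr_pM2l mu0) mulrA divff// mul1r; lra.
  by move=> /(lt_trans tx); rewrite ltxx.
rewrite add0r addr0.
transitivity (itg (0 + t0) ((t1 - t0) + t0) (fun t => ep_density (xi - mu * t) t)); last first.
  rewrite add0r subrK; apply: itg_ext => t /andP[t0t tt1]; rewrite ifT//.
  rewrite (le_trans X1) ?(le_trans _ X0)// lerD2l lerN2 ler_pM2l//.
rewrite -itg_shift; last by have ld := ldens; lbm.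
by apply: itg_ext => t _; rewrite [t + t0]addrC; congr (ep_density _ _); ring.
Qed.

(** Integrating [ep_label] over all labels gives the energy balance for broad solutions, without
    derivatives in x or t. Outgoing labels below mu * T produce the boundary term at x = 0. *)
Lemma ep_energy T : 0 <= T ->
  itg 0 1 (fun x => ep x T ^+ 2 * W x) + mu * itg 0 T (fun t => ep 0 t ^+ 2) =
  itg 0 1 (fun x => ep x 0 ^+ 2 * W x) +
  itg 0 T (fun t => itg 0 1 (fun x => ep_density x t)).
Proof.
move=> T0; have ld := ldens.
have mT0 : 0 <= mu * T by rewrite mulr_ge0// ltW.
have E : itg 0 (1 + mu * T) (fun xi => if xi <= mu * T then ep 0 (h * xi) ^+ 2
      else ep (xi - mu * T) T ^+ 2 * W (xi - mu * T)) =
    itg 0 (1 + mu * T) (fun xi => (if xi <= 1 then ep xi 0 ^+ 2 * W xi else 0) +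
      itg 0 T (fun t => if (0 <= xi - mu * t <= 1)%R then ep_density (xi - mu * t) t else 0)).
  by apply: itg_ext => xi hxi; exact: ep_label.
move: E; rewrite (@itg_split _ (mu * T)); [|by rewrite mT0 lerDr ler01|by lbm].
rewrite (_ : itg 0 (mu * T) _ = mu * itg 0 T (fun t => ep 0 t ^+ 2)); last first.
  transitivity (itg 0 (mu * T) (fun xi => (fun t => ep 0 t ^+ 2) (h * xi + 0))).
    by apply: itg_ext => xi /andP[_ ->]; rewrite addr0.
  rewrite (@itg_affine _ h 0 0 (mu * T) (fun t => ep 0 t ^+ 2))//; last by lbm.
  by rewrite invrK mulr0 !addr0 mulrA mulVf// mul1r.
rewrite (_ : itg (mu * T) _ _ = itg 0 1 (fun x => ep x T ^+ 2 * W x)); last first.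
  transitivity (itg (mu * T) (1 + mu * T) (fun xi => (fun x => ep x T ^+ 2 * W x) (xi + - (mu * T)))).
    apply: itg_ext_oo; [by lbm|by lbm|] => xi /andP[h1 _].
    by rewrite ifF//; apply/negbTE; rewrite -ltNge.
  by rewrite (@itg_shift _ _ _ _ (fun x => ep x T ^+ 2 * W x)) ?subrr ?addrK//; lbm.
rewrite addrC => ->; rewrite itgD; [|by lbm|by lbm].
congr (_ + _).
  rewrite (@itg_split _ 1); [|by rewrite ler01 lerDl|by lbm].
  rewrite [X in _ + X](_ : _ = 0) ?addr0; last first.
    transitivity (itg 1 (1 + mu * T) (fun=> 0 : R)); last exact: itg0.
  apply: itg_ext_oo; [by lbm|by lbm|] => xi /andP[h1 _].
    by rewrite ifF//; apply/negbTE; rewrite -ltNge.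
  by apply: itg_ext => xi /andP[_ ->].
rewrite itg_fubini; last by lbm.
apply: itg_ext => t /andP[t0 tT].
have mt0 : 0 <= mu * t by rewrite mulr_ge0// ltW.
have mtT : mu * t <= mu * T by rewrite ler_pM2l.
rewrite (@itg_shift _ 0 (1 + mu * T) (- (mu * t)) (fun x => if (0 <= x <= 1)%R then ep_density x t else 0)); last by lbm.
rewrite [RHS](@itg_ind _ (0 - mu * t) (1 + mu * T - mu * t)); [|by lbm|by rewrite sub0r oppr_le0|lra].
by apply: itg_ext => x _; case: ifP => _; rewrite ?mul1r ?mul0r.
Qed.

Definition epN t : R := itg 0 1 (fun x => ep x t ^+ 2).
Definition ctN t : R := itg 0 1 (fun x => ct x t ^+ 2).
(* The initial value of the Lyapunov functional of the identifier errors, with the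
   weight exp(gamma x) bounded by exp gamma. *)
Definition lyap0 : R := expR gamma * epN 0 + gamma1^-1 * ctN 0.

Lemma lbm_epN : lbm1 epN. Proof. rewrite /epN; lbm. Qed.
Lemma epN_ge0 t : 0 <= epN t.
Proof. by apply: itg_ge0 => x _; exact: sqr_ge0. Qed.
Lemma ctN_ge0 t : 0 <= ctN t.
Proof. by apply: itg_ge0 => x _; exact: sqr_ge0. Qed.

Lemma lyapunov T : 0 <= T ->
  epN T + mu * itg 0 T (fun t => ep 0 t ^+ 2) + mu * gamma * itg 0 T epN +
  2 * rho * itg 0 T (fun t => m t * epN t) + gamma1^-1 * ctN T <= lyap0.
Proof.
(* Stated for plain reals, so that the concluding arithmetic does not see the integrals. *)
have aux (a p q r' s z w b c' g g0 : R) : a <= p -> r' <= z -> s <= w - (b + c') ->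
    g <= g0 - w -> p + q = r' + s -> a + q + b + c' + g <= z + g0 by lra.
move=> T0; have ld := ldens; have lN := lbm_epN.
have W1 x : 0 <= x <= 1 -> 1 <= W x <= expR gamma.
  move=> /andP[x0 x1]; rewrite -expR0 !ler_expR mulr_ge0 ?(ltW gamma0)//=.
  by rewrite ler_piMr// ltW.
have E := ep_energy T0.
have A1 : epN T <= itg 0 1 (fun x => ep x T ^+ 2 * W x).
  apply: itg_le; [by lbm|by lbm|] => x /W1/andP[w1 _].
  by rewrite ler_peMr// sqr_ge0.
have A2 : itg 0 1 (fun x => ep x 0 ^+ 2 * W x) <= expR gamma * epN 0.
  rewrite -itgZ; last by lbm.
  apply: itg_le; [by lbm|by lbm|] => x /W1/andP[_ w1].
  by rewrite mulrC ler_wpM2r// sqr_ge0.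
have A3 : itg 0 T (fun t => itg 0 1 (fun x => ep_density x t)) <=
    itg 0 T (fun t => itg 0 1 (fun x => 2 * (ct x t * W x * ep x t * u x t))) -
    (mu * gamma * itg 0 T epN + 2 * rho * itg 0 T (fun t => m t * epN t)).
  rewrite -!itgZ; [|by lbm|by lbm].
  rewrite -itgD; [|by lbm|by lbm].
  rewrite -itgB; [|by lbm|by lbm].
  apply: itg_le; [by lbm|by lbm|] => t /andP[t0 tT].
  rewrite /epN mulrA -mulrDl -itgZ; last by lbm.
  rewrite -itgB; [|by lbm|by lbm].
  apply: itg_le; [by lbm|by lbm|] => x /W1/andP[w1 _].
  rewrite /ep_density -subr_ge0.
  set k := mu * gamma + 2 * rho * m t.
  have -> : 2 * (ct x t * W x * ep x t * u x t) - k * ep x t ^+ 2 -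
    W x * (2 * ep x t * (ct x t * u x t) - k * ep x t ^+ 2) =
    (W x - 1) * (k * ep x t ^+ 2) by ring.
  rewrite mulr_ge0 ?subr_ge0// mulr_ge0 ?sqr_ge0//; apply: addr_ge0.
    by rewrite mulr_ge0 ?(ltW mu0) ?(ltW gamma0).
  by rewrite mulr_ge0 ?m0// mulr_ge0// ltW.
have A4 : gamma1^-1 * ctN T <= gamma1^-1 * ctN 0 -
    itg 0 T (fun t => itg 0 1 (fun x => 2 * (ct x t * W x * ep x t * u x t))).
  rewrite (@itg_fubini _ (fun t x => 2 * (ct x t * W x * ep x t * u x t))); last by lbm.
  rewrite -(ler_pM2l gamma10) mulrBr !mulrA divff ?gt_eqF// !mul1r.
  rewrite -itgZ; last by lbm.
  rewrite -itgB; [|by lbm|by lbm].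
  apply: itg_le; [by lbm|by lbm|] => x hx.
  apply: (le_trans (ctilde_decay hx T0)).
  by rewrite itgZ; [rewrite mulrA (mulrC gamma1)|lbm].
exact: aux A1 A2 A3 A4 E.
Qed.

Let lyap_parts T : 0 <= T ->
  [/\ 0 <= epN T, 0 <= mu * itg 0 T (fun t => ep 0 t ^+ 2),
    0 <= mu * gamma * itg 0 T epN,
    0 <= 2 * rho * itg 0 T (fun t => m t * epN t) & 0 <= gamma1^-1 * ctN T].
Proof.
move=> T0; split; first exact: epN_ge0.
- by rewrite mulr_ge0 ?(ltW mu0)//; apply: itg_ge0 => x _; exact: sqr_ge0.
- by rewrite mulr_ge0 ?mulr_ge0 ?(ltW mu0) ?(ltW gamma0)//; apply: itg_ge0 => x _; exact: epN_ge0.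
- rewrite mulr_ge0 ?mulr_ge0 ?(ltW rho0)//; apply: itg_ge0 => x _.
  by rewrite mulr_ge0 ?m0 ?epN_ge0.
by rewrite mulr_ge0 ?invr_ge0 ?(ltW gamma10)// ctN_ge0.
Qed.

Lemma epN_le T : 0 <= T -> epN T <= lyap0.
Proof. by move=> T0; have := lyapunov T0; case: (lyap_parts T0); lra. Qed.
Lemma ep0_le T : 0 <= T -> mu * itg 0 T (fun t => ep 0 t ^+ 2) <= lyap0.
Proof. by move=> T0; have := lyapunov T0; case: (lyap_parts T0); lra. Qed.
Lemma epN_itg_le T : 0 <= T -> mu * gamma * itg 0 T epN <= lyap0.
Proof. by move=> T0; have := lyapunov T0; case: (lyap_parts T0); lra. Qed.
Lemma mepN_itg_le T : 0 <= T -> 2 * rho * itg 0 T (fun t => m t * epN t) <= lyap0.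
Proof. by move=> T0; have := lyapunov T0; case: (lyap_parts T0); lra. Qed.
Lemma ctN_le T : 0 <= T -> gamma1^-1 * ctN T <= lyap0.
Proof. by move=> T0; have := lyapunov T0; case: (lyap_parts T0); lra. Qed.

End error.

(** * Variation of the estimate *)

Section variation.
Context {R : realType}.
Variables (lambda mu r cbar rho gamma gamma1 : R).
Hypotheses (lambda0 : 0 < lambda) (mu0 : 0 < mu) (r0 : 0 < r) (cbar0 : 0 < cbar).
Hypotheses (rho0 : 0 < rho) (gamma0 : 0 < gamma) (gamma10 : 0 < gamma1).
Local Notation d := (lambda^-1).
Local Notation h := (mu^-1).
Variables (c m : R -> R) (u e ep ch : R -> R -> R).
Hypotheses (lc : lbm1 c) (lm : lbm1 m).
Hypotheses (lu : lbm2 u) (le : lbm2 e) (lep : lbm2 ep) (lch : lbm2 ch).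
Implicit Types (x s t T a b l xi : R).
Hypothesis m0 : forall t, 0 <= m t.
Hypothesis te : forall x t s, 0 <= t -> 0 <= s -> 0 <= x -> x + lambda * s <= 1 ->
  e (x + lambda * s) (t + s) =
  e x t + itg 0 s (fun z => rho * e (x + lambda * z) (t + z) * - m (t + z)).
Hypothesis tep : forall x t s, 0 <= t -> 0 <= s -> x <= 1 -> 0 <= x - mu * s ->
  ep (x - mu * s) (t + s) =
  ep x t + itg 0 s (fun z => (c (x - mu * z) - ch (x - mu * z) (t + z)) * u (x - mu * z) (t + z)
    - rho * ep (x - mu * z) (t + z) * m (t + z)).
Hypothesis be : forall t, 0 < t -> e 0 t = r * ep 0 t.
Hypothesis bep : forall t, 0 < t -> ep 1 t = 0.
Hypothesis upd : forall x t, 0 <= x <= 1 -> 0 <= t ->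
  ch x t = ch x 0 + itg 0 t (fun s =>
    Proj cbar (gamma1 * expR (gamma * x) * ep x s * u x s) (ch x s)).
Variable K : R.
Hypothesis K0 : 0 < K.
Hypothesis u_col : forall x a l s, 0 <= a -> 0 <= x -> x + lambda * l <= 1 ->
  0 <= l <= h -> a <= s <= a + l -> itg a (a + l) (fun t => u x t ^+ 2) <= K * m s.

Let mn0 : mu != 0. Proof. by rewrite gt_eqF. Qed.
Let ln0 : lambda != 0. Proof. by rewrite gt_eqF. Qed.
Let h0 : 0 < h. Proof. by rewrite invr_gt0. Qed.
Let d0 : 0 < d. Proof. by rewrite invr_gt0. Qed.

Lemma e_decay x t s : 0 <= t -> 0 <= s -> 0 <= x -> x + lambda * s <= 1 ->
  e (x + lambda * s) (t + s) ^+ 2 <= e x t ^+ 2.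
Proof.
move=> t0 s0 x0 xs.
rewrite (@sqr_rule _ (fun z => e (x + lambda * z) (t + z))
  (fun z => rho * e (x + lambda * z) (t + z) * - m (t + z)) s s0); last 2 first.
- by lbm.
- move=> z /andP[z0 zs]; rewrite mulr0 !addr0 te//.
  by rewrite (le_trans _ xs)// lerD2l ler_pM2l.
rewrite mulr0 !addr0 gerDl -oppr_ge0 -itgN; last by lbm.
apply: itg_ge0 => z _; rewrite (_ : - _ =
  2 * (rho * (m (t + z) * e (x + lambda * z) (t + z) ^+ 2))); last by ring.
by rewrite mulr_ge0// mulr_ge0 ?(ltW rho0)// mulr_ge0 ?m0 ?sqr_ge0.
Qed.

(** The counterpart of the outlet trace for e^2. Since e is damped along its characteristics, the
    value at the foot of the characteristic is an upper bound instead of an exact value. *)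
Definition eta s : R :=
  if 0 < s then r ^+ 2 * ep 0 s ^+ 2 else if - d <= s then e (- (lambda * s)) 0 ^+ 2 else 0.

Lemma lbm_eta : lbm1 eta.
Proof. rewrite /eta; lbm. Qed.
Let leta := lbm_eta.

Lemma eta_ge0 s : 0 <= eta s.
Proof.
rewrite /eta; case: ifP => _; first by rewrite mulr_ge0 ?sqr_ge0.
by case: ifP => _; rewrite ?sqr_ge0.
Qed.

Lemma e_eta x t : 0 <= x <= 1 -> 0 <= t -> e x t ^+ 2 <= eta (t - x * d).
Proof.
move=> /andP[x0 x1] t0; rewrite /eta; case: ifPn => [tx|].
  have := @e_decay 0 (t - x * d) (x * d) (ltW tx).
  rewrite be// add0r subrK mulrCA divff// mulr1 exprMn; apply => //.
  by rewrite mulr_ge0// ltW.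
rewrite -leNgt => tx; rewrite ifT; last first.
  by have : x * d <= d; [rewrite ler_piMl// ltW|lra].
have e1 : - (lambda * (t - x * d)) = x - lambda * t by field.
rewrite e1; have := @e_decay (x - lambda * t) 0 t (lexx _) t0.
rewrite subrK add0r; apply => //.
by rewrite -e1 oppr_ge0 pmulr_rle0.
Qed.

Definition eN t : R := itg 0 1 (fun x => e x t ^+ 2).
Lemma lbm_eN : lbm1 eN. Proof. rewrite /eN; lbm. Qed.
Lemma eN_ge0 t : 0 <= eN t.
Proof. by apply: itg_ge0 => x _; exact: sqr_ge0. Qed.

Lemma eta_itg T : 0 <= T ->
  itg (- d) T eta = d * eN 0 + r ^+ 2 * itg 0 T (fun t => ep 0 t ^+ 2).
Proof.
move=> T0; have le' := leta.
rewrite (@itg_split _ 0); [|by rewrite oppr_le0 (ltW d0)|by []]; congr (_ + _).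
  transitivity (itg (- d) 0 (fun s => (fun x => e x 0 ^+ 2) ((- lambda) * s + 0))).
    apply: itg_ext_oo; [by lbm|by lbm|] => s /andP[s1 s2].
    by rewrite /eta ltNge (ltW s2)/= (ltW s1) addr0 mulNr.
  rewrite (@itg_affine_neg _ (- lambda) 0 (- d) 0 (fun x => e x 0 ^+ 2)) ?oppr_lt0//; last by lbm.
  by rewrite opprK mulr0 !addr0 (_ : - lambda * - d = 1)//; field.
rewrite -itgZ; last by lbm.
by apply: itg_ext_oo; [by lbm|by lbm|] => s /andP[s1 _]; rewrite /eta s1.
Qed.

Lemma eN_le t : 0 <= t -> eN t <= eN 0 + lambda * r ^+ 2 * itg 0 t (fun t => ep 0 t ^+ 2).
Proof.
move=> t0; have le' := leta.
have -> : eN 0 + lambda * r ^+ 2 * itg 0 t (fun t => ep 0 t ^+ 2) = lambda * itg (- d) t eta.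
  by rewrite eta_itg//; field.
apply: (@le_trans _ _ (itg 0 1 (fun x => eta ((- d) * x + t)))).
  apply: itg_le; [by lbm|by lbm|] => x hx.
  by rewrite addrC mulNr mulrC e_eta.
rewrite itg_affine_neg ?oppr_lt0// opprK invrK ler_pM2l// mulr0 mulr1 add0r.
apply: itg_sub => // [|x _]; [by rewrite lerDl|exact: eta_ge0].
Qed.

(** For each fixed x the delayed majorant is integrated over a part of [- d, T], and the delays x *
    d are then averaged over x. *)
Lemma eN_itg_le T : 0 <= T ->
  itg 0 T eN <= d * eN 0 + r ^+ 2 * itg 0 T (fun t => ep 0 t ^+ 2).
Proof.
move=> T0; rewrite -eta_itg//; have le' := leta.
apply: (@le_trans _ _ (itg 0 T (fun t => itg 0 1 (fun x => eta (t - x * d))))).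
  rewrite /eN; apply: itg_le; [by lbm|by lbm|] => t /andP[t0 _].
  apply: itg_le; [by lbm|by lbm|] => x hx; exact: e_eta.
rewrite itg_fubini; last by lbm.
apply: (@le_trans _ _ (itg 0 1 (fun _ => itg (- d) T eta))); last first.
  by rewrite itg_cst// subr0 mulr1.
apply: itg_le; [by lbm|by lbm|] => x /andP[x0 x1].
rewrite itg_shift//; apply: itg_sub => // [||s _]; last exact: eta_ge0.
  by rewrite sub0r lerN2 ler_piMl// ltW.
by rewrite gerBl mulr_ge0// ltW.
Qed.

Let lProj x : lbm1 (fun s => Proj cbar (gamma1 * expR (gamma * x) * ep x s * u x s) (ch x s)).
Proof. rewrite /Proj; lbm. Qed.

Definition ch_step : R := (gamma1 * expR gamma) ^+ 2 * K.

Lemma ch_step_ge0 : 0 <= ch_step.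
Proof. by rewrite /ch_step mulr_ge0 ?sqr_ge0// ltW. Qed.

(** After Cauchy-Schwarz, the factor given by the integral of u^2 is moved inside the integral of
    ep^2. Since [u_col] holds for every s of the interval, it is there replaced by K * m s, which
    yields the quantity ep^2 * m controlled by the Lyapunov functional. *)
Lemma ch_short x a l : 0 <= a -> 0 <= x -> x + lambda * l <= 1 -> 0 <= l <= h ->
  (ch x (a + l) - ch x a) ^+ 2 <= ch_step * itg a (a + l) (fun s => ep x s ^+ 2 * m s).
Proof.
move=> a0 x0 xl /[dup] hl /andP[l0 lh].
have x1 : x <= 1 by rewrite (le_trans _ xl)// lerDl mulr_ge0// ltW.
have hx : 0 <= x <= 1 by rewrite x0.
have lP := lProj x.
have al : a <= a + l by rewrite lerDl.
have -> : ch x (a + l) - ch x a = itg a (a + l) (fun s =>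
    Proj cbar (gamma1 * expR (gamma * x) * ep x s * u x s) (ch x s)).
  rewrite upd ?addr_ge0// [in X in _ - X]upd// (@itg_split _ a 0) ?a0//; ring.
set g := gamma1 * expR gamma.
have g0 : 0 < g by rewrite mulr_gt0// expR_gt0.
have B : `|itg a (a + l) (fun s =>
    Proj cbar (gamma1 * expR (gamma * x) * ep x s * u x s) (ch x s))| <=
    g * itg a (a + l) (fun s => `|ep x s| * `|u x s|).
  apply: (le_trans (itg_norm _ _ lP)); rewrite -itgZ; last by lbm.
  apply: itg_le; [by lbm|by lbm|] => s _.
  rewrite /Proj; case: ifP => _; first by rewrite normr0 mulr_ge0// ltW.
  rewrite -mulrA normrM [X in _ * X]normrM ler_wpM2r ?mulr_ge0//.
  rewrite gtr0_norm ?mulr_gt0 ?expR_gt0// /g ler_pM2l// ler_expR.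
  by rewrite ler_piMr// ltW.
rewrite -real_normK ?num_real//.
apply: (@le_trans _ _ ((g * itg a (a + l) (fun s => `|ep x s| * `|u x s|)) ^+ 2)).
  by rewrite lerXn2r ?nnegrE ?normr_ge0// (le_trans _ B).
rewrite exprMn /ch_step -mulrA ler_wpM2l ?sqr_ge0//.
apply: (le_trans (itg_cauchy_schwarz _ _ _ _)); [by lbm|by lbm|].
rewrite (_ : itg a (a + l) (fun s => `|ep x s| ^+ 2) = itg a (a + l) (fun s => ep x s ^+ 2)); last first.
  by apply: itg_ext => s _; rewrite real_normK ?num_real.
rewrite (_ : itg a (a + l) (fun s => `|u x s| ^+ 2) = itg a (a + l) (fun s => u x s ^+ 2)); last first.
  by apply: itg_ext => s _; rewrite real_normK ?num_real.
rewrite -itgZr; last by lbm.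
rewrite -itgZ; last by lbm.
apply: itg_le; [by lbm|by lbm|] => s hs.
rewrite mulrCA ler_wpM2l ?sqr_ge0//; exact: u_col.
Qed.

Lemma ch_multi x a l n : 0 <= a -> 0 <= x -> x + lambda * l <= 1 -> 0 <= l <= h ->
  (ch x (a + n%:R * l) - ch x a) ^+ 2 <=
  n%:R * ch_step * itg a (a + n%:R * l) (fun s => ep x s ^+ 2 * m s).
Proof.
move=> a0 x0 xl /[dup] hl /andP[l0 lh].
elim: n => [|n IH]; first by rewrite !mul0r addr0 subrr expr0n.
have nl0 : 0 <= n%:R * l by rewrite mulr_ge0.
have a'0 : 0 <= a + n%:R * l by rewrite addr_ge0.
have := ch_short a'0 x0 xl hl.
have -> : a + n%:R * l + l = a + n.+1%:R * l by rewrite -natr1; ring.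
rewrite (@itg_split _ (a + n%:R * l) a (a + n.+1%:R * l)); last 2 first.
- by rewrite lerDl nl0 lerD2l ler_wpM2r// ler_nat.
- by lbm.
set X := itg a _ _; set Y := itg _ (a + n.+1%:R * l) _.
move: IH; rewrite -/X.
set p := ch x (a + n%:R * l); set q := ch x a; set w := ch x _ => IH S.
have X0 : 0 <= X by apply: itg_ge0 => z _; rewrite mulr_ge0 ?sqr_ge0 ?m0.
have Y0 : 0 <= Y by apply: itg_ge0 => z _; rewrite mulr_ge0 ?sqr_ge0 ?m0.
have [n0|np] := posnP n.
  move: IH; rewrite n0 !mul0r => IH; have <- : p = q.
    by apply/eqP; rewrite -subr_eq0 -sqrf_eq0 eq_le IH sqr_ge0.
  by rewrite mul1r (le_trans S)// ler_wpM2l ?ch_step_ge0// lerDr.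
have nr : 0 < n%:R :> R by rewrite ltr0n.
have -> : w - q = (p - q) + (w - p) by ring.
move: IH S; set A := p - q; set B := w - p => IH S.
(* Young's inequality with weight n: it turns the factor n of the induction hypothesis into n + 1
   and gives the same factor to the new piece. *)
have hAB : (A + B) ^+ 2 <= (1 + n%:R^-1) * A ^+ 2 + (1 + n%:R) * B ^+ 2.
  rewrite -subr_ge0.
  have -> : (1 + n%:R^-1) * A ^+ 2 + (1 + n%:R) * B ^+ 2 - (A + B) ^+ 2 =
    n%:R^-1 * (A - n%:R * B) ^+ 2 by field; rewrite gt_eqF.
  by rewrite mulr_ge0 ?sqr_ge0 ?invr_ge0 ?ltW.
apply: (le_trans hAB).
rewrite -natr1 (mulrDr (_ * ch_step)); apply: lerD.
  apply: (@le_trans _ _ ((1 + n%:R^-1) * (n%:R * ch_step * X))).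
    by rewrite ler_wpM2l// addr_ge0// invr_ge0 ltW.
  rewrite le_eqVlt; apply/orP; left; apply/eqP; field; rewrite gt_eqF//.
by rewrite -mulrA (addrC n%:R) ler_wpM2l// addr_ge0// ltW.
Qed.

Variable N : nat.
Hypothesis N0 : (0 < N)%N.
Hypothesis lN : lambda <= mu * N%:R.

(* [u_col] needs short time steps, whence the N pieces. *)
Lemma ch_variation x t s : 0 <= t -> 0 <= x -> 0 <= s -> mu * s <= 1 - x ->
  (ch x (t + s) - ch x t) ^+ 2 <=
  N%:R * ch_step * itg t (t + s) (fun q => ep x q ^+ 2 * m q).
Proof.
move=> t0 x0 s0 msx.
have Nr : 0 < N%:R :> R by rewrite ltr0n.
have sh : s <= h by rewrite -(ler_pM2l mu0) divff//; lra.
have := @ch_multi x t (s / N%:R) N t0 x0.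
rewrite (_ : N%:R * (s / N%:R) = s); last by field; rewrite gt_eqF.
apply.
  (* A piece of length s / N is so short that the characteristic of u starting at x stays in
     [0, 1]. *)
  have : lambda * (s / N%:R) <= mu * s.
    rewrite mulrA ler_pdivrMr// mulrAC ler_wpM2r//.
  lra.
rewrite divr_ge0 ?(ltW Nr)//= ler_pdivrMr// (le_trans sh)// ler_peMr ?(ltW h0)//.
by rewrite ler1n.
Qed.

(* The error of predicting v at the outlet with the estimate frozen at time t; the
   equation of ep rewrites it in terms of ep and of the variation of ch. *)
Definition defect t s : R := itg 0 s (fun z =>
  (c (mu * (s - z)) - ch (mu * (s - z)) t) * u (mu * (s - z)) (t + z)).
Local Notation epN := (epN ep).
(** The integral of ||varpi||^2 epsilon^2 along the characteristic of v that reaches the outlet at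
    time t + s. *)
Definition char_mep t s : R := itg 0 s (fun z => m (t + z) * ep (mu * (s - z)) (t + z) ^+ 2).
Definition mepN t : R := m t * epN t.

Lemma lbm_defect d' (T : measurableType d') (n : T -> R) (p q : T -> R) :
  lbm n p -> lbm n q -> lbm n (fun z => defect (p z) (q z)).
Proof. move=> lp lq; rewrite /defect; lbm. Qed.

Lemma lbm_mepN : lbm1 mepN.
Proof. have := lbm_epN lep; rewrite /mepN => ?; lbm. Qed.

Lemma mepN_ge0 t : 0 <= mepN t.
Proof. by rewrite mulr_ge0 ?m0 ?epN_ge0. Qed.

Lemma ep_char_itg s q : 0 <= s <= h ->
  itg 0 s (fun z => ep (mu * (s - z)) q ^+ 2) <= h * epN q.
Proof.
move=> /andP[s0 sh].
rewrite (_ : itg 0 s _ = itg 0 s (fun z => (fun x => ep x q ^+ 2) ((- mu) * z + mu * s))); last first.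
  by apply: itg_ext => z _; congr (ep _ _ ^+ 2); ring.
rewrite (@itg_affine_neg _ (- mu) (mu * s) 0 s (fun x => ep x q ^+ 2)) ?oppr_lt0//; last by lbm.
rewrite opprK ler_pM2l//; apply: itg_sub; [|by rewrite mulr0 add0r -(ler_pM2l h0) mulrA mulVf// mul1r mulr1|by lbm|].
  by rewrite mulNr addNr.
by move=> x _; exact: sqr_ge0.
Qed.

Lemma defect_sqr_le t s M U : 0 < t -> 0 <= s <= h ->
  (forall q, t <= q <= t + h -> m q <= M) -> 0 <= M ->
  itg 0 s (fun z => u (mu * (s - z)) (t + z) ^+ 2) <= U ->
  defect t s ^+ 2 <= 4 * (ep 0 (t + s) ^+ 2 + ep (mu * s) t ^+ 2 +
    rho ^+ 2 * h * M * char_mep t s +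
    N%:R * ch_step * h * U * itg t (t + h) mepN).
Proof.
move=> t0 /[dup] hs /andP[s0 sh] hM M0 hU.
have lme := lbm_mepN.
have ms : mu * s <= 1 by rewrite -(ler_pM2l mu0) divff in sh.
have ms0 : 0 <= mu * s by rewrite mulr_ge0// ltW.
(* [P1] uses the current estimate; the equation of ep expresses it by two values of ep and by the
   damping [P2]. [P3] is the drift of the estimate since time t. *)
pose P1 := itg 0 s (fun z => (c (mu * (s - z)) - ch (mu * (s - z)) (t + z)) * u (mu * (s - z)) (t + z)).
pose P2 := itg 0 s (fun z => ep (mu * (s - z)) (t + z) * m (t + z)).
pose P3 := itg 0 s (fun z => (ch (mu * (s - z)) (t + z) - ch (mu * (s - z)) t) * u (mu * (s - z)) (t + z)).
have E1 : ep 0 (t + s) = ep (mu * s) t + (P1 - rho * P2).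
  have := @tep (mu * s) t s (ltW t0) s0 ms; rewrite subrr lexx => -> //; congr (_ + _).
  rewrite /P1 /P2 -itgZ; last by lbm.
  rewrite -itgB; [|by lbm|by lbm].
  by apply: itg_ext => z _; rewrite mulrBr; ring.
have E2 : defect t s = P1 + P3.
  rewrite /defect /P1 /P3 -itgD; [|by lbm|by lbm].
  by apply: itg_ext => z _; ring.
have -> : defect t s = ep 0 (t + s) - ep (mu * s) t + rho * P2 + P3 by rewrite E2 E1; ring.
have four (a b c' d' : R) : (a - b + c' + d') ^+ 2 <= 4 * (a ^+ 2 + b ^+ 2 + c' ^+ 2 + d' ^+ 2).
  have := sqr_ge0 (a + b); have := sqr_ge0 (a - c'); have := sqr_ge0 (a - d').
  have := sqr_ge0 (b + c'); have := sqr_ge0 (b + d'); have := sqr_ge0 (c' - d'); nra.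
apply: (le_trans (four _ _ _ _)); rewrite ler_pM2l//.
have F2 : (rho * P2) ^+ 2 <= rho ^+ 2 * h * M * char_mep t s.
  rewrite exprMn (_ : _ * char_mep t s = rho ^+ 2 * (h * (M * char_mep t s))); last by ring.
  rewrite ler_wpM2l ?sqr_ge0//.
  apply: (le_trans (itg_sqr_le s0 _)); first by lbm.
  rewrite subr0; apply: ler_pM => //.
    by apply: itg_ge0 => z _; exact: sqr_ge0.
  rewrite /char_mep -itgZ; last by lbm.
  apply: itg_le; [by lbm|by lbm|] => z /andP[z0 zs].
  (* Of the two factors m only one is bounded by M; the other stays with ep^2, since m * ep^2 has a
     finite integral in time. *)
  rewrite (_ : _ ^+ 2 = m (t + z) * (m (t + z) * ep (mu * (s - z)) (t + z) ^+ 2)); last by ring.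
  apply: ler_wpM2r; first by apply: mulr_ge0; [exact: m0|exact: sqr_ge0].
  by apply: hM; rewrite lerDl z0 lerD2l (le_trans zs).
have F3 : P3 ^+ 2 <= N%:R * ch_step * h * U * itg t (t + h) mepN.
  have NC : 0 <= N%:R * ch_step by rewrite mulr_ge0 ?ch_step_ge0.
  apply: (le_trans (itg_cauchy_schwarz _ _ _ _)); [by lbm|by lbm|].
  rewrite (_ : N%:R * _ * _ * U * _ = (N%:R * ch_step * h * itg t (t + h) mepN) * U); last by ring.
  apply: ler_pM => //.
  - by apply: itg_ge0 => z _; exact: sqr_ge0.
  - by apply: itg_ge0 => z _; exact: sqr_ge0.
  apply: (@le_trans _ _ (itg 0 s (fun z => N%:R * ch_step *
      itg t (t + h) (fun q => ep (mu * (s - z)) q ^+ 2 * m q)))).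
    apply: itg_le; [by lbm|by lbm|] => z /andP[z0 zs].
    apply: (le_trans (ch_variation _ _ _ _)) => //; first exact: ltW.
    - by rewrite mulr_ge0 ?subr_ge0// ltW.
    - by rewrite mulrBr; lra.
    rewrite ler_wpM2l//; apply: itg_sub => //.
    - by rewrite lerD2l (le_trans zs).
    - by lbm.
    by move=> q _; rewrite mulr_ge0 ?sqr_ge0 ?m0.
  rewrite itgZ; last by lbm.
  rewrite -[leRHS]mulrA ler_wpM2l// itg_fubini; last by lbm.
  rewrite -itgZ//; apply: itg_le; [by lbm|by lbm|] => q _.
  rewrite itgZr; last by lbm.
  by rewrite /mepN mulrC mulrCA ler_wpM2l ?m0// ep_char_itg.
lra.
Qed.

(** As s runs over [0, h], the points mu * (s - z) at a fixed time t + z run through part of [0, 1]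
    with speed mu. This gives the factor h. In [char_mep_itg_time] the label is fixed and t varies,
    with the same effect. *)
Lemma char_mep_itg_label t : itg 0 h (char_mep t) <= h * itg t (t + h) mepN.
Proof.
have lme := lbm_mepN.
rewrite /char_mep (@itg_triangle _ (fun s z => m (t + z) * ep (mu * (s - z)) (t + z) ^+ 2)); last by lbm.
have -> : h * itg t (t + h) mepN = itg 0 h (fun z => h * mepN (z + t)).
  rewrite itgZ; last by lbm.
  by rewrite itg_shift// add0r addrC.
apply: itg_le; [by lbm|by lbm|] => z /andP[z0 zh].
rewrite itgZ; last by lbm.
rewrite /mepN addrC mulrCA ler_wpM2l ?m0//.
rewrite (_ : itg z h _ = itg z h (fun s => (fun x => ep x (z + t) ^+ 2) (mu * s + - (mu * z)))); last first.
  by apply: itg_ext => s _; rewrite mulrBr.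
rewrite (@itg_affine _ _ _ _ _ (fun x => ep x (z + t) ^+ 2))//; last by lbm.
rewrite ler_pM2l//; apply: itg_sub.
- by rewrite subrr.
- by rewrite divff// gerBl mulr_ge0// ltW.
- by lbm.
by move=> x _; exact: sqr_ge0.
Qed.

Lemma char_mep_itg_time a b : a <= b -> itg a b (char_mep ^~ h) <= h * itg a (b + h) mepN.
Proof.
move=> ab; have lme := lbm_mepN.
rewrite /char_mep itg_fubini; last by lbm.
apply: (@le_trans _ _ (itg 0 h (fun z => itg a (b + h) (fun q => m q * ep (mu * (h - z)) q ^+ 2)))).
  apply: itg_le; [by lbm|by lbm|] => z /andP[z0 zh].
  rewrite (@itg_shift _ a b z (fun q => m q * ep (mu * (h - z)) q ^+ 2)); last by lbm.
  apply: itg_sub; [by rewrite lerDl|by rewrite lerD2l|by lbm|].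
  by move=> q _; rewrite mulr_ge0 ?sqr_ge0 ?m0.
rewrite itg_fubini; last by lbm.
rewrite -itgZ//; apply: itg_le; [by lbm|by lbm|] => q _.
rewrite itgZ; last by lbm.
by rewrite /mepN mulrCA ler_wpM2l ?m0// ep_char_itg// lexx ltW.
Qed.

(** The two terms on the left are the ones that the control error needs: the defect over a full
    travel time, and its mean square over the intermediate ones. The window has length 2 * h, as t +
    s ranges up to a + 2 * h. *)
Lemma defect_block_le a M U : 0 <= a -> 0 <= M -> 0 <= U ->
  (forall q, a <= q <= a + 2 * h -> m q <= M) ->
  (forall t s, a <= t <= a + h -> 0 <= s <= h ->
     itg 0 s (fun z => u (mu * (s - z)) (t + z) ^+ 2) <= U) ->
  itg a (a + h) (fun t => defect t h ^+ 2) +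
  itg a (a + h) (fun t => itg 0 h (fun s => defect t s ^+ 2)) <=
  4 * (1 + h) * (itg a (a + 2 * h) (fun t => ep 0 t ^+ 2) + itg a (a + 2 * h) epN +
    (rho ^+ 2 * h ^+ 2 * M + N%:R * ch_step * h ^+ 2 * U) * itg a (a + 2 * h) mepN).
Proof.
move=> a0 M0 U0 hM hU; have lme := lbm_mepN; have lN' := lbm_epN lep.
have lD2 : lbm2 defect by apply: lbm_defect; lbm.
have lA2 : lbm2 char_mep by rewrite /char_mep; lbm.
have e2 : a + 2 * h = a + h + h by ring.
set Z := itg a (a + 2 * h) mepN.
have Z0 : 0 <= Z by apply: itg_ge0 => q _; exact: mepN_ge0.
set k1 := rho ^+ 2 * h * M; set k2 := N%:R * ch_step * h * U.
have k10 : 0 <= k1 by rewrite !mulr_ge0 ?sqr_ge0// ltW.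
have k20 : 0 <= k2 by rewrite mulr_ge0// mulr_ge0 ?(ltW h0)// mulr_ge0 ?ch_step_ge0.
have pt t s : a < t < a + h -> 0 <= s <= h ->
  defect t s ^+ 2 <= 4 * (ep 0 (t + s) ^+ 2 + ep (mu * s) t ^+ 2 + k1 * char_mep t s + k2 * Z).
  move=> /andP[at1 at2] hs; apply: (@le_trans _ _ (4 * (ep 0 (t + s) ^+ 2 + ep (mu * s) t ^+ 2 +
    k1 * char_mep t s + k2 * itg t (t + h) mepN))).
    apply: defect_sqr_le => //; first exact: le_lt_trans at1.
      by move=> q /andP[q1 q2]; apply: hM; lra.
    by apply: hU => //; rewrite !ltW.
  rewrite ler_pM2l// lerD2l ler_wpM2l//; apply: itg_sub => //; [exact: ltW|lra|].
  by move=> q _; exact: mepN_ge0.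
have aux (f g : R -> R) : lbm1 f -> lbm1 g -> (forall t, a < t < a + h -> f t <= g t) ->
    itg a (a + h) f <= itg a (a + h) g.
  move=> lf lg fg.
  rewrite (_ : itg a (a + h) f = itg a (a + h) (fun t => if (a < t < a + h)%R then f t else g t)).
    apply: itg_le; [|by []|].
      by lbm.
    by move=> t _; case: ifP => // /fg.
  apply: itg_ext_oo => //; first by lbm.
  by move=> t ->.
have ep_shift s : 0 <= s <= h ->
    itg a (a + h) (fun t => ep 0 (t + s) ^+ 2) <= itg a (a + 2 * h) (fun t => ep 0 t ^+ 2).
  move=> /andP[s0 sh]; rewrite (@itg_shift _ _ _ s (fun t => ep 0 t ^+ 2)); last by lbm.
  apply: itg_sub; [by rewrite lerDl|lra|by lbm|].
  by move=> q _; exact: sqr_ge0.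
set X := itg a (a + 2 * h) (fun t => ep 0 t ^+ 2) in ep_shift *.
set Y := itg a (a + 2 * h) epN.
have aah : a <= a + h by rewrite lerDl ltW.
have YY : itg a (a + h) epN <= Y.
  by apply: itg_sub => //; [lra|move=> q _; exact: epN_ge0].
have Y0 : 0 <= Y by apply: itg_ge0 => q _; exact: epN_ge0.
have X0 : 0 <= X by apply: itg_ge0 => q _; exact: sqr_ge0.
have P : itg a (a + h) (fun t => defect t h ^+ 2) <= 4 * (X + k1 * (h * Z) + h * (k2 * Z)).
  apply: (@le_trans _ _ (itg a (a + h) (fun t => 4 * (ep 0 (t + h) ^+ 2 + k1 * char_mep t h + k2 * Z)))).
    apply: aux; [by lbm|by lbm|] => t ht.
    (* At s = h the term ep (mu * s) t is ep 1 t = 0, so no interior value of ep remains to be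
       integrated in t. *)
    have := pt t h ht; rewrite lexx (ltW h0) divff// => /(_ isT).
    by rewrite bep ?expr0n ?addr0//; case/andP: ht => /(le_lt_trans a0).
  rewrite itgZ; last by lbm.
  rewrite itgD; [|by lbm|by lbm]; rewrite itgD; [|by lbm|by lbm].
  rewrite itg_cst// (addrC a) addrK itgZ; last by lbm.
  rewrite ler_pM2l// (mulrC (k2 * Z)) lerD2r lerD//.
    by rewrite addrC; apply: ep_shift; rewrite lexx ltW.
  rewrite ler_wpM2l//; apply: (le_trans (char_mep_itg_time _)) => //; first by rewrite lerDr ltW.
  by rewrite /Z e2 (addrC h a).
have Q : itg a (a + h) (fun t => itg 0 h (fun s => defect t s ^+ 2)) <=
    4 * (h * X + h * Y + h * (k1 * (h * Z)) + h * (h * (k2 * Z))).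
  apply: (@le_trans _ _ (itg a (a + h) (fun t => 4 * (itg 0 h (fun s => ep 0 (t + s) ^+ 2) +
      h * epN t + k1 * (h * Z) + h * (k2 * Z))))).
    apply: aux; [by lbm|by lbm|] => t ht.
    apply: (@le_trans _ _ (itg 0 h (fun s => 4 * (ep 0 (t + s) ^+ 2 + ep (mu * s) t ^+ 2 + k1 * char_mep t s + k2 * Z)))).
      by apply: itg_le; [by lbm|by lbm|] => s hs; exact: pt.
    rewrite itgZ; last by lbm.
    rewrite itgD; [|by lbm|by lbm]; rewrite itgD; [|by lbm|by lbm]; rewrite itgD; [|by lbm|by lbm].
    rewrite itg_cst ?(ltW h0)// subr0 itgZ; last by lbm.
    rewrite ler_pM2l// (mulrC (k2 * Z)) lerD2r; apply: lerD.
      rewrite lerD2l (_ : itg 0 h _ = itg 0 h (fun s => (fun x => ep x t ^+ 2) (mu * s + 0))); last first.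
        by apply: itg_ext => s _; rewrite addr0.
      rewrite (@itg_affine _ _ _ _ _ (fun x => ep x t ^+ 2))//; last by lbm.
      by rewrite mulr0 !addr0 divff.
    rewrite ler_wpM2l// (le_trans (char_mep_itg_label _))// ler_pM2l//.
    have /andP[at1 at2] := ht; apply: itg_sub => //; [exact: ltW|lra|].
    by move=> q _; exact: mepN_ge0.
  rewrite itgZ; last by lbm.
  rewrite itgD; [|by lbm|by lbm]; rewrite itgD; [|by lbm|by lbm]; rewrite itgD; [|by lbm|by lbm].
  rewrite !itg_cst// (addrC a h) addrK (addrC h a) itgZ//.
  rewrite ler_pM2l// (mulrC (h * (k2 * Z))) lerD2r (mulrC (k1 * (h * Z))) lerD2r lerD//.
    rewrite itg_fubini; last by lbm.
    apply: (@le_trans _ _ (itg 0 h (fun=> X))); last first.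
      by rewrite itg_cst ?(ltW h0)// subr0 mulrC.
    by apply: itg_le; [by lbm|by lbm|] => s hs; exact: ep_shift.
  by rewrite ler_pM2l.
apply: (le_trans (lerD P Q)).
rewrite -subr_ge0.
have -> : 4 * (1 + h) * (X + Y + (rho ^+ 2 * h ^+ 2 * M + N%:R * ch_step * h ^+ 2 * U) * Z) -
  (4 * (X + k1 * (h * Z) + h * (k2 * Z)) + 4 * (h * X + h * Y + h * (k1 * (h * Z)) + h * (h * (k2 * Z)))) =
  4 * Y by rewrite /k1 /k2; ring.
by rewrite mulr_ge0.
Qed.

End variation.

(** * Outlet values of the kernels *)

Section volterra_kernel.
Context {R : realType}.
Variables (lambda mu r cbar : R).
Hypotheses (lambda0 : 0 < lambda) (mu0 : 0 < mu) (r0 : 0 < r) (cbar0 : 0 < cbar).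
Local Notation d := (lambda^-1).
Local Notation h := (mu^-1).
Implicit Types (x s t xi zeta theta : R).
(** The characteristic of K^u through (x, 0) leaves the diagonal at alpha * x, and [beta] is the
    factor by which the condition at xi = 0 turns K^v(x, 0) into (lambda + mu) K^u(x, 0). *)
Local Notation alpha := (lambda / (lambda + mu)).
Local Notation beta := ((lambda + mu) * mu / (lambda * r)).

(* The kernel equations integrated along characteristics, with
   kappa(x - xi) = K^v(x, xi) and Ku1 = K^u(1, .). *)
Definition volterra_kernel (k kappa Ku1 : R -> R) : Prop :=
  (forall zeta, 0 <= zeta <= 1 -> beta * kappa zeta = - k (alpha * zeta) +
    itg 0 zeta (fun xi => kappa (zeta - xi) * k (alpha * xi))) /\
  (forall xi, 0 <= xi <= 1 -> (lambda + mu) * Ku1 xi =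
    - k (alpha * (1 + mu * d * xi)) +
    itg xi 1 (fun z => kappa (1 - z) * k (alpha * (z + mu * d * xi)))).

Variables (k kappa Ku1 : R -> R).
Hypotheses (lk : lbm1 k) (lkappa : lbm1 kappa) (lKu : lbm1 Ku1).
Hypothesis kb : forall x, 0 <= x <= 1 -> `|k x| <= cbar.
Hypothesis K : volterra_kernel k kappa Ku1.

Let lm0 : 0 < lambda + mu. Proof. by rewrite addr_gt0. Qed.
Let lmn0 : lambda + mu != 0. Proof. by rewrite gt_eqF. Qed.
Let mn0 : mu != 0. Proof. by rewrite gt_eqF. Qed.
Let ln0 : lambda != 0. Proof. by rewrite gt_eqF. Qed.
Let rn0 : r != 0. Proof. by rewrite gt_eqF. Qed.
Let h0 : 0 < h. Proof. by rewrite invr_gt0. Qed.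
Let d0 : 0 < d. Proof. by rewrite invr_gt0. Qed.
Let beta0 : 0 < beta. Proof. by rewrite divr_gt0 ?mulr_gt0. Qed.
Let alpha0 : 0 < alpha. Proof. by rewrite divr_gt0. Qed.
Let alpha1 : alpha <= 1. Proof. by rewrite ler_pdivrMr// mul1r lerDl ltW. Qed.

Definition kappa_mass : R := 2 * expR (2 * (cbar / beta) * 1) * (cbar / beta * 1).
(** It depends on the coefficient only through cbar, hence bounds the kernels of c^(., t) uniformly
    in t and for all trajectories. The two summands of the first factor serve kappa and Ku1
    respectively. *)
Definition kernel_bound : R := (cbar / beta + cbar / (lambda + mu)) * (1 + kappa_mass).

Lemma kappa_mass_ge0 : 0 <= kappa_mass.
Proof.
rewrite /kappa_mass !mulr1; apply: mulr_ge0; last by rewrite ltW// divr_gt0.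
by apply: mulr_ge0 => //; exact: expR_ge0.
Qed.

Lemma kernel_bound_ge0 : 0 <= kernel_bound.
Proof.
apply: mulr_ge0; last by rewrite addr_ge0// kappa_mass_ge0.
by rewrite addr_ge0// ltW// divr_gt0.
Qed.

Let kernel_boundE : kernel_bound =
  cbar / beta * (1 + kappa_mass) + cbar / (lambda + mu) * (1 + kappa_mass).
Proof. exact: mulrDl. Qed.

Let kb' x : 0 <= x <= 1 -> `|k (alpha * x)| <= cbar.
Proof.
move=> /andP[x0 x1]; apply: kb; rewrite mulr_ge0 ?(ltW alpha0)//=.
by rewrite mulr_ile1// ltW.
Qed.

Lemma kappa_volterra zeta : 0 <= zeta <= 1 ->
  `|kappa zeta| <= cbar / beta + cbar / beta * itg 0 zeta (fun x => `|kappa x|).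
Proof.
move=> /[dup] hz /andP[z0 z1].
have -> : kappa zeta = beta^-1 * (- k (alpha * zeta) +
    itg 0 zeta (fun xi => kappa (zeta - xi) * k (alpha * xi))).
  by rewrite -K.1// mulrA mulVf ?mul1r// gt_eqF.
rewrite normrM gtr0_norm ?invr_gt0//.
have -> : cbar / beta + cbar / beta * itg 0 zeta (fun x => `|kappa x|) =
  beta^-1 * (cbar + cbar * itg 0 zeta (fun x => `|kappa x|)) by ring.
rewrite ler_pM2l ?invr_gt0// (le_trans (ler_normD _ _))// normrN lerD ?kb'//.
apply: (le_trans (itg_norm _ _ _)); first by lbm.
have -> : itg 0 zeta (fun x => `|kappa x|) = itg 0 zeta (fun x => `|kappa (zeta - x)|).
  by rewrite (@itg_refl _ 0 zeta zeta (fun x => `|kappa x|)) ?subrr ?subr0//; lbm.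
rewrite -itgZ; last by lbm.
apply: itg_le; [by lbm|by lbm|] => x /andP[x0 xz].
by rewrite normrM mulrC ler_wpM2r// kb'// x0 (le_trans xz).
Qed.

Lemma kappa_mass_le zeta : 0 <= zeta <= 1 -> itg 0 zeta (fun x => `|kappa x|) <= kappa_mass.
Proof.
move=> /andP[z0 z1]; have cb0 : 0 < cbar / beta by rewrite divr_gt0.
apply: (@le_trans _ _ (itg 0 1 (fun x => `|kappa x|))).
  by apply: itg_sub => //; lbm.
apply: (le_trans (@gronwall _ (cbar / beta) 1 (fun x => `|kappa x|) (fun=> cbar / beta) _ _ _ _ _ _ _)) => //.
- by lbm.
- by lbm.
- by move=> _ _; exact: ltW.
- by move=> x hx; exact: kappa_volterra.
by rewrite itg_cst// subr0.
Qed.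

Lemma kappa_le zeta : 0 <= zeta <= 1 -> `|kappa zeta| <= kernel_bound.
Proof.
move=> hz; apply: (le_trans (kappa_volterra hz)).
have M := kappa_mass_le hz; have M0 := kappa_mass_ge0.
have b0 : 0 < cbar / beta by rewrite divr_gt0.
have l0 : 0 <= cbar / (lambda + mu) * (1 + kappa_mass).
  by apply: mulr_ge0; [rewrite ltW// divr_gt0|rewrite addr_ge0].
rewrite kernel_boundE (le_trans _ (lerD (lexx _) l0))// addr0 (mulrDr (cbar / beta)) mulr1.
by rewrite lerD2l ler_pM2l.
Qed.

Lemma Ku1_le xi : 0 <= xi <= 1 -> `|Ku1 xi| <= kernel_bound.
Proof.
move=> /[dup] hx /andP[x0 x1].
have M : itg 0 1 (fun x => `|kappa x|) <= kappa_mass by apply: kappa_mass_le; rewrite ler01 lexx.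
have M0 := kappa_mass_ge0.
have b0 : 0 <= cbar / beta * (1 + kappa_mass).
  by apply: mulr_ge0; [rewrite ltW// divr_gt0|rewrite addr_ge0].
rewrite kernel_boundE (le_trans _ (lerD b0 (lexx _)))// add0r.
rewrite mulrAC ler_pdivlMr// mulrC -[X in X * _](gtr0_norm lm0) -normrM K.2//.
have kk z : xi <= z <= 1 -> `|k (alpha * (z + mu * d * xi))| <= cbar.
  move=> /andP[z0 z1]; apply: kb.
  have -> : alpha * (z + mu * d * xi) = (lambda * z + mu * xi) / (lambda + mu).
    by field; rewrite ?lmn0.
  rewrite divr_ge0 ?(ltW lm0) ?addr_ge0 ?mulr_ge0 ?(ltW lambda0) ?(ltW mu0) ?(le_trans x0 z0)//=.
  rewrite ler_pdivrMr// mul1r lerD// ler_piMr// ltW//.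
rewrite (le_trans (ler_normD _ _))// normrN (mulrDr cbar) mulr1 lerD//.
  by apply: kk; rewrite x1 lexx.
apply: (le_trans (itg_norm _ _ _)); first by lbm.
apply: (@le_trans _ _ (cbar * itg 0 1 (fun x => `|kappa x|))); last by rewrite ler_pM2l.
have -> : itg 0 1 (fun x => `|kappa x|) = itg 0 1 (fun x => `|kappa (1 - x)|).
  by rewrite (@itg_refl _ 0 1 1 (fun x => `|kappa x|)) ?subrr ?subr0//; lbm.
apply: (@le_trans _ _ (cbar * itg xi 1 (fun x => `|kappa (1 - x)|))).
  rewrite -itgZ; last by lbm.
  apply: itg_le; [by lbm|by lbm|] => x hxx.
  by rewrite normrM mulrC ler_wpM2r// kk.
by rewrite ler_pM2l//; apply: itg_sub => //; lbm.
Qed.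

Section identity.
Variable z : R -> R.
Hypothesis lz : lbm1 z.

(** If z is the outlet trace shifted by t, this is the integral of w u along the characteristic of v
    arriving at x = 0 at time t + s, with u written as a delayed trace. For w = c it is what the
    plant adds to v; for w = c^(., t) it is the prediction of this contribution. *)
Definition Jint (w : R -> R) s : R :=
  itg 0 s (fun q => w (mu * (s - q)) * (r * z (q - mu * (s - q) * d))).

Lemma Jint_label w s : lbm1 w -> 0 <= s ->
  Jint w s = r * alpha * itg (- (mu * s * d)) s (fun theta => w (alpha * (mu * s - mu * theta)) * z theta).
Proof.
move=> lw s0; rewrite /Jint.
rewrite (_ : itg 0 s _ = itg 0 s (fun q => (fun theta => r * (w (alpha * (mu * s - mu * theta)) * z theta))
    (alpha^-1 * q + - (mu * s * d)))); last first.
  apply: itg_ext => q _.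
  have -> : mu * s - mu * (alpha^-1 * q - mu * s * d) = alpha^-1 * (mu * (s - q)).
    by field; rewrite ln0 lmn0.
  rewrite (mulVKf (lt0r_neq0 alpha0)) mulrCA; congr (_ * (_ * z _)).
  by field; rewrite ln0 lmn0.
rewrite (@itg_affine _ _ _ _ _ (fun theta => r * (w (alpha * (mu * s - mu * theta)) * z theta))); last 2 first.
- by rewrite invr_gt0.
- by lbm.
rewrite invrK itgZ; last by lbm.
rewrite mulrCA mulrA mulr0 add0r (_ : alpha^-1 * s - _ = s)//.
by field; rewrite ln0 lmn0.
Qed.

(** Both sides are integrals of z over [- d, h], for an arbitrary z, and after Fubini their
    densities can be compared. At theta < 0 equality is the second Volterra equation at xi = -
    lambda * theta, at theta > 0 the first one at zeta = 1 - mu * theta. *)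
Lemma kernel_identity :
  itg 0 1 (fun xi => Ku1 xi * (r * z (- xi * d))) +
  itg 0 1 (fun xi => kappa (1 - xi) * z (xi * h)) + Jint k h =
  itg 0 1 (fun xi => kappa (1 - xi) * Jint k (xi * h)).
Proof.
pose G xi theta := if (- d * xi <= theta <= h * xi)%R
  then kappa (1 - xi) * (r * alpha * (k (alpha * (xi - mu * theta)) * z theta)) else 0.
have lG : lbm2 G by rewrite /G; lbm.
pose B theta := k (alpha * (1 - mu * theta)).
have lB : lbm1 B by rewrite /B; lbm.
have JE xi : 0 <= xi <= 1 -> kappa (1 - xi) * Jint k (xi * h) = itg (- d) h (G xi).
  move=> /andP[x0 x1]; rewrite Jint_label// ?mulr_ge0 ?(ltW h0)//.
  have -> : mu * (xi * h) = xi by field.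
  rewrite -[in LHS]itgZ; last by lbm.
  rewrite -itgZ; last by lbm.
  rewrite (@itg_ind _ (- d) h) //; last 3 first.
  - by lbm.
  - by rewrite lerN2 ler_piMl// ltW.
  - by rewrite ler_piMl// ltW.
  apply: itg_ext => theta _; rewrite /G (mulrC h) mulNr (mulrC d).
  by case: ifP => _; rewrite ?mul1r ?mul0r.
rewrite [RHS](_ : _ = itg 0 1 (fun xi => itg (- d) h (G xi))); last exact: itg_ext.
rewrite itg_fubini// [RHS](@itg_split _ 0); [|by rewrite oppr_le0 !ltW|by lbm].
have neg : itg (- d) 0 (fun theta => itg 0 1 (G ^~ theta)) =
    itg (- d) 0 (fun theta => r * lambda * (Ku1 (- lambda * theta) * z theta) + r * alpha * (B theta * z theta)).
  apply: itg_ext_oo; [by lbm|by lbm|] => theta /andP[t1 t2].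
  pose xi := - lambda * theta.
  have hxi : 0 <= xi <= 1.
    rewrite /xi mulNr oppr_ge0 (nmulr_lle0 _ t2) (ltW lambda0)/= -mulrN -(ler_pM2l d0) mulrA mulVf// mul1r mulr1 lerNl ltW//.
  transitivity (r * alpha * z theta * itg xi 1 (fun x => kappa (1 - x) * k (alpha * (x + mu * d * xi)))).
    rewrite -itgZ; last by lbm.
    rewrite [RHS](@itg_ind _ 0 1)//; last 2 first.
    - by lbm.
    - by case/andP: hxi.
    apply: itg_ext => x /andP[x0 x1]; rewrite /G x1 andbT.
    have -> : (theta <= h * x) = true by rewrite (le_trans (ltW t2))// mulr_ge0// ltW.
    have -> : (- d * x <= theta) = (xi <= x).
      by rewrite /xi !mulNr lerNl [RHS]lerNl -(ler_pM2l lambda0) mulrN -[in LHS](mulrN lambda) mulrN (mulrA lambda d) divff// mul1r lerNl.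
    rewrite andbT; case: ifP => _; rewrite ?mul1r ?mul0r//.
    have -> : x + mu * d * xi = x - mu * theta by rewrite /xi; field.
    ring.
  have := K.2 _ hxi; set I := itg xi 1 _ => KE.
  have {KE} -> : I = (lambda + mu) * Ku1 xi + k (alpha * (1 + mu * d * xi)).
    by rewrite KE addrAC addNr add0r.
  have -> : 1 + mu * d * xi = 1 - mu * theta by rewrite /xi; field.
  rewrite -/(B theta); field; rewrite lmn0//.
have pos : itg 0 h (fun theta => itg 0 1 (G ^~ theta)) =
    itg 0 h (fun theta => mu * (kappa (1 - mu * theta) * z theta) + r * alpha * (B theta * z theta)).
  apply: itg_ext_oo; [by lbm|by lbm|] => theta /andP[t1 t2].
  pose zeta := 1 - mu * theta.
  have mt : mu * theta <= 1 by rewrite -(ler_pM2l h0) mulrA mulVf// mul1r mulr1 ltW.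
  have mt0 : 0 <= mu * theta by rewrite mulr_ge0// ltW.
  have hzeta : 0 <= zeta <= 1 by rewrite /zeta subr_ge0 mt lerBlDr lerDl.
  transitivity (r * alpha * z theta * itg 0 zeta (fun x => kappa (zeta - x) * k (alpha * x))).
    transitivity (r * alpha * z theta * itg (mu * theta) 1 (fun x => kappa (1 - x) * k (alpha * (x - mu * theta)))).
      rewrite -itgZ; last by lbm.
      rewrite [RHS](@itg_ind _ 0 1)//; last by lbm.
      apply: itg_ext => x /andP[x0 x1]; rewrite /G x1 andbT.
      have -> : (- d * x <= theta) = true by rewrite (le_trans _ (ltW t1))// mulNr oppr_le0 mulr_ge0// ltW.
      have -> : (theta <= h * x) = (mu * theta <= x).
        by rewrite -(ler_pM2l mu0) mulrA divff// mul1r.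
      by rewrite /=; case: ifP => _; rewrite ?mul1r ?mul0r//; ring.
    congr (_ * _).
    have := @itg_shift _ 0 zeta (mu * theta) (fun x => kappa (1 - x) * k (alpha * (x - mu * theta))).
    rewrite add0r /zeta subrK => <-; last by lbm.
    by apply: itg_ext => x _; congr (kappa _ * k (alpha * _)); ring.
  have := K.1 _ hzeta; set I := itg 0 zeta _ => KE.
  have {KE} -> : I = beta * kappa zeta + k (alpha * zeta).
    by rewrite KE addrAC addNr add0r.
  rewrite -/zeta /B -/zeta; field; rewrite lmn0 ln0 rn0//.
rewrite neg pos itgD; [|by lbm|by lbm]; rewrite itgD; [|by lbm|by lbm].
have J1 : Jint k h = itg (- d) 0 (fun theta => r * alpha * (B theta * z theta)) +
    itg 0 h (fun theta => r * alpha * (B theta * z theta)).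
  rewrite Jint_label ?(ltW h0)// divff// mul1r -itg_split; [|by rewrite oppr_le0 !ltW|by lbm].
  by rewrite itgZ//; lbm.
have U1 : itg 0 1 (fun xi => Ku1 xi * (r * z (- xi * d))) =
    itg (- d) 0 (fun theta => r * lambda * (Ku1 (- lambda * theta) * z theta)).
  transitivity (itg 0 1 (fun xi => (fun theta => r * (Ku1 (- lambda * theta) * z theta)) (- d * xi + 0))).
    apply: itg_ext => xi _; have -> : - lambda * (- d * xi + 0) = xi by field.
    by rewrite addr0 (_ : - xi * d = - d * xi); ring.
  rewrite (@itg_affine_neg _ (- d) 0 0 1 (fun theta => r * (Ku1 (- lambda * theta) * z theta))) ?oppr_lt0//; last by lbm.
  rewrite opprK invrK mulr1 mulr0 !addr0 -itgZ; last by lbm.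
  by apply: itg_ext => theta _; ring.
have U2 : itg 0 1 (fun xi => kappa (1 - xi) * z (xi * h)) =
    itg 0 h (fun theta => mu * (kappa (1 - mu * theta) * z theta)).
  transitivity (itg 0 1 (fun xi => (fun theta => kappa (1 - mu * theta) * z theta) (h * xi + 0))).
    apply: itg_ext => xi _; have -> : mu * (h * xi + 0) = xi by field.
    by rewrite addr0 (mulrC h).
  rewrite (@itg_affine _ h 0 0 1 (fun theta => kappa (1 - mu * theta) * z theta))//; last by lbm.
  by rewrite invrK mulr1 mulr0 !addr0 -itgZ//; lbm.
rewrite J1 U1 U2; ring.
Qed.

End identity.
End volterra_kernel.

(** * The closed loop over all periods *)

Lemma discrete_gronwall (R : realType) (K : R) (x a : nat -> R) : 0 <= K ->
  (forall n, 0 <= a n) -> (forall n, 0 <= x n) ->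
  (forall n, x n <= K + \sum_(0 <= i < n) a i * x i) ->
  forall n, x n <= K * expR (\sum_(0 <= i < n) a i).
Proof.
move=> K0 a0 x0 hx n; apply: (le_trans (hx n)).
elim: n => [|n IH]; first by rewrite !big_geq// expR0 mulr1 addr0.
rewrite !big_nat_recr//= expRD mulrA addrA.
set P := K + _ in IH *.
apply: (@le_trans _ _ (P * (1 + a n))).
  by rewrite mulrDr mulr1 lerD2l mulrC ler_wpM2r// hx.
apply: ler_pM => //; last exact: expR_ge1Dx.
- by rewrite addr_ge0// sumr_ge0// => i _; rewrite mulr_ge0.
- by rewrite addr_ge0.
Qed.

Lemma sqrD3_le (R : realDomainType) (a b c : R) :
  (a + b + c) ^+ 2 <= 3 * (a ^+ 2 + b ^+ 2 + c ^+ 2).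
Proof.
by have := sqr_ge0 (a - b); have := sqr_ge0 (a - c); have := sqr_ge0 (b - c); nra.
Qed.

Lemma sqrD4_le (R : realDomainType) (a b c k : R) :
  (a + b + (c + k)) ^+ 2 <= 4 * (a ^+ 2 + b ^+ 2 + (c ^+ 2 + k ^+ 2)).
Proof.
have := sqr_ge0 (a - b); have := sqr_ge0 (a - c); have := sqr_ge0 (a - k).
by have := sqr_ge0 (b - c); have := sqr_ge0 (b - k); have := sqr_ge0 (c - k); nra.
Qed.

(** M n is not compared with a single increment of S: only the sum of all M i is at most Cm * S n,
    so the recursion is summed first and k * Cm <= 1/2 absorbs half of S n. Gronwall is then applied
    to S n + p, since the coefficient a n multiplies the initial perturbation too. *)
Lemma recursion_sum (R : realType) (k Cm Cb Ca B A p : R) (S M b a : nat -> R) :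
  0 <= k -> 0 <= Cb -> 0 <= Ca -> 0 <= p ->
  (forall n, 0 <= S n) -> (forall n, 0 <= a n) ->
  (forall n, S n.+1 - S n <= k * M n + Cb * b n + Ca * (S n + p) * a n) ->
  (forall n, \sum_(0 <= i < n) M i <= Cm * S n) -> k * Cm <= 2^-1 ->
  (forall n, \sum_(0 <= i < n) b i <= B) -> (forall n, \sum_(0 <= i < n) a i <= A) ->
  forall n, S n + p <= (2 * (S 0%N + Cb * B) + p) * expR (2 * Ca * A).
Proof.
move=> k0 Cb0 Ca0 p0 S0 a0 rec hM kC hb ha n.
have X0 i : 0 <= S i + p by rewrite addr_ge0.
have B0 : 0 <= B by have := hb 0%N; rewrite big_geq.
have G i : S i + p <= (2 * (S 0%N + Cb * B) + p) +
    \sum_(0 <= j < i) (2 * Ca * a j) * (S j + p).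
  have T : S i <= S 0%N + k * (Cm * S i) + Cb * B + Ca * \sum_(0 <= j < i) a j * (S j + p).
    have : S i <= S 0%N + \sum_(0 <= j < i) (k * M j + Cb * b j + Ca * (S j + p) * a j).
      elim: i => [|i IH]; first by rewrite big_geq// addr0.
      rewrite big_nat_recr//=; have := rec i; move: IH; lra.
    rewrite !big_split/= -!mulr_sumr.
    have -> : \sum_(0 <= j < i) Ca * (S j + p) * a j = Ca * \sum_(0 <= j < i) a j * (S j + p).
      by rewrite mulr_sumr; apply: eq_bigr => j _; ring.
    have := ler_wpM2l k0 (hM i); have := ler_wpM2l Cb0 (hb i); lra.
  have : k * (Cm * S i) <= 2^-1 * S i by rewrite mulrA ler_wpM2r.
  have -> : \sum_(0 <= j < i) 2 * Ca * a j * (S j + p) = 2 * (Ca * \sum_(0 <= j < i) a j * (S j + p)).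
    by rewrite !mulr_sumr; apply: eq_bigr => j _; ring.
  lra.
have K0 : 0 <= 2 * (S 0%N + Cb * B) + p by rewrite addr_ge0// mulr_ge0// addr_ge0// mulr_ge0.
have a20 i : 0 <= 2 * Ca * a i by rewrite mulr_ge0// mulr_ge0.
apply: (le_trans (discrete_gronwall K0 a20 X0 G n)).
rewrite ler_wpM2l// ler_expR -mulr_sumr ler_wpM2l// mulr_ge0//.
Qed.

(** For either sign, [barrier] applies to the excess of F or - F over the bound: where this excess
    is positive, the damping has the favourable sign. *)
Lemma damped_bound (R : realType) (F g k : R -> R) (s : R) : 0 <= s ->
  lbm1 F -> lbm1 g -> lbm1 k -> (forall z, 0 <= k z) ->
  (forall z, 0 <= z <= s -> F z = F 0 + itg 0 z (fun q => g q - k q * F q)) ->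
  `|F s| <= `|F 0| + itg 0 s (fun q => `|g q|).
Proof.
move=> s0 lF lg lk k0 hF.
have B (sg : R) : `|sg| = 1 -> sg * F s - (`|F 0| + itg 0 s (fun q => `|g q|)) <= 0.
  move=> sg1; apply: (@barrier _ (fun z => sg * F z - (`|F 0| + itg 0 z (fun q => `|g q|)))
    (fun q => sg * (g q - k q * F q) - `|g q|) 0 s s0).
  - by lbm.
  - by rewrite itg_nil// addr0 subr_le0 (le_trans (ler_norm _))// normrM sg1 mul1r.
  - move=> z hz; rewrite itgB; [|by lbm|by lbm].
    by rewrite itgZ; [rewrite (itg_nil _ (lexx 0)) (hF z hz); ring|lbm].
  move=> z hz pz.
  have I0 : 0 <= itg 0 z (fun q => `|g q|) by apply: itg_ge0.
  have sF : 0 <= sg * F z by have := normr_ge0 (F 0); lra.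
  have sgg : sg * g z <= `|g z|.
    by rewrite (le_trans (ler_norm _))// normrM sg1 mul1r.
  have : 0 <= k z * (sg * F z) by rewrite mulr_ge0.
  rewrite mulrBr (mulrCA sg); lra.
have := B 1; have := B (-1); rewrite normrN normr1 => /(_ erefl) b1 /(_ erefl) b2.
rewrite ler_norml; apply/andP; split; lra.
Qed.

Section loop.
Context {R : realType}.
Variables (lambda mu r cbar rho gamma gamma1 : R).
Hypotheses (lambda0 : 0 < lambda) (mu0 : 0 < mu) (r0 : 0 < r) (cbar0 : 0 < cbar).
Hypotheses (rho0 : 0 < rho) (gamma0 : 0 < gamma) (gamma10 : 0 < gamma1).
Local Notation d := (lambda^-1).
Local Notation h := (mu^-1).
Implicit Types (x s t T a b l xi E : R).

Local Notation ctr := (ctr_const lambda mu r cbar).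
Local Notation kbd := (kernel_bound lambda mu r cbar).
Local Notation cK := (kbd + 1).
Local Notation colK := (r ^+ 2 * obs_const lambda mu r cbar).
Definition pieces : nat := (Num.bound (lambda / mu)).+1.
Definition growth_rate : R := 8 * cK ^+ 2 * (ctr + 1) + obs_rate mu r cbar.
Definition growth : R :=
  1 + 2 * expR (2 * growth_rate * (2 * h)) * (2 * h * growth_rate).
Definition pert_gain : R := 12 * cK ^+ 2 + 12 * (1 + kbd ^+ 2 * mu) * (1 + h).
Definition learn_gain : R := 12 * (1 + kbd ^+ 2 * mu) * (1 + h) *
  (rho ^+ 2 * h ^+ 2 * ctr + pieces%:R * ch_step gamma gamma1 colK * h ^+ 2 * r ^+ 2) * growth.

Variables (E : R) (c : R -> R) (u v e ep ch : R -> R -> R).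
Hypotheses (E0 : 0 < E) (E1 : E <= 1).
Local Notation m := (energy u v).
Hypotheses (lc : lbm1 c).
Hypotheses (lu : lbm2 u) (lv : lbm2 v) (le : lbm2 e) (lep : lbm2 ep) (lch : lbm2 ch).
Hypothesis cb : forall x, 0 <= x <= 1 -> `|c x| <= cbar.
Hypothesis chb : forall x t, 0 <= x <= 1 -> 0 <= t -> `|ch x t| <= cbar.
Hypothesis tu : forall x t s, 0 <= t -> 0 <= s -> 0 <= x -> x + lambda * s <= 1 ->
  u (x + lambda * s) (t + s) = u x t.
Hypothesis tv : forall x t s, 0 <= t -> 0 <= s -> x <= 1 -> 0 <= x - mu * s ->
  v (x - mu * s) (t + s) =
  v x t + itg 0 s (fun z => c (x - mu * z) * u (x - mu * z) (t + z)).
Hypothesis bu : forall t, 0 < t -> u 0 t = r * v 0 t.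
Hypothesis te : forall x t s, 0 <= t -> 0 <= s -> 0 <= x -> x + lambda * s <= 1 ->
  e (x + lambda * s) (t + s) =
  e x t + itg 0 s (fun z => rho * e (x + lambda * z) (t + z) * - m (t + z)).
Hypothesis tep : forall x t s, 0 <= t -> 0 <= s -> x <= 1 -> 0 <= x - mu * s ->
  ep (x - mu * s) (t + s) =
  ep x t + itg 0 s (fun z => (c (x - mu * z) - ch (x - mu * z) (t + z)) * u (x - mu * z) (t + z)
    - rho * ep (x - mu * z) (t + z) * m (t + z)).
Hypothesis be : forall t, 0 < t -> e 0 t = r * ep 0 t.
Hypothesis bep : forall t, 0 < t -> ep 1 t = 0.
Hypothesis upd : forall x t, 0 <= x <= 1 -> 0 <= t ->
  ch x t = ch x 0 + itg 0 t (fun s =>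
    Proj cbar (gamma1 * expR (gamma * x) * ep x s * u x s) (ch x s)).
(** All that the closed loop uses of the neural operators: slices at x = 1 that are bounded,
    measurable and within E of outlet kernels solving the Volterra equations. Here kappa (1 - xi)
    stands for K^v(1, xi). *)
Hypothesis control_kernel : forall t, 0 < t ->
  exists kappa Ku1 Nu Nv : R -> R,
    [/\ [/\ lbm1 kappa, lbm1 Ku1, lbm1 Nu & lbm1 Nv],
        volterra_kernel lambda mu r (ch ^~ t) kappa Ku1,
        forall xi, 0 < xi < 1 -> `|Ku1 xi - Nu xi| <= E /\ `|kappa (1 - xi) - Nv xi| <= E &
        v 1 t = itg 0 1 (fun xi => Nu xi * (u xi t - e xi t) + Nv xi * (v xi t - ep xi t))].

Local Notation y := (trace lambda r u v).
Local Notation Q := (traceQ lambda r u v).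
Local Notation D := (defect mu c u ch).
Local Notation epN := (epN ep).
Local Notation eN := (eN e).
Local Notation mepN := (mepN m ep).
Local Notation lyap := (lyap0 gamma gamma1 c ep ch).

Let mn0 : mu != 0. Proof. by rewrite gt_eqF. Qed.
Let h0 : 0 < h. Proof. by rewrite invr_gt0. Qed.
Let d0 : 0 < d. Proof. by rewrite invr_gt0. Qed.
Let ly : lbm1 y. Proof. exact: lbm_trace. Qed.
Let lm : lbm1 m. Proof. exact: lbm_energy. Qed.
Let leN : lbm1 eN. Proof. exact: lbm_eN. Qed.
Let lepN : lbm1 epN. Proof. exact: lbm_epN. Qed.
Let lmepN : lbm1 mepN. Proof. exact: lbm_mepN. Qed.
Let m0 t : 0 <= m t.
Proof. by apply: itg_ge0 => x _; rewrite addr_ge0 ?sqr_ge0. Qed.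
Let lch1 t : lbm1 (ch ^~ t). Proof. lbm. Qed.
Let kbd0 : 0 <= kbd. Proof. exact: kernel_bound_ge0. Qed.
Let cK0 : 0 < cK. Proof. by rewrite ltr_wpDl. Qed.
Let Q0 a b : 0 <= Q a b. Proof. exact: traceQ_ge0. Qed.
Let Qsub a b a' b' : a' <= a -> b <= b' -> Q a b <= Q a' b'.
Proof. exact: traceQ_sub. Qed.
Let Qsplit b a z : a <= b <= z -> Q a z = Q a b + Q b z.
Proof. exact: traceQ_split. Qed.
Let obs_rate0 : 0 < obs_rate mu r cbar. Proof. exact: obs_rate_gt0. Qed.
Let ctr0 : 0 < ctr.
Proof.
rewrite /ctr_const -/(obs_rate mu r cbar) addr_gt0// addr_gt0// mulr_gt0//.
by rewrite exprn_gt0.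
Qed.
Let trE t s : 0 <= t -> 0 <= s <= h -> 0 < t + s -> y (t + s) = v (mu * s) t +
    itg 0 s (fun z => c (mu * (s - z)) * u (mu * (s - z)) (t + z)).
Proof. exact: (@trace_v_char _ lambda mu r mu0 c u v tv). Qed.
Let uE x t : 0 <= x <= 1 -> 0 <= t -> u x t = r * y (t - x * d).
Proof. exact: (@u_trace _ lambda r lambda0 r0 u v tu bu). Qed.
Let mQ t : 0 <= t -> m t <= ctr * Q (t - d) (t + h).
Proof. exact: (energy_traceQ lambda0 mu0 r0 cbar0 lc lu lv cb tu tv bu). Qed.
Let Qm t : 0 <= t -> Q (t - d) (t + h) <= obs_const lambda mu r cbar * m t.
Proof. exact: (traceQ_energy lambda0 mu0 r0 cbar0 lc lu lv cb tu tv bu). Qed.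

Let DE t s : 0 <= t -> 0 <= s <= h ->
  D t s = Jint lambda mu r (fun q => y (t + q)) c s - Jint lambda mu r (fun q => y (t + q)) (ch ^~ t) s.
Proof.
move=> t0 /andP[s0 sh]; rewrite /Jint -itgB; [|by lbm|by lbm].
apply: itg_ext => z /andP[z0 zs]; rewrite uE; last first.
- by rewrite addr_ge0.
- rewrite mulr_ge0 ?subr_ge0 ?(ltW mu0)//= -(ler_pM2l h0) mulrA mulVf// mul1r mulr1.
  by rewrite (le_trans _ sh)// gerBl.
by rewrite addrA mulrBl.
Qed.

Let lD d' (T : measurableType d') (n : T -> R) (p q : T -> R) :
  lbm n p -> lbm n q -> lbm n (fun z => D (p z) (q z)).
Proof. exact: lbm_defect. Qed.

(* The control cancels the predicted trace one period ahead, up to the errors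
   of identification, of approximation of the kernels, and of learning. *)
Lemma trace_ahead t : 0 < t ->
  y (t + h) ^+ 2 <= 3 * (4 * (E ^+ 2 * m t + cK ^+ 2 * (eN t + epN t)) +
    D t h ^+ 2 + kbd ^+ 2 * mu * itg 0 h (fun s => D t s ^+ 2)).
Proof.
move=> t0; have t0' := ltW t0.
have [kappa [Ku1 [Nu [Nv [[lka lKu lNu lNv] VK NE UE]]]]] := control_kernel t0.
have kab xi : 0 <= xi <= 1 -> `|kappa xi| <= kbd.
  by apply: (kappa_le lambda0 mu0 r0 cbar0 (lch1 t) lka _ VK) => x hx; exact: chb.
have Kub xi : 0 <= xi <= 1 -> `|Ku1 xi| <= kbd.
  by apply: (Ku1_le lambda0 mu0 r0 cbar0 (lch1 t) lka _ VK) => x hx; exact: chb.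
pose z q := y (t + q).
have lz : lbm1 z by rewrite /z; lbm.
have lDt : lbm1 (D t) by apply: lD; lbm.
have := kernel_identity lambda0 mu0 r0 (lch1 t) lka lKu VK lz.
set J := Jint lambda mu r z => KI.
have lJc : lbm1 (J c) by rewrite /J /Jint; lbm.
have lJk : lbm1 (J (ch ^~ t)) by rewrite /J /Jint; lbm.
have lku x : lbm1 (u ^~ x) by lbm.
have lv1 x : lbm1 (v ^~ x) by lbm.
have le1 x : lbm1 (e ^~ x) by lbm.
have lep1 x : lbm1 (ep ^~ x) by lbm.
pose P := itg 0 1 (fun xi => Ku1 xi * u xi t + kappa (1 - xi) * v xi t).
have hh : 0 <= h <= h by rewrite lexx ltW.
have xh xi : 0 <= xi <= 1 -> 0 <= xi * h <= h.
  by move=> /andP[x0 x1]; rewrite mulr_ge0 ?(ltW h0)//= ler_piMl// ltW.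
have yE : y (t + h) = v 1 t + J c h.
  rewrite trE//; last by rewrite addr_gt0.
  rewrite divff//; congr (_ + _); apply: itg_ext => q /andP[q0 qh].
  rewrite uE; last first.
  - by rewrite addr_ge0.
  - rewrite mulr_ge0 ?subr_ge0 ?(ltW mu0)//= -(ler_pM2l h0) mulrA mulVf// mul1r mulr1.
    by rewrite gerBl.
  by rewrite /z addrA.
(* [P] is the exact-kernel control fed with the true state. Substituting v = z - J c and u = r z
   (delayed), [kernel_identity] leaves minus the predicted contribution, and the defects weighted by
   kappa. *)
have PE : P = - J (ch ^~ t) h - itg 0 1 (fun xi => kappa (1 - xi) * D t (xi * h)).
  have -> : - J (ch ^~ t) h = itg 0 1 (fun xi => Ku1 xi * (r * z (- xi * d))) +
     itg 0 1 (fun xi => kappa (1 - xi) * z (xi * h)) -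
     itg 0 1 (fun xi => kappa (1 - xi) * J (ch ^~ t) (xi * h)) by rewrite -KI; ring.
  rewrite /P itgD; [|by lbm|by lbm]; rewrite -!addrA; congr (_ + _).
    apply: itg_ext => xi hxi; rewrite uE//; congr (_ * (_ * y _)); ring.
  rewrite -opprD -itgD; [|by lbm|by lbm]; rewrite -itgB; [|by lbm|by lbm].
  apply: itg_ext => xi hxi; rewrite (DE t0' (xh _ hxi)) -/z -/J.
  have := @trE t (xi * h) t0' (xh _ hxi).
  have -> : mu * (xi * h) = xi by field.
  have xh0 := xh _ hxi; have /andP[xh1 xh2] := xh0.
  have tp : 0 < t + xi * h by rewrite ltr_wpDr.
  move=> /(_ tp); rewrite -[y _]/(z (xi * h)).
  rewrite (_ : itg 0 (xi * h) _ = J c (xi * h)).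
    by move=> ->; ring.
  apply: itg_ext => q /andP[q0 qh].
  rewrite uE; last first.
  - by rewrite addr_ge0.
  - rewrite mulr_ge0 ?subr_ge0 ?(ltW mu0)//= -(ler_pM2l h0) mulrA mulVf// mul1r mulr1.
    by rewrite (le_trans _ xh2)// gerBl.
  by rewrite /z addrA.
have YE : y (t + h) = (v 1 t - P) + D t h - itg 0 1 (fun xi => kappa (1 - xi) * D t (xi * h)).
  by rewrite yE PE (DE t0' hh) -/z -/J; ring.
rewrite YE; apply: (le_trans (sqrD3_le _ _ _)); apply: ler_wpM2l; first exact: ler0n.
rewrite sqrrN; apply: lerD; first (apply: lerD; last exact: lexx).
  (* The applied control differs from [P] in two ways: the kernels are off by at most E, and they
     act on u^, v^ instead of u, v. The first error is charged to m, the second to eN + epN. *)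
  have UP : v 1 t - P = itg 0 1 (fun xi => (Nu xi - Ku1 xi) * u xi t + (Nv xi - kappa (1 - xi)) * v xi t
      - (Nu xi * e xi t + Nv xi * ep xi t)).
    rewrite UE /P -itgB; [|by lbm|by lbm].
    by apply: itg_ext => xi _; ring.
  rewrite UP; apply: (le_trans (itg_sqr_le _ _)); [by []|by lbm|].
  rewrite subr0 mul1r.
  have -> : 4 * (E ^+ 2 * m t + cK ^+ 2 * (eN t + epN t)) = itg 0 1 (fun xi =>
      4 * (E ^+ 2 * (u xi t ^+ 2 + v xi t ^+ 2) + cK ^+ 2 * (e xi t ^+ 2 + ep xi t ^+ 2))).
    rewrite itgZ; last by lbm.
    rewrite itgD; [|by lbm|by lbm]; rewrite itgZ; last by lbm.
    rewrite itgZ; last by lbm.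
    by rewrite [in RHS](itgD _ _ (f := fun xi => e xi t ^+ 2)); [|by lbm|by lbm].
  rewrite (@itg_ext_oo _ 0 1 _ (fun xi => if (0 < xi < 1)%R then
     ((Nu xi - Ku1 xi) * u xi t + (Nv xi - kappa (1 - xi)) * v xi t
      - (Nu xi * e xi t + Nv xi * ep xi t)) ^+ 2 else 0)); last 3 first.
  - by lbm.
  - by lbm.
  - by move=> xi ->.
  apply: itg_le; [by lbm|by lbm|] => xi /andP[x0 x1]; case: ifPn => [hx|_]; last first.
    by rewrite mulr_ge0// addr_ge0// mulr_ge0 ?sqr_ge0// addr_ge0 ?sqr_ge0.
  have [n1 n2] := NE _ hx.
  have hxi : 0 <= xi <= 1 by rewrite x0.
  have hxi' : 0 <= 1 - xi <= 1 by rewrite subr_ge0 x1 lerBlDr lerDl.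
  have sq (a b : R) : 0 <= b -> `|a| <= b -> a ^+ 2 <= b ^+ 2.
    by move=> b0 ab; rewrite -real_normK ?num_real// lerXn2r ?nnegrE.
  have q1 : (Nu xi - Ku1 xi) ^+ 2 <= E ^+ 2 by rewrite sq ?(ltW E0)// distrC.
  have q2 : (Nv xi - kappa (1 - xi)) ^+ 2 <= E ^+ 2 by rewrite sq ?(ltW E0)// distrC.
  have q3 : Nu xi ^+ 2 <= cK ^+ 2.
    rewrite sq ?(ltW cK0)// -(subrK (Ku1 xi) (Nu xi)) addrC (le_trans (ler_normD _ _))//.
    by rewrite lerD ?Kub// distrC (le_trans n1).
  have q4 : Nv xi ^+ 2 <= cK ^+ 2.
    rewrite sq ?(ltW cK0)// -(subrK (kappa (1 - xi)) (Nv xi)) addrC (le_trans (ler_normD _ _))//.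
    by rewrite lerD ?kab// distrC (le_trans n2).
  set a1 := Nu xi - Ku1 xi in q1 *; set a2 := Nv xi - _ in q2 *.
  rewrite opprD; apply: (le_trans (sqrD4_le _ _ _ _)).
  rewrite ler_pM2l// !sqrrN !exprMn (mulrDr (E ^+ 2)) (mulrDr (cK ^+ 2)).
  by rewrite !lerD// ler_wpM2r ?sqr_ge0.
apply: (le_trans (itg_sqr_le _ _)); [by []|by lbm|].
rewrite subr0 mul1r -mulrA.
have -> : mu * itg 0 h (fun s => D t s ^+ 2) = itg 0 1 (fun xi => D t (xi * h) ^+ 2).
  transitivity (itg 0 1 (fun xi => (fun s => D t s ^+ 2) (h * xi + 0))); last first.
    by apply: itg_ext => xi _; rewrite addr0 mulrC.
  rewrite (@itg_affine _ h 0 0 1 (fun s => D t s ^+ 2))//; last by lbm.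
  by rewrite invrK mulr1 mulr0 !addr0.
rewrite -itgZ; last by lbm.
apply: itg_le; [by lbm|by lbm|] => xi /andP[x0 x1].
rewrite exprMn ler_wpM2r ?sqr_ge0// -real_normK ?num_real// lerXn2r ?nnegrE//.
by apply: kab; rewrite subr_ge0 x1 lerBlDr lerDl.
Qed.

Definition pert0 : R := eN 0 + (lambda * r ^+ 2 * h + 1) * lyap.

Let eN_ge0 t : 0 <= eN t. Proof. exact: eN_ge0. Qed.
Let epN_ge0 t : 0 <= epN t. Proof. exact: epN_ge0. Qed.
Let mepN_ge0 t : 0 <= mepN t. Proof. exact: mepN_ge0. Qed.

Let epN_b T : 0 <= T -> epN T <= lyap.
Proof. exact: (epN_le mu0 cbar0 rho0 gamma0 gamma10 lc lm lu lep lch m0 cb chb tep bep upd). Qed.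
Let ep0_b T : 0 <= T -> itg 0 T (fun t => ep 0 t ^+ 2) <= h * lyap.
Proof.
move=> T0; rewrite -(ler_pM2l mu0) mulrA divff// mul1r.
exact: (ep0_le mu0 cbar0 rho0 gamma0 gamma10 lc lm lu lep lch m0 cb chb tep bep upd).
Qed.
Let epNi_b T : 0 <= T -> itg 0 T epN <= (mu * gamma)^-1 * lyap.
Proof.
move=> T0; rewrite -(ler_pM2l (mulr_gt0 mu0 gamma0)) mulrA divff ?gt_eqF ?mulr_gt0// mul1r.
exact: (epN_itg_le mu0 cbar0 rho0 gamma0 gamma10 lc lm lu lep lch m0 cb chb tep bep upd).
Qed.
Let mepNi_b T : 0 <= T -> itg 0 T mepN <= (2 * rho)^-1 * lyap.
Proof.
move=> T0; have r2 : 0 < 2 * rho by rewrite mulr_gt0.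
rewrite -(ler_pM2l r2) mulrA divff ?gt_eqF// mul1r.
exact: (mepN_itg_le mu0 cbar0 rho0 gamma0 gamma10 lc lm lu lep lch m0 cb chb tep bep upd).
Qed.
Let eNi_b T : 0 <= T -> itg 0 T eN <= d * eN 0 + r ^+ 2 * (h * lyap).
Proof.
move=> T0; apply: (le_trans (eN_itg_le lambda0 rho0 lm le lep m0 te be T0)).
by rewrite lerD2l ler_wpM2l ?sqr_ge0// ep0_b.
Qed.

Lemma pert_le t : 0 <= t -> eN t + epN t <= pert0.
Proof.
move=> t0; rewrite /pert0 mulrDl mul1r addrA lerD// ?epN_b//.
apply: (le_trans (eN_le lambda0 rho0 lm le lep m0 te be t0)).
by rewrite lerD2l -[leRHS]mulrA ler_wpM2l ?ep0_b// mulr_ge0 ?sqr_ge0// ltW.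
Qed.

Lemma pert0_ge0 : 0 <= pert0.
Proof. by apply: (le_trans _ (pert_le (lexx 0))); rewrite addr_ge0. Qed.

Lemma control_sqr t : 0 < t -> v 1 t ^+ 2 <= 4 * cK ^+ 2 * (m t + (eN t + epN t)).
Proof.
move=> t0; have t0' := ltW t0.
have [kappa [Ku1 [Nu [Nv [[lka lKu lNu lNv] VK NE UE]]]]] := control_kernel t0.
have kab xi : 0 <= xi <= 1 -> `|kappa xi| <= kbd.
  by apply: (kappa_le lambda0 mu0 r0 cbar0 (lch1 t) lka _ VK) => x hx; exact: chb.
have Kub xi : 0 <= xi <= 1 -> `|Ku1 xi| <= kbd.
  by apply: (Ku1_le lambda0 mu0 r0 cbar0 (lch1 t) lka _ VK) => x hx; exact: chb.
rewrite UE; apply: (le_trans (itg_sqr_le _ _)); [by []|by lbm|].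
rewrite subr0 mul1r.
have -> : 4 * cK ^+ 2 * (m t + (eN t + epN t)) = itg 0 1 (fun xi =>
    4 * cK ^+ 2 * ((u xi t ^+ 2 + v xi t ^+ 2) + (e xi t ^+ 2 + ep xi t ^+ 2))).
  rewrite itgZ; last by lbm.
  rewrite itgD; [|by lbm|by lbm].
  by rewrite [in RHS](itgD _ _ (f := fun xi => e xi t ^+ 2)); [|by lbm|by lbm].
rewrite (@itg_ext_oo _ 0 1 _ (fun xi => if (0 < xi < 1)%R then
   (Nu xi * (u xi t - e xi t) + Nv xi * (v xi t - ep xi t)) ^+ 2 else 0)); last 3 first.
- by lbm.
- by lbm.
- by move=> xi ->.
apply: itg_le; [by lbm|by lbm|] => xi /andP[x0 x1]; case: ifPn => [hx|_]; last first.
  by rewrite mulr_ge0 ?mulr_ge0 ?sqr_ge0// addr_ge0// addr_ge0 ?sqr_ge0.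
have [n1 n2] := NE _ hx.
have hxi : 0 <= xi <= 1 by rewrite x0.
have hxi' : 0 <= 1 - xi <= 1 by rewrite subr_ge0 x1 lerBlDr lerDl.
have sq (a b : R) : 0 <= b -> `|a| <= b -> a ^+ 2 <= b ^+ 2.
  by move=> b0 ab; rewrite -real_normK ?num_real// lerXn2r ?nnegrE.
have q3 : Nu xi ^+ 2 <= cK ^+ 2.
  rewrite sq ?(ltW cK0)// -(subrK (Ku1 xi) (Nu xi)) addrC (le_trans (ler_normD _ _))//.
  by rewrite lerD ?Kub// distrC (le_trans n1).
have q4 : Nv xi ^+ 2 <= cK ^+ 2.
  rewrite sq ?(ltW cK0)// -(subrK (kappa (1 - xi)) (Nv xi)) addrC (le_trans (ler_normD _ _))//.
  by rewrite lerD ?kab// distrC (le_trans n2).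
set a1 := Nu xi in q3 *; set a2 := Nv xi in q4 *.
set U := u _ _; set V := v _ _; set A := e _ _; set B := ep _ _.
apply: (@le_trans _ _ (4 * (a1 ^+ 2 * U ^+ 2 + a2 ^+ 2 * V ^+ 2 + (a1 ^+ 2 * A ^+ 2 + a2 ^+ 2 * B ^+ 2)))).
  rewrite -!exprMn (mulrBr a1) (mulrBr a2).
  rewrite (_ : _ + _ = a1 * U + a2 * V + (- (a1 * A) + - (a2 * B))); last by ring.
  by apply: (le_trans (sqrD4_le _ _ _ _)); rewrite !sqrrN.
rewrite -mulrA ler_pM2l// !(mulrDr (cK ^+ 2)).
by rewrite !lerD// ler_wpM2r ?sqr_ge0.
Qed.

Let growth_rate0 : 0 < growth_rate.
Proof. by rewrite addr_gt0// mulr_gt0 ?addr_gt0// mulr_gt0// exprn_gt0. Qed.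

(** A coarse bound without any cancellation: the control is estimated by its size. It serves only to
    compare neighbouring windows. *)
Lemma trace_growth t : 0 < t ->
  y (t + h) ^+ 2 <= growth_rate * (Q (t - d) (t + h) + pert0).
Proof.
move=> t0; have t0' := ltW t0.
have hh : 0 <= h <= h by rewrite lexx ltW.
rewrite trE//; last by rewrite addr_gt0.
rewrite divff//; set A := v 1 t; set B := itg _ _ _.
have hB : B ^+ 2 <= h * cbar ^+ 2 * r ^+ 2 * Q (t - d) (t + h).
  exact: (char_cu_sqr lambda0 mu0 r0 cbar0 lu lv tu bu).
have hA := control_sqr t0.
have hAB : (A + B) ^+ 2 <= 2 * A ^+ 2 + 2 * B ^+ 2 by have := sqr_ge0 (A - B); nra.
apply: (le_trans hAB).
have P := pert_le t0'; have M := mQ t0'.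
have P0 := pert0_ge0; have q0 := Q0 (t - d) (t + h).
have c8 : 0 <= 4 * cK ^+ 2 by rewrite mulr_ge0 ?sqr_ge0.
have hA' : A ^+ 2 <= 4 * cK ^+ 2 * (ctr * Q (t - d) (t + h) + pert0).
  by apply: (le_trans hA); rewrite ler_wpM2l// lerD.
rewrite /growth_rate.
set q := Q _ _ in hA' hB q0 *; set p := pert0 in hA' P0 *.
set k := 4 * cK ^+ 2 in c8 hA'.
have -> : 8 * cK ^+ 2 = 2 * k by rewrite /k; ring.
have o0 := ltW obs_rate0.
have z1 : 0 <= obs_rate mu r cbar * p by rewrite mulr_ge0.
have z2 : 0 <= k * (ctr * p) by rewrite !mulr_ge0// ltW.
have z3 : 0 <= k * q by rewrite mulr_ge0.
move: hB z1; rewrite /obs_rate => hB z1.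
rewrite -subr_ge0.
rewrite (_ : _ - _ = 2 * (k * (ctr * q + p) - A ^+ 2) +
  2 * (h * cbar ^+ 2 * r ^+ 2 * q - B ^+ 2) + 2 * (h * cbar ^+ 2 * r ^+ 2) * p +
  2 * (k * (ctr * p)) + 2 * (k * q)); last by ring.
apply: addr_ge0; last by apply: mulr_ge0.
apply: addr_ge0; last by apply: mulr_ge0.
apply: addr_ge0 => //.
by apply: addr_ge0; apply: mulr_ge0; rewrite // subr_ge0.
Qed.

(** The defect of a block involves ||varpi||^2 up to a + 2 * h, hence the trace up to a + 3 * h,
    whereas the recursion knows it up to a + h. Gronwall over the missing length 2 * h closes the
    gap at the cost of a fixed factor. *)
Lemma traceQ_growth a : 0 <= a ->
  Q (- d) (a + 3 * h) <= growth * (Q (- d) (a + h) + pert0).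
Proof.
move=> a0; have P0 := pert0_ge0.
have nd : - d <= a + h by have := ltW d0; have := ltW h0; lra.
rewrite (@Qsplit (a + h)); last by rewrite nd /=; move: (h0); lra.
set S := Q (- d) (a + h); have S0 : 0 <= S by exact: Q0.
pose psi s := if 0 < s then y (a + h + s) ^+ 2 else 0.
have lpsi : lbm1 psi by rewrite /psi; lbm.
have Qpsi s : itg 0 s psi = Q (a + h) (a + h + s).
  transitivity (itg 0 s (fun q => (fun z => y z ^+ 2) (q + (a + h)))).
    apply: itg_ext_oo; [by lbm|by lbm|] => q /andP[q0 _].
    by rewrite /psi q0 addrC.
  rewrite (@itg_shift _ _ _ _ (fun z => y z ^+ 2)); last by lbm.
  by rewrite add0r (addrC s).
have lb : lbm1 (fun _ : R => growth_rate * (S + pert0)) by lbm.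
have G : itg 0 (2 * h) psi <= 2 * expR (2 * growth_rate * (2 * h)) * itg 0 (2 * h) (fun=> growth_rate * (S + pert0)).
  apply: gronwall => //.
  - by rewrite mulr_ge0// ltW.
  - by move=> t _; rewrite /psi; case: ifP => _; rewrite ?sqr_ge0.
  - by move=> t _; apply: mulr_ge0; [exact: ltW|exact: addr_ge0].
  move=> s /andP[s0 sh]; have Ip : 0 <= itg 0 s psi by rewrite Qpsi; exact: Q0.
  rewrite [psi s]/psi; case: ifPn => [sp|_]; last first.
    apply: addr_ge0; apply: mulr_ge0; [exact: ltW|exact: addr_ge0|exact: ltW|exact: Ip].
  have as0 : 0 < a + s by rewrite ltr_wpDl.
  have := trace_growth as0; rewrite (_ : a + s + h = a + h + s); last by ring.
  move=> /le_trans; apply; rewrite -mulrDr ler_pM2l// Qpsi (addrAC S) lerD2r.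
  rewrite /S -Qsplit; last by rewrite nd lerDl.
  by apply: Qsub => //; rewrite lerBrDr; lra.
have -> : a + 3 * h = a + h + 2 * h by ring.
rewrite -Qpsi.
have : itg 0 (2 * h) psi <= 2 * expR (2 * growth_rate * (2 * h)) * (2 * h * growth_rate) * (S + pert0).
  apply: (le_trans G); rewrite itg_cst; last by rewrite mulr_ge0// ltW.
  by rewrite subr0 le_eqVlt; apply/orP; left; apply/eqP; ring.
rewrite /growth mulrDl mul1r; lra.
Qed.

Definition disturbance t : R := eN t + epN t + ep 0 t ^+ 2.
Let ldisturbance : lbm1 disturbance. Proof. by have := leN; have := lepN; rewrite /disturbance => *; lbm. Qed.
Let disturbance_ge0 t : 0 <= disturbance t.
Proof. by rewrite /disturbance addr_ge0 ?sqr_ge0// addr_ge0. Qed.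

Let growth1 : 1 <= growth.
Proof. by rewrite lerDl !mulr_ge0 ?expR_ge0// ltW. Qed.
Let obsp : 0 < obs_const lambda mu r cbar.
Proof.
have k0 : 0 < (r ^+ 2 * lambda)^-1 by rewrite invr_gt0 mulr_gt0// exprn_gt0.
rewrite /obs_const ltr_pwDl// mulr_ge0 ?mulr_ge0 ?expR_ge0// addr_ge0//.
  by rewrite mulr_ge0// ltW.
by rewrite mulr_ge0 ?(ltW k0)// mulr_ge0// ltW.
Qed.
Let obs0 := ltW obsp.
Let colK0 : 0 <= colK. Proof. by rewrite mulr_ge0 ?sqr_ge0. Qed.
Let chs0 : 0 <= ch_step gamma gamma1 colK.
Proof. by rewrite /ch_step mulr_ge0 ?sqr_ge0. Qed.
Let kap : 0 <= 1 + kbd ^+ 2 * mu.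
Proof. by rewrite addr_ge0// mulr_ge0 ?sqr_ge0// ltW. Qed.
Let pert_gain0 : 0 <= pert_gain.
Proof.
apply: addr_ge0; first by rewrite mulr_ge0 ?sqr_ge0.
by apply: mulr_ge0; [rewrite mulr_ge0|rewrite addr_ge0// ltW].
Qed.
Let learn_gain0 : 0 <= learn_gain.
Proof.
apply: mulr_ge0; last exact: le_trans growth1.
apply: mulr_ge0; first by apply: mulr_ge0; [rewrite mulr_ge0|rewrite addr_ge0// ltW].
apply: addr_ge0; apply: mulr_ge0; rewrite ?sqr_ge0 ?(ltW ctr0)//.
  by rewrite mulr_ge0 ?sqr_ge0.
by rewrite mulr_ge0 ?sqr_ge0// mulr_ge0.
Qed.
Let piecesP : lambda <= mu * pieces%:R.
Proof.
have q0 : 0 <= lambda / mu by rewrite divr_ge0// ltW.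
have := archi_boundP q0; rewrite ltr_pdivrMr// => /ltW /le_trans; apply.
by rewrite mulrC ler_pM2l// /pieces ler_nat.
Qed.

(** The integral of [trace_ahead] over one period. The factor 12 is 3 * 4, from splitting the trace
    into three errors and the control error into four terms. The bounds M and U of the defect are
    multiples of the trace up to a + 3 * h, which makes the learning term quadratic in the
    unknowns. *)
Lemma trace_block a : 0 <= a ->
  Q (a + h) (a + 2 * h) <= 12 * E ^+ 2 * itg a (a + h) m +
    pert_gain * itg a (a + 2 * h) disturbance +
    learn_gain * (Q (- d) (a + h) + pert0) * itg a (a + 2 * h) mepN.
Proof.
move=> a0; have P0 := pert0_ge0.
set G := Q (- d) (a + 3 * h).
have G0 : 0 <= G by exact: Q0.
have ah : a <= a + h by rewrite lerDl ltW.
have colp : 0 < colK by rewrite mulr_gt0// exprn_gt0.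
have DB := defect_block_le lambda0 mu0 rho0 gamma0 gamma10 lc lm lu lep lch m0 tep bep upd colp
  (u_column_energy lambda0 mu0 r0 cbar0 lc lu lv cb tu tv bu)
  (isT : (0 < pieces)%N) piecesP a0 (mulr_ge0 (ltW ctr0) G0) (mulr_ge0 (sqr_ge0 r) G0).
have wide q : a <= q -> q + h <= a + 3 * h -> Q (q - d) (q + h) <= G.
  move=> aq qa; apply: Qsub; last exact: qa.
  by rewrite -[leLHS]add0r lerD2r (le_trans a0 aq).
have hM q : a <= q <= a + 2 * h -> m q <= ctr * G.
  move=> /andP[aq qa]; apply: (le_trans (mQ (le_trans a0 aq))).
  apply: ler_wpM2l; first exact: ltW.
  by apply: wide; [exact: aq|rewrite (_ : a + 3 * h = a + 2 * h + h) ?lerD2r//; ring].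
have hU t s : a <= t <= a + h -> 0 <= s <= h ->
     itg 0 s (fun z => u (mu * (s - z)) (t + z) ^+ 2) <= r ^+ 2 * G.
  move=> /andP[at1 ta] /[dup] hs /andP[s0 sh]; have t0 := le_trans a0 at1.
  apply: (le_trans (char_u_sqr lambda0 mu0 r0 lu lv tu bu t0 hs)).
  apply: ler_wpM2l; first exact: sqr_ge0.
  apply: (@le_trans _ _ (Q (t - d) (t + h))).
    by apply: Qsub; [exact: lexx|rewrite lerD2l].
  apply: wide; first exact: at1.
  rewrite (_ : a + 3 * h = a + h + h + h); last by ring.
  by apply: (@le_trans _ _ (a + h + h)); rewrite ?lerD2r// lerDl ltW.
have {}DB := DB hM hU.
have I1 : itg a (a + 2 * h) (fun t => ep 0 t ^+ 2) + itg a (a + 2 * h) epN <= itg a (a + 2 * h) disturbance.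
  rewrite -itgD; [|by lbm|by lbm]; apply: itg_le; [by have := lepN => *; lbm|by []|] => t _.
  by rewrite /disturbance addrC lerD2r lerDr.
have I2 : itg a (a + h) (fun t => eN t + epN t) <= itg a (a + 2 * h) disturbance.
  apply: (@le_trans _ _ (itg a (a + h) disturbance)).
    apply: itg_le; [by have := leN; have := lepN => *; lbm|exact: ldisturbance|].
    by move=> t _; rewrite /disturbance lerDl sqr_ge0.
  apply: itg_sub; [exact: lexx| |exact: ldisturbance|by move=> t _].
  by rewrite lerD2l ler_peMl ?(ltW h0)// ler1n.
set Bd := itg a (a + 2 * h) disturbance in I1 I2 *.
set A := itg a (a + 2 * h) mepN in DB *.
have A0 : 0 <= A by apply: itg_ge0 => q _; exact: mepN_ge0.
have lD2 : lbm2 D by apply: lD; lbm.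
have step : Q (a + h) (a + 2 * h) <= itg a (a + h) (fun t =>
    12 * E ^+ 2 * m t + 12 * cK ^+ 2 * (eN t + epN t) +
    3 * (1 + kbd ^+ 2 * mu) * (D t h ^+ 2 + itg 0 h (fun s => D t s ^+ 2))).
  have -> : Q (a + h) (a + 2 * h) = itg a (a + h) (fun t => y (t + h) ^+ 2).
    rewrite (@itg_shift _ a (a + h) h (fun t => y t ^+ 2)); last by lbm.
    by congr (Q _ _); ring.
  have lrhs : lbm1 (fun t => 12 * E ^+ 2 * m t + 12 * cK ^+ 2 * (eN t + epN t) +
    3 * (1 + kbd ^+ 2 * mu) * (D t h ^+ 2 + itg 0 h (fun s => D t s ^+ 2))).
    by have := lm; have := leN; have := lepN => *; lbm.
  rewrite (@itg_ext_oo _ a (a + h) _ (fun t => if 0 < t then y (t + h) ^+ 2 else 0)); last 3 first.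
  - by lbm.
  - by lbm.
  - by move=> t /andP[at1 _]; rewrite (le_lt_trans a0 at1).
  apply: itg_le; [by lbm|exact: lrhs|].
  move=> t /andP[at1 _]; have t0' := le_trans a0 at1; case: ifPn => [t0|_].
    apply: (le_trans (trace_ahead t0)).
    set X := D t h ^+ 2; set Z := itg 0 h _.
    have X0 : 0 <= X by exact: sqr_ge0.
    have Z0 : 0 <= Z by apply: itg_ge0 => s _; exact: sqr_ge0.
    have z1 : 0 <= kbd ^+ 2 * mu * X by rewrite mulr_ge0// mulr_ge0 ?sqr_ge0// ltW.
    rewrite -subr_ge0 (_ : _ - _ = 3 * (kbd ^+ 2 * mu * X) + 3 * Z); last by ring.
    by rewrite addr_ge0// mulr_ge0.
  apply: addr_ge0; first apply: addr_ge0.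
  - by rewrite mulr_ge0// mulr_ge0 ?sqr_ge0.
  - by apply: mulr_ge0; [rewrite mulr_ge0 ?sqr_ge0|rewrite addr_ge0].
  apply: mulr_ge0; first by rewrite mulr_ge0.
  by apply: addr_ge0; [exact: sqr_ge0|apply: itg_ge0 => s _; exact: sqr_ge0].
apply: (le_trans step).
have lm' := lm; have leN' := leN; have lepN' := lepN.
rewrite itgD; [|by lbm|by lbm]; rewrite itgD; [|by lbm|by lbm].
rewrite itgZ//; rewrite itgZ; last by lbm.
rewrite itgZ; last by lbm.
rewrite [in X in _ + X](itgD _ _ (f := fun t => D t h ^+ 2)); [|by lbm|by lbm].
move: DB; set DD := _ + itg a (a + h) (fun t => itg 0 h _) => DB.
have gr : G <= growth * (Q (- d) (a + h) + pert0) by exact: traceQ_growth.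
set X := Q (- d) (a + h) + pert0 in gr *.
set kk := rho ^+ 2 * h ^+ 2 * ctr + pieces%:R * ch_step gamma gamma1 colK * h ^+ 2 * r ^+ 2.
have kk0 : 0 <= kk.
  apply: addr_ge0; apply: mulr_ge0; rewrite ?sqr_ge0 ?(ltW ctr0)//.
    by rewrite mulr_ge0 ?sqr_ge0.
  by rewrite mulr_ge0 ?sqr_ge0// mulr_ge0.
have DB' : DD <= 4 * (1 + h) * (Bd + kk * (growth * X) * A).
  apply: (le_trans DB); rewrite ler_pM2l; last by rewrite mulr_gt0// addr_gt0.
  apply: lerD => //.
  rewrite (_ : _ + _ = kk * G); last by rewrite /kk; ring.
  by rewrite ler_wpM2r// ler_wpM2l.
rewrite -addrA -[leRHS]addrA lerD2l.
apply: (@le_trans _ _ (12 * cK ^+ 2 * Bd + 3 * (1 + kbd ^+ 2 * mu) * (4 * (1 + h) * (Bd + kk * (growth * X) * A)))).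
  apply: lerD; first by rewrite ler_wpM2l// mulr_ge0 ?sqr_ge0.
  by rewrite ler_wpM2l// mulr_ge0.
by rewrite le_eqVlt; apply/orP; left; apply/eqP; rewrite /pert_gain /learn_gain -/kk; ring.
Qed.

(** By Fubini: each value of y^2 is counted in windows of total length d + h. *)
Lemma energy_itg T : 0 <= T ->
  itg 0 T m <= ctr * (d + h) * Q (- d) (T + h).
Proof.
move=> T0; have ly' := ly.
apply: (@le_trans _ _ (itg 0 T (fun t => ctr * itg (- d) h (fun q => y (q + t) ^+ 2)))).
  apply: itg_le; [exact: lm|by lbm|] => t /andP[t0 _].
  rewrite (@itg_shift _ _ _ t (fun q => y q ^+ 2)); last by lbm.
  by apply: (le_trans (mQ t0)); rewrite (addrC (- d)) (addrC h).
rewrite itgZ; last by lbm.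
rewrite -[leRHS]mulrA; apply: ler_wpM2l; first exact: ltW.
rewrite itg_fubini; last by lbm.
have -> : (d + h) * Q (- d) (T + h) = itg (- d) h (fun=> Q (- d) (T + h)).
  rewrite itg_cst; last by rewrite (@le_trans _ _ 0) ?oppr_le0 ?(ltW h0)// ltW.
  by rewrite opprK mulrC (addrC h).
apply: itg_le; [by lbm|by lbm|] => q /andP[q1 q2].
rewrite (_ : itg 0 T _ = itg 0 T (fun t => (fun z => y z ^+ 2) (t + q))); last first.
  by apply: itg_ext => t _; rewrite addrC.
rewrite (@itg_shift _ _ _ q (fun z => y z ^+ 2)); last by lbm.
by apply: Qsub; [rewrite add0r|rewrite lerD2l].
Qed.

Definition disturbance_total : R := d * eN 0 + (r ^+ 2 * h + (mu * gamma)^-1 + h) * lyap.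

Lemma disturbance_itg_le T : 0 <= T -> itg 0 T disturbance <= disturbance_total.
Proof.
move=> T0; have leN' := leN; have lepN' := lepN.
rewrite /disturbance itgD; [|by lbm|by lbm]; rewrite itgD; [|by []|by []].
have := eNi_b T0; have := epNi_b T0; have := ep0_b T0.
rewrite /disturbance_total (_ : _ + _ * lyap =
  (d * eN 0 + r ^+ 2 * (h * lyap)) + (mu * gamma)^-1 * lyap + h * lyap); last by ring.
by move=> a1 a2 a3; apply: lerD => //; apply: lerD.
Qed.

Let sum_itg (f : R -> R) n : lbm1 f ->
  \sum_(0 <= i < n) itg (i%:R * h) (i%:R * h + h) f = itg 0 (n%:R * h) f.
Proof.
move=> lf; elim: n => [|n IH]; first by rewrite big_geq// mul0r itg_nil.
rewrite big_nat_recr//= IH -itg_split//.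
  by congr itg; rewrite -natr1; ring.
by rewrite mulr_ge0 ?(ltW h0)//= lerDl ltW.
Qed.

(** Consecutive windows of length 2 * h overlap, each time being covered at most twice. *)
Let sum_itg2 (f : R -> R) n B : lbm1 f -> (forall t, 0 <= f t) ->
  (forall T, 0 <= T -> itg 0 T f <= B) ->
  \sum_(0 <= i < n) itg (i%:R * h) (i%:R * h + 2 * h) f <= 2 * B.
Proof.
move=> lf f0 hB.
have e1 : \sum_(0 <= i < n) itg (i%:R * h) (i%:R * h + 2 * h) f =
  \sum_(0 <= i < n) itg (i%:R * h) (i%:R * h + h) f +
  \sum_(0 <= i < n) itg (i%:R * h + h) (i%:R * h + h + h) f.
  rewrite -big_split; apply: eq_bigr => i _ /=.
  rewrite -itg_split//; first by congr itg; ring.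
  by rewrite !lerDl (ltW h0).
have e2 : \sum_(0 <= i < n) itg (i%:R * h + h) (i%:R * h + h + h) f =
    itg h (n.+1%:R * h) f.
  have := sum_itg n.+1 lf; rewrite big_nat_recl//= mul0r add0r.
  rewrite (@itg_split _ h 0 (n.+1%:R * h))//; last first.
    by rewrite (ltW h0)/= ler_peMl ?(ltW h0)// ler1n.
  move=> /addrI <-; apply: eq_bigr => i _.
  by rewrite (_ : i.+1%:R * h = i%:R * h + h)// -natr1; ring.
rewrite e1 e2 sum_itg// (_ : 2 * B = B + B); last by ring.
apply: lerD; first by apply: hB; rewrite mulr_ge0// ltW.
apply: (@le_trans _ _ (itg 0 (n.+1%:R * h) f)).
  apply: itg_sub; [exact: ltW|exact: lexx|exact: lf|by move=> t _].
by apply: hB; rewrite mulr_ge0// ltW.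
Qed.

(* The term of [trace_block] with the factor E ^+ 2, summed over all periods, is
   then absorbed by the left-hand side. *)
Hypothesis Esmall : 12 * E ^+ 2 * (ctr * (d + h)) <= 2^-1.

Definition trace_bound : R :=
  (2 * (Q (- d) h + pert_gain * (2 * disturbance_total)) + pert0) *
  expR (2 * learn_gain * (2 * ((2 * rho)^-1 * lyap))).

Lemma trace_total T : Q (- d) T <= trace_bound.
Proof.
pose S (n : nat) := Q (- d) (n%:R * h + h).
pose M (n : nat) := itg (n%:R * h) (n%:R * h + h) m.
pose b (n : nat) := itg (n%:R * h) (n%:R * h + 2 * h) disturbance.
pose a (n : nat) := itg (n%:R * h) (n%:R * h + 2 * h) mepN.
have nh (n : nat) : 0 <= n%:R * h by rewrite mulr_ge0// ltW.
have tot : forall n, S n + pert0 <=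
    (2 * (S 0%N + pert_gain * (2 * disturbance_total)) + pert0) *
    expR (2 * learn_gain * (2 * ((2 * rho)^-1 * lyap))).
  have k0 : 0 <= 12 * E ^+ 2 by rewrite mulr_ge0 ?sqr_ge0.
  apply: (@recursion_sum _ (12 * E ^+ 2) (ctr * (d + h)) _ _ _ _ _ S M b a k0 pert_gain0 learn_gain0 pert0_ge0).
  - by move=> n; exact: Q0.
  - by move=> n; apply: itg_ge0 => t _; exact: mepN_ge0.
  - move=> n; rewrite /S (_ : n.+1%:R * h + h = n%:R * h + 2 * h); last by rewrite -natr1; ring.
    rewrite (@Qsplit (n%:R * h + h) (- d)).
      by rewrite (addrC (Q _ _)) addrK; exact: trace_block.
    have n1 : 0 <= n%:R * h + h by rewrite addr_ge0// ltW.
    rewrite (le_trans _ n1) ?oppr_le0 ?(ltW d0)//= lerD2l ler_peMl ?(ltW h0)//.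
    by rewrite ler1n.
  - by move=> n; rewrite /M sum_itg//; exact: energy_itg.
  - exact: Esmall.
  - by move=> n; apply: sum_itg2; [exact: ldisturbance|exact: disturbance_ge0|exact: disturbance_itg_le].
  - by move=> n; apply: sum_itg2; [exact: lmepN|exact: mepN_ge0|exact: mepNi_b].
have [n Tn] : exists n : nat, T <= n%:R * h + h.
  exists (Num.bound (`|T| * mu)).
  have q0 : 0 <= `|T| * mu by rewrite mulr_ge0// ltW.
  have := archi_boundP q0; rewrite -ltr_pdivlMr// => /ltW Tb.
  apply: (le_trans (ler_norm T)); apply: (le_trans Tb).
  by rewrite lerDl ltW.
apply: (le_trans (Qsub (lexx _) Tn)).
apply: (@le_trans _ _ (S n + pert0)); first by rewrite lerDl pert0_ge0.
apply: (le_trans (tot n)); rewrite /S mul0r add0r; exact: lexx.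
Qed.

(** * Pointwise bounds by a recent window of the outlet trace *)

Let Q_wide a b a' b' k : 0 <= k -> a' <= a -> b <= b' -> k * Q a b <= k * Q a' b'.
Proof. by move=> k0 aa bb; apply: ler_wpM2l => //; exact: Qsub. Qed.

Definition ep_gain : R := 4 * cbar ^+ 2 * h * r ^+ 2.
Let ep_gain0 : 0 <= ep_gain.
Proof. by rewrite /ep_gain !mulr_ge0 ?exprn_ge0// ltW. Qed.

(** Followed back to x = 1, where it vanishes, ep is generated by c~ u alone during one travel time;
    the damping only helps, and |c~| <= 2 * cbar replaces any convergence of c^. The later bounds
    add travel times: e from ep at x = 0, the control from the state and the errors, v from the
    control, u from v at x = 0. *)
Lemma ep_window x t : 0 <= x <= 1 -> h < t ->
  ep x t ^+ 2 <= ep_gain * Q (t - h - d) (t + h).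
Proof.
move=> /andP[x0 x1] ht.
pose s := (1 - x) * h; pose t0 := t - s.
have s0 : 0 <= s by rewrite mulr_ge0 ?subr_ge0// ltW.
have sh : s <= h by rewrite ler_piMl ?(ltW h0)// gerBl.
have t00 : 0 < t0 by rewrite subr_gt0 (le_lt_trans sh).
have t0' := ltW t00.
have ms : 1 - mu * s = x by rewrite /s; field.
pose g z := (c (1 - mu * z) - ch (1 - mu * z) (t0 + z)) * u (1 - mu * z) (t0 + z).
pose k z := rho * m (t0 + z).
have lg : lbm1 g by rewrite /g; lbm.
have lk : lbm1 k by have lm' := lm; rewrite /k; lbm.
have lF : lbm1 (fun z => ep (1 - mu * z) (t0 + z)) by lbm.
have k0 z : 0 <= k z by rewrite mulr_ge0// ltW.
have B := @damped_bound _ (fun z => ep (1 - mu * z) (t0 + z)) g k s s0 lF lg lk k0.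
have {}B : `|ep x t| <= itg 0 s (fun q => `|g q|).
  rewrite -ms -{1}(subrK s t) -/t0.
  move: B; rewrite mulr0 subr0 addr0 bep// normr0 add0r; apply => z /andP[z0 zs].
  rewrite tep//; last first.
    by rewrite (@le_trans _ _ x)// -ms lerD2l lerN2 ler_pM2l.
  by rewrite bep//; congr (_ + _); apply: itg_ext => q _; rewrite /g /k; ring.
have B2 : itg 0 s (fun q => `|g q|) <= itg 0 h (fun z => 2 * cbar * `|u (mu * (h - z)) (t0 + z)|).
  apply: (@le_trans _ _ (itg 0 s (fun z => 2 * cbar * `|u (mu * (h - z)) (t0 + z)|))).
    apply: itg_le; [by lbm|by lbm|] => z /andP[z0 zs].
    have -> : mu * (h - z) = 1 - mu * z by field.
    have z01 : 0 <= 1 - mu * z <= 1.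
      rewrite gerBl mulr_ge0 ?(ltW mu0)// andbT (@le_trans _ _ x)// -ms lerD2l lerN2 ler_pM2l//.
    rewrite /g normrM ler_wpM2r// (le_trans (ler_normB _ _))//.
    rewrite (_ : 2 * cbar = cbar + cbar); last by ring.
    by apply: lerD; [exact: cb|apply: chb => //; rewrite addr_ge0].
  apply: itg_sub; [exact: lexx|exact: sh|by lbm|] => z _.
  by rewrite mulr_ge0// mulr_ge0// ltW.
have I0 : 0 <= itg 0 s (fun q => `|g q|) by apply: itg_ge0.
rewrite -real_normK ?num_real//.
apply: (@le_trans _ _ ((itg 0 h (fun z => 2 * cbar * `|u (mu * (h - z)) (t0 + z)|)) ^+ 2)).
  rewrite lerXn2r ?nnegrE//; first exact: (le_trans (normr_ge0 _) (le_trans B B2)).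
  exact: le_trans B2.
apply: (le_trans (itg_sqr_le (ltW h0) _)); first by lbm.
rewrite (_ : itg 0 h _ = 4 * cbar ^+ 2 * itg 0 h (fun z => u (mu * (h - z)) (t0 + z) ^+ 2)); last first.
  rewrite -itgZ; last by lbm.
  by apply: itg_ext => z _; rewrite exprMn real_normK ?num_real//; ring.
have hh : 0 <= h <= h by rewrite lexx ltW.
have := char_u_sqr lambda0 mu0 r0 lu lv tu bu t0' hh.
move=> /(ler_wpM2l (mulr_ge0 (ltW h0) (mulr_ge0 (ler0n _ 4) (sqr_ge0 cbar)))).
rewrite subr0 mulrA => /le_trans; apply.
rewrite (_ : _ * (r ^+ 2 * _) = ep_gain * Q (t0 - d) (t0 + h)); last by rewrite /ep_gain; ring.
apply: Q_wide => //.
  by rewrite lerD2r lerD2l lerN2.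
by rewrite lerD2r gerBl.
Qed.

Lemma e_window x t : 0 <= x <= 1 -> h + d < t ->
  e x t ^+ 2 <= r ^+ 2 * ep_gain * Q (t - h - 2 * d) (t + h).
Proof.
move=> /andP[x0 x1] ht.
have xd : 0 <= x * d <= d by rewrite mulr_ge0 ?(ltW d0)//= ler_piMl// ltW.
have /andP[xd0 xd1] := xd.
have t0 : 0 <= t by apply: ltW; apply: le_lt_trans ht; rewrite addr_ge0// ltW.
have hx : 0 <= x <= 1 by rewrite x0.
have tx : h < t - x * d.
  by rewrite ltrBrDr (le_lt_trans _ ht)// lerD2l.
apply: (le_trans (e_eta lambda0 rho0 lm le m0 te be hx t0)).
rewrite /eta (lt_trans h0 tx) -mulrA; apply: ler_wpM2l; first exact: sqr_ge0.
have z0 : 0 <= (0 : R) <= 1 by rewrite lexx ler01.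
apply: (le_trans (ep_window z0 tx)); apply: Q_wide => //.
  rewrite (_ : t - h - 2 * d = t - d - h - d); last by ring.
  by rewrite !lerD2r lerD2l lerN2.
by rewrite lerD2r gerBl.
Qed.

Definition v1_gain : R := 4 * cK ^+ 2 * (ctr + (1 + r ^+ 2) * ep_gain).
Let v1_gain0 : 0 <= v1_gain.
Proof.
apply: mulr_ge0; first by rewrite mulr_ge0 ?sqr_ge0.
by rewrite addr_ge0 ?(ltW ctr0)// mulr_ge0// addr_ge0 ?sqr_ge0.
Qed.

(** The control is bounded by the energy and both errors at time t, each of which depends on the
    trace near t only. *)
Lemma v1_window t : h + d < t ->
  v 1 t ^+ 2 <= v1_gain * Q (t - h - 2 * d) (t + h).
Proof.
move=> ht; have t0 : 0 < t by apply: le_lt_trans ht; rewrite addr_ge0// ltW.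
have ht' : h < t by apply: le_lt_trans ht; rewrite lerDl ltW.
apply: (le_trans (control_sqr t0)).
rewrite /v1_gain -[leRHS]mulrA; apply: ler_wpM2l; first by rewrite mulr_ge0 ?sqr_ge0.
have lo : t - h - 2 * d <= t - d.
  by rewrite (_ : t - h - 2 * d = t - d - (h + d)) ?gerBl ?addr_ge0 ?ltW//; ring.
have lo2 : t - h - 2 * d <= t - h - d.
  by rewrite (_ : t - h - 2 * d = t - h - d - d) ?gerBl ?ltW//; ring.
rewrite (mulrDl ctr); apply: lerD.
  apply: (le_trans (mQ (ltW t0))); apply: Q_wide; [exact: ltW|exact: lo|exact: lexx].
have a1 : eN t <= r ^+ 2 * ep_gain * Q (t - h - 2 * d) (t + h).
  rewrite -[leRHS]mulr1 -[X in _ <= _ * X](subr0 1) -itg_cst// /eN.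
  by apply: itg_le; [by lbm|by lbm|] => x hx; exact: e_window.
have a2 : epN t <= ep_gain * Q (t - h - 2 * d) (t + h).
  apply: (@le_trans _ _ (ep_gain * Q (t - h - d) (t + h))).
    rewrite -[leRHS]mulr1 -[X in _ <= _ * X](subr0 1) -itg_cst// /epN.
    by apply: itg_le; [by lbm|by lbm|] => x hx; exact: ep_window.
  by apply: Q_wide; [exact: ep_gain0|exact: lo2|exact: lexx].
rewrite (_ : (1 + r ^+ 2) * ep_gain * _ = r ^+ 2 * ep_gain * Q (t - h - 2 * d) (t + h) +
  ep_gain * Q (t - h - 2 * d) (t + h)); last by ring.
exact: lerD.
Qed.

Definition v_gain : R := 2 * v1_gain + 2 * (h * cbar ^+ 2 * r ^+ 2).
Let v_gain0 : 0 <= v_gain.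
Proof.
apply: addr_ge0; first by rewrite mulr_ge0.
by rewrite mulr_ge0// mulr_ge0 ?sqr_ge0// mulr_ge0 ?sqr_ge0// ltW.
Qed.

Lemma v_window x t : 0 <= x <= 1 -> 2 * h + d < t ->
  v x t ^+ 2 <= v_gain * Q (t - 2 * h - 2 * d) (t + h).
Proof.
move=> /andP[x0 x1] ht.
pose s := (1 - x) * h; pose t0 := t - s.
have s0 : 0 <= s by rewrite mulr_ge0 ?subr_ge0// ltW.
have sh : s <= h by rewrite ler_piMl ?(ltW h0)// gerBl.
have t0h : h + d < t0.
  rewrite ltrBrDr (le_lt_trans _ ht)// (_ : 2 * h + d = h + d + h) ?lerD2l//; ring.
have t0' : 0 <= t0 by apply: ltW; apply: le_lt_trans t0h; rewrite addr_ge0// ltW.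
have ms : 1 - mu * s = x by rewrite /s; field.
have := @tv 1 t0 s t0' s0 (lexx 1); rewrite ms subrK => /(_ x0) ->.
set B := itg 0 s _.
have hB : B ^+ 2 <= h * cbar ^+ 2 * r ^+ 2 * Q (t0 - d) (t0 + h).
  apply: (le_trans (itg_sqr_le s0 _)); first by lbm.
  rewrite subr0; have hh : 0 <= h <= h by rewrite lexx ltW.
  have C := char_u_sqr lambda0 mu0 r0 lu lv tu bu t0' hh.
  apply: (@le_trans _ _ (h * (cbar ^+ 2 * itg 0 h (fun z => u (mu * (h - z)) (t0 + z) ^+ 2)))).
    apply: ler_pM => //; first by apply: itg_ge0 => z _; exact: sqr_ge0.
    rewrite -itgZ; last by lbm.
    apply: (@le_trans _ _ (itg 0 s (fun z => cbar ^+ 2 * u (mu * (h - z)) (t0 + z) ^+ 2))).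
      apply: itg_le; [by lbm|by lbm|] => z /andP[z0 zs].
      have -> : mu * (h - z) = 1 - mu * z by field.
      have z01 : 0 <= 1 - mu * z <= 1.
        by rewrite gerBl mulr_ge0 ?(ltW mu0)// andbT (@le_trans _ _ x)// -ms lerD2l lerN2 ler_pM2l.
      rewrite exprMn; apply: ler_wpM2r; first exact: sqr_ge0.
      by rewrite -real_normK ?num_real// lerXn2r ?nnegrE ?(ltW cbar0)// cb.
    apply: itg_sub; [exact: lexx|exact: sh|by lbm|] => z _.
    by rewrite mulr_ge0 ?sqr_ge0.
  rewrite (_ : _ * Q _ _ = h * (cbar ^+ 2 * (r ^+ 2 * Q (t0 - d) (t0 + h)))); last by ring.
  by apply: ler_wpM2l; [exact: ltW|apply: ler_wpM2l; [exact: sqr_ge0|exact: C]].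
set A := v 1 t0.
have hA : A ^+ 2 <= v1_gain * Q (t0 - h - 2 * d) (t0 + h) by exact: v1_window.
have hAB : (A + B) ^+ 2 <= 2 * A ^+ 2 + 2 * B ^+ 2 by have := sqr_ge0 (A - B); nra.
apply: (le_trans hAB); rewrite /v_gain (mulrDl (2 * v1_gain)) -!(mulrA 2).
have up : t0 + h <= t + h by rewrite lerD2r gerBl.
have lo : t - 2 * h - 2 * d <= t0 - h - 2 * d.
  rewrite (_ : t - 2 * h = t - h - h); last by ring.
  by rewrite !lerD2r lerD2l lerN2.
have lo2 : t0 - h - 2 * d <= t0 - d.
  by rewrite (_ : t0 - h - 2 * d = t0 - d - (h + d)) ?gerBl ?addr_ge0 ?ltW//; ring.
apply: lerD; apply: ler_wpM2l => //.
  by apply: (le_trans hA); apply: Q_wide.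
apply: (le_trans hB); apply: Q_wide => //; last exact: le_trans lo2.
by rewrite mulr_ge0 ?sqr_ge0// mulr_ge0 ?sqr_ge0// ltW.
Qed.

Lemma u_window x t : 0 <= x <= 1 -> 2 * h + 2 * d < t ->
  u x t ^+ 2 <= r ^+ 2 * v_gain * Q (t - 2 * h - 3 * d) (t + h).
Proof.
move=> /andP[x0 x1] ht.
have xd : 0 <= x * d <= d by rewrite mulr_ge0 ?(ltW d0)//= ler_piMl// ltW.
have /andP[xd0 xd1] := xd.
have t0 : 0 <= t by apply: ltW; apply: le_lt_trans ht; rewrite addr_ge0// mulr_ge0// ltW.
have tx : 2 * h + d < t - x * d.
  rewrite ltrBrDr (le_lt_trans _ ht)// (_ : 2 * h + 2 * d = 2 * h + d + d) ?lerD2l//; ring.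
rewrite uE ?x0// exprMn -mulrA; apply: ler_wpM2l; first exact: sqr_ge0.
have txp : 0 < t - x * d.
  by apply: le_lt_trans tx; rewrite addr_ge0 ?mulr_ge0// ltW.
rewrite /trace txp; have z0 : 0 <= (0 : R) <= 1 by rewrite lexx ler01.
apply: (le_trans (v_window z0 tx)); apply: Q_wide => //.
  rewrite (_ : t - 2 * h - 3 * d = t - d - 2 * h - 2 * d); last by ring.
  by rewrite !lerD2r lerD2l lerN2.
by rewrite lerD2r gerBl.
Qed.

Definition decay_gain : R :=
  v_gain + r ^+ 2 * v_gain + (ep_gain + r ^+ 2 * ep_gain).
Lemma decay_gain_ge0 : 0 <= decay_gain.
Proof.
have r2 := sqr_ge0 r.
by apply: addr_ge0; (apply: addr_ge0; last apply: mulr_ge0).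
Qed.
Lemma decay x t : 0 <= x <= 1 -> 2 * h + 3 * d < t ->
  [/\ u x t ^+ 2 <= decay_gain * Q (t - (2 * h + 3 * d)) (t + h),
      v x t ^+ 2 <= decay_gain * Q (t - (2 * h + 3 * d)) (t + h),
      e x t ^+ 2 <= decay_gain * Q (t - (2 * h + 3 * d)) (t + h) &
      ep x t ^+ 2 <= decay_gain * Q (t - (2 * h + 3 * d)) (t + h)].
Proof.
move=> x01 ht; have r2 := sqr_ge0 r.
have g1 : 0 <= r ^+ 2 * v_gain by exact: mulr_ge0.
have g2 : 0 <= r ^+ 2 * ep_gain by exact: mulr_ge0.
have W k w a : k <= decay_gain -> t - (2 * h + 3 * d) <= a ->
    w <= k * Q a (t + h) -> w <= decay_gain * Q (t - (2 * h + 3 * d)) (t + h).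
  move=> kg ha /le_trans; apply; apply: (@le_trans _ _ (decay_gain * Q a (t + h))).
    exact: ler_wpM2r.
  by apply: ler_wpM2l; [exact: decay_gain_ge0|exact: Qsub].
have [s1 s2 s3 s4] : [/\ t - (2 * h + 3 * d) <= t - 2 * h - 3 * d,
    t - (2 * h + 3 * d) <= t - 2 * h - 2 * d,
    t - (2 * h + 3 * d) <= t - h - 2 * d & t - (2 * h + 3 * d) <= t - h - d].
  by move: (d) (h) d0 h0 => d' h' *; split; lra.
have [t1 t2 t3 t4] : [/\ 2 * h + 2 * d < t, 2 * h + d < t, h + d < t & h < t].
  by move: (d) (h) d0 h0 ht => d' h' *; split; lra.
have [k1 k2 k3 k4] : [/\ r ^+ 2 * v_gain <= decay_gain, v_gain <= decay_gain,
    r ^+ 2 * ep_gain <= decay_gain & ep_gain <= decay_gain].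
  rewrite /decay_gain; move: (r ^+ 2 * v_gain) (r ^+ 2 * ep_gain) v_gain ep_gain
    g1 g2 v_gain0 ep_gain0 => a b a' b' p1 p2 p3 p4.
  by split; lra.
split.
- exact: W k1 s1 (u_window x01 t1).
- exact: W k2 s2 (v_window x01 t2).
- exact: W k3 s3 (e_window x01 t3).
- exact: W k4 s4 (ep_window x01 t4).
Qed.

(** * Bounds by the size of the initial data *)

Definition lyap_gain : R := expR gamma + gamma1^-1.
Definition pert0_gain : R := 1 + (lambda * r ^+ 2 * h + 1) * lyap_gain.
Definition disturbance_gain : R := d + (r ^+ 2 * h + (mu * gamma)^-1 + h) * lyap_gain.
Definition trace_gain : R :=
  2 * (obs_const lambda mu r cbar + pert_gain * (2 * disturbance_gain)) + pert0_gain.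
Definition stability_rate : R := 2 * learn_gain * (2 * ((2 * rho)^-1 * lyap_gain)).
Definition stability_gain : R := ctr * trace_gain + pert0_gain + gamma1 * lyap_gain.
Definition size0 : R := m 0 + eN 0 + epN 0 + ctN c ch 0.
Local Notation Z := size0.
Let Z0 : 0 <= Z.
Proof. by rewrite /size0; do !apply: addr_ge0; rewrite ?m0 ?eN_ge0 ?epN_ge0 ?ctN_ge0. Qed.
Let parts : [/\ m 0 <= Z, eN 0 <= Z, epN 0 <= Z & ctN c ch 0 <= Z].
Proof.
have a1 := m0 0; have a2 := eN_ge0 0; have a3 := epN_ge0 0; have a4 := ctN_ge0 c ch 0.
move: a1 a2 a3 a4; rewrite /size0.
move: (m 0) (eN 0) (epN 0) (ctN c ch 0) => x1 x2 x3 x4 a1 a2 a3 a4.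
split; first by rewrite -2!addrA lerDl !addr_ge0.
- by rewrite (addrC x1) -2!addrA lerDl !addr_ge0.
- by rewrite (addrC _ x3) -addrA lerDl !addr_ge0.
- by rewrite lerDr !addr_ge0.
Qed.
Let lyap_gain0 : 0 <= lyap_gain.
Proof. by rewrite addr_ge0 ?expR_ge0 ?invr_ge0 ?ltW. Qed.
Let g10 : 0 <= gamma1^-1 := ltW (etrans (invr_gt0 gamma1) gamma10).
Let lyap_Z : lyap <= lyap_gain * Z.
Proof.
have [_ _ z3 z4] := parts; rewrite /lyap0 /lyap_gain mulrDl lerD// ler_wpM2l//.
Qed.
Let k1 : 0 <= lambda * r ^+ 2 * h + 1.
Proof. by rewrite addr_ge0// !mulr_ge0 ?sqr_ge0 ?ltW. Qed.
Let k2 : 0 <= r ^+ 2 * h + (mu * gamma)^-1 + h.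
Proof. by rewrite !addr_ge0 ?mulr_ge0 ?sqr_ge0 ?invr_ge0 ?mulr_ge0 ?ltW. Qed.
Let pert0_Z : pert0 <= pert0_gain * Z.
Proof.
have [_ z2 _ _] := parts; rewrite /pert0 /pert0_gain [leRHS]mulrDl mul1r.
by apply: lerD => //; rewrite -(mulrA _ lyap_gain) ler_wpM2l.
Qed.
Let dist_Z : disturbance_total <= disturbance_gain * Z.
Proof.
have [_ z2 _ _] := parts; rewrite /disturbance_total /disturbance_gain [leRHS]mulrDl.
apply: lerD; first by rewrite ler_wpM2l// ltW.
by rewrite -(mulrA _ lyap_gain) ler_wpM2l.
Qed.
Let pert0_gain0 : 0 <= pert0_gain.
Proof. by apply: addr_ge0 => //; apply: mulr_ge0. Qed.
Lemma stability_rate_ge0 : 0 <= stability_rate.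
Proof.
apply: mulr_ge0; first exact: mulr_ge0.
by apply: mulr_ge0 => //; apply: mulr_ge0 => //; rewrite invr_ge0 mulr_ge0// ltW.
Qed.
(** Every ingredient is linear in the initial size, except for the Gronwall exponential, whose
    exponent is linear in it. *)
Lemma trace_bound_Z : trace_bound <= trace_gain * Z * expR (stability_rate * Z).
Proof.
have [z1 _ _ _] := parts.
have Qh : Q (- d) h <= obs_const lambda mu r cbar * Z.
  have := Qm (lexx 0); rewrite !add0r => /le_trans; apply; exact: ler_wpM2l.
have p0 := pert0_ge0.
have r0' : 0 <= (2 * rho)^-1 by rewrite invr_ge0 mulr_ge0// ltW.
apply: ler_pM; [|exact: expR_ge0| |].
- apply: addr_ge0 => //; apply: mulr_ge0 => //; apply: addr_ge0 => //.
  by do 2?apply: mulr_ge0 => //; apply: le_trans (disturbance_itg_le (lexx 0)); apply: itg_ge0.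
- rewrite /trace_gain [leRHS]mulrDl; apply: lerD => //; rewrite -mulrA ler_wpM2l// [leRHS]mulrDl.
  by apply: lerD => //; rewrite -!mulrA ler_wpM2l// ler_wpM2l.
rewrite ler_expR (_ : stability_rate * Z = 2 * learn_gain * (2 * ((2 * rho)^-1 * (lyap_gain * Z)))).
  by apply: ler_wpM2l; [exact: mulr_ge0|apply: ler_wpM2l => //; apply: ler_wpM2l].
by rewrite /stability_rate; ring.
Qed.
Lemma energy_bound t : 0 <= t ->
  m t + eN t + epN t + ctN c ch t <= stability_gain * Z * expR (stability_rate * Z).
Proof.
move=> t0; set X := expR _.
have X1 : 1 <= X by rewrite -expR0 ler_expR mulr_ge0// stability_rate_ge0.
have mt : m t <= ctr * trace_gain * Z * X.
  apply: (le_trans (mQ t0)); rewrite -!mulrA ler_wpM2l ?(ltW ctr0)// !mulrA.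
  apply: le_trans trace_bound_Z; apply: le_trans (trace_total (t + h)).
  by apply: Qsub => //; rewrite lerDr.
have et : eN t + epN t <= pert0_gain * Z * X.
  apply: (le_trans (pert_le t0)); apply: (le_trans pert0_Z).
  by rewrite ler_peMr// mulr_ge0.
have ct : ctN c ch t <= gamma1 * lyap_gain * Z * X.
  have := ctN_le mu0 cbar0 rho0 gamma0 gamma10 lc lm lu lep lch m0 cb chb tep bep upd t0.
  rewrite ler_pdivrMl// => /le_trans; apply.
  apply: (@le_trans _ _ (gamma1 * (lyap_gain * Z))); first by rewrite ler_wpM2l// ltW.
  apply: (@le_trans _ _ (gamma1 * lyap_gain * Z)).
    by rewrite mulrA.
  by rewrite ler_peMr// -mulrA; apply: mulr_ge0; [exact: ltW|exact: mulr_ge0].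
rewrite -(addrA (m t)) (_ : stability_gain * Z * X = ctr * trace_gain * Z * X +
  pert0_gain * Z * X + gamma1 * lyap_gain * Z * X); last by rewrite /stability_gain; ring.
by apply: lerD => //; apply: lerD.
Qed.
End loop.

(** * From kernels to Volterra equations *)

Section triangle_calculus.
Context {R : realType}.
Implicit Types (K Kx Kxi : R -> R -> R) (x xi a b k e L : R).

Lemma linear_approx (F dF : R -> R) x k L e :
  (forall z, `|z - x| <= `|k| -> is_derive z 1 F (dF z) /\ `|dF z - L| <= e) ->
  `|F (x + k) - F x - L * k| <= e * `|k|.
Proof.
move=> H.
have M (p q : R) : p < q -> (forall z, p <= z <= q -> `|z - x| <= `|k|) ->
    `|F q - F p - L * (q - p)| <= e * (q - p).
  move=> pq hz.
  have [] := @MVT R F dF p q pq.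
  - by move=> z; rewrite in_itv/= => /andP[pz zq]; apply: (proj1 (H z (hz z _))); rewrite !ltW.
  - apply: derivable_within_continuous => z; rewrite in_itv/= => /hz /H[dz _].
    by case: dz.
  move=> z; rewrite in_itv/= => /andP[pz zq] ->.
  rewrite -mulrBl normrM (gtr0_norm (_ : 0 < q - p)) ?subr_gt0// ler_wpM2r ?subr_ge0 ?(ltW pq)//.
  by apply: (proj2 (H z (hz z _))); rewrite !ltW.
have [k0|k0|->] := ltgtP k 0; last by rewrite addr0 subrr mulr0 subr0 normr0 mulr0.
- have := M (x + k) x; rewrite (_ : x - (x + k) = - k); last by ring.
  rewrite (ltr0_norm k0) => M'; rewrite -normrN.
  rewrite (_ : - (F (x + k) - F x - L * k) = F x - F (x + k) - L * - k); last by ring.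
  by apply: M' => [|z /andP[z1 z2]]; [lra|rewrite ler_norml; apply/andP; split; lra].
have := M x (x + k); rewrite (_ : x + k - x = k); last by ring.
rewrite (gtr0_norm k0) => M'.
by apply: M' => [|z /andP[z1 z2]]; [lra|rewrite ler_norml; apply/andP; split; lra].
Qed.

Lemma tri_interior K x xi e : {within tri, continuous (fun p => K p.1 p.2)} ->
  0 < xi -> xi < x -> x < 1 -> 0 < e ->
  exists2 d, 0 < d & forall x' xi', `|x' - x| < d -> `|xi' - xi| < d ->
    [/\ 0 < xi', xi' < x', x' < 1 & `|K x' xi' - K x xi| <= e].
Proof.
move=> cK xi0 xix x1 e0.
have tr : tri (x, xi) by split; rewrite /= ?ltW//=; rewrite !ltW.
have := (subspace_continuousP _ _).1 cK _ tr => /cvgrPdist_le /(_ e e0)/=.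
rewrite /within/= => -[[A B]/= [[d1 /= d10 H1] [d2 /= d20 H2]] AB].
exists (Num.min (Num.min d1 d2) (Num.min (Num.min xi (1 - x)) ((x - xi) / 2))).
  by rewrite !lt_min d10 d20 xi0 subr_gt0 x1 divr_gt0// subr_gt0.
move=> x' xi'; rewrite !lt_min => /andP[/andP[a1 a2] /andP[/andP[a3 a4] a5]].
move=> /andP[/andP[b1 b2] /andP[/andP[b3 b4] b5]].
have [c1 c2 c3] : [/\ 0 < xi', xi' < x' & x' < 1].
  by move: a4 a5 b3 b5; rewrite !ltr_norml => /andP[_ ?] /andP[? _] /andP[? _] /andP[_ ?]; split; lra.
split=> //; have := AB (x', xi'); rewrite /= distrC; apply.
  by split; [apply: H1; rewrite /ball_/= distrC|apply: H2; rewrite /ball_/= distrC].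
by split; rewrite /= !ltW.
Qed.

(** The increment along an oblique line is a horizontal step plus a vertical one; by continuity of
    the partial derivatives each is linear up to an error e / n per unit length, n bounding the
    lengths of both steps. *)
Lemma path_derive K Kx Kxi x0 xi0 a b s : C1_tri_with K Kx Kxi ->
  0 < xi0 + b * s -> xi0 + b * s < x0 + a * s -> x0 + a * s < 1 ->
  is_derive s 1 (fun q => K (x0 + a * q) (xi0 + b * q))
    (a * Kx (x0 + a * s) (xi0 + b * s) + b * Kxi (x0 + a * s) (xi0 + b * s)).
Proof.
move=> [_ cKx cKxi dK]; set x := x0 + a * s; set xi := xi0 + b * s => p1 p2 p3.
set L := a * _ + _.
suff C : h^-1 *: (((fun q => K (x0 + a * q) (xi0 + b * q)) \o shift s) (h *: (1 : R)) -
    K (x0 + a * s) (xi0 + b * s)) @[h --> 0^'] --> L.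
  by apply: DeriveDef; [apply/cvg_ex; exists L|exact/cvg_lim].
apply/cvgrPdist_le => e e0.
set n := `|a| + `|b| + 1.
have n0 : 0 < n by rewrite ltr_wpDl ?addr_ge0.
have en : 0 < e / n by rewrite divr_gt0.
have [d1 d10 H1] := tri_interior cKx p1 p2 p3 en.
have [d2 d20 H2] := tri_interior cKxi p1 p2 p3 en.
near=> h.
have h0 : h != 0 by near: h; exact: nbhs_dnbhs_neq.
have hd : `|h| < Num.min d1 d2 / n.
  near: h; apply: dnbhs0_lt; by rewrite divr_gt0// lt_min d10.
have hd1 : n * `|h| < d1 by move: hd; rewrite ltr_pdivlMr// lt_min mulrC => /andP[].
have hd2 : n * `|h| < d2 by move: hd; rewrite ltr_pdivlMr// lt_min mulrC => /andP[].
have an : `|a| * `|h| <= n * `|h| by rewrite ler_wpM2r// /n -addrA lerDl.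
have bn : `|b| * `|h| <= n * `|h| by rewrite ler_wpM2r// /n addrAC lerDr addr_ge0.
have E1 : `|K (x + a * h) (xi + b * h) - K x (xi + b * h) - Kx x xi * (a * h)| <= e / n * `|a * h|.
  apply: (@linear_approx (fun y => K y (xi + b * h)) (fun y => Kx y (xi + b * h))) => z hz.
  have [] := H1 z (xi + b * h).
  - by rewrite (le_lt_trans hz)// normrM (le_lt_trans an).
  - by rewrite addrC addKr normrM (le_lt_trans bn).
  by move=> q1 q2 q3 q4; split=> //; have [] := dK _ _ q1 q2 q3.
have E2 : `|K x (xi + b * h) - K x xi - Kxi x xi * (b * h)| <= e / n * `|b * h|.
  apply: (@linear_approx (fun y => K x y) (fun y => Kxi x y)) => z hz.
  have [] := H2 x z.
  - by rewrite subrr normr0.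
  - by rewrite (le_lt_trans hz)// normrM (le_lt_trans bn).
  by move=> q1 q2 q3 q4; split=> //; have [] := dK _ _ q1 q2 q3.
rewrite /= /GRing.scale/= mulr1.
rewrite (_ : x0 + a * (h + s) = x + a * h); last by rewrite /x; ring.
rewrite (_ : xi0 + b * (h + s) = xi + b * h); last by rewrite /xi; ring.
rewrite distrC.
rewrite -(ler_pM2r (_ : 0 < `|h|)) ?normr_gt0// -normrM mulrBl.
rewrite (mulrC h^-1) mulfVK//.
rewrite (_ : _ - _ = (K (x + a * h) (xi + b * h) - K x (xi + b * h) - Kx x xi * (a * h)) +
  (K x (xi + b * h) - K x xi - Kxi x xi * (b * h))); last by rewrite /L; ring.
rewrite (le_trans (ler_normD _ _))// (le_trans (lerD E1 E2))//.
rewrite -mulrDr !normrM -mulrDl mulrA ler_wpM2r// -mulrA ler_piMr ?(ltW e0)//.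
by rewrite mulrC ler_pdivrMr// mul1r /n lerDl.
Unshelve. all: by end_near. Qed.

End triangle_calculus.

(** Extension by 0 makes a function known only on [0, 1] measurable and locally bounded on the line,
    so that [lbm] applies. [patchQ] does the same for functions of (x, t). *)
Definition patch01 {R : realType} (f : R -> R) (x : R) : R := if (0 <= x <= 1)%R then f x else 0.

Section patching.
Context {R : realType}.
Implicit Types (f g : R -> R) (x a b : R).

Lemma patch01E f x : 0 <= x <= 1 -> patch01 f x = f x.
Proof. by rewrite /patch01 => ->. Qed.

Lemma within_continuous_bounded f a b : {within `[a, b], continuous f} ->
  exists B, forall x, a <= x <= b -> `|f x| <= B.
Proof.
move=> cf; have [ab|ba] := leP a b; last first.
  by exists 0 => x /andP[ax xb]; have := le_lt_trans (le_trans ax xb) ba; rewrite ltxx.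
have [p _ hp] := EVT_max ab cf; have [q _ hq] := EVT_min ab cf.
exists (Num.max `|f p| `|f q|) => x xab.
have xi : x \in `[a, b]%R by rewrite in_itv.
rewrite maxC; apply: norm_le_max; apply/andP; split; [exact: hq|exact: hp].
Qed.

Lemma lbm_patch01 f : {within `[0, 1], continuous f} -> lbm1 (patch01 f).
Proof.
move=> cf; split; last first.
  have [B hB] := within_continuous_bounded cf; move=> M.
  exists (Num.max B 0) => z _; rewrite /patch01 le_max; case: ifP => [/hB->//|_].
  by rewrite normr0 lexx orbT.
have mI : measurable (`[0, 1]%classic : set R) by exact: measurable_itv.
have := (measurable_restrictT f mI).1 (subspace_continuous_measurable_fun mI cf).
apply: eq_measurable_fun => x _.
by rewrite /patch01 /patch mem_setE in_itv.
Qed.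

Lemma lbm_uniform_limit f :
  (forall e, 0 < e -> exists2 g, lbm1 g & forall x, `|g x - f x| <= e) -> lbm1 f.
Proof.
move=> H.
have inv0 n : 0 < n.+1%:R^-1 :> R by rewrite invr_gt0.
have /choice[g hg] n : exists g, lbm1 g /\ forall x, `|g x - f x| <= n.+1%:R^-1.
  by have [g] := H _ (inv0 n); exists g.
split.
  apply: (@measurable_fun_cvg _ (measurableTypeR R) R setT g f) => [n|x _]; first by case: (hg n) => -[].
  apply/cvgrPdist_le => e e0; near=> n.
  rewrite distrC; apply: (le_trans ((hg n).2 x)).
  by apply: ltW; near: n; exact: (near_infty_natSinv_lt (PosNum e0)).
move=> M; have [B hB] := (hg 0%N).1.2 M; exists (B + 1) => z /hB b.
have := (hg 0%N).2 z; rewrite invr1 => b'.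
rewrite -(subrKC (g 0%N z) (f z)) (le_trans (ler_normD _ _))//.
by apply: lerD => //; rewrite distrC.
Unshelve. all: by end_near. Qed.

Lemma within_comp (T U V : topologicalType) (A : set T) (B : set U) (h : T -> U) (k : U -> V) :
  continuous h -> (forall z, A z -> B (h z)) -> {within B, continuous k} ->
  {within A, continuous (k \o h)}.
Proof.
move=> cg AB /subspace_continuousP cf; apply: (subspace_continuousP A (k \o h)).2 => x Ax.
apply: (@cvg_comp _ _ _ h k _ _ _ _ (cf _ (AB _ Ax))).
move=> W HW; have HW' := cg x _ HW.
change (nbhs x (fun y => A y -> W (h y))).
by apply: (@filterS _ (nbhs x) _ _ _ _ HW') => y hy Ay; exact/hy/AB.
Qed.

Lemma path_ftc (F G : R -> R) (T : R) : 0 <= T ->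
  {within `[0, T], continuous F} -> {within `[0, T], continuous G} ->
  (forall s : R, 0 < s < T -> is_derive s 1 F (G s)) -> F T = F 0 + itg 0 T G.
Proof.
rewrite le_eqVlt => /predU1P[<- *|T0 cF cG dF]; first by rewrite itg_nil// addr0.
have [_ c0 cT] := (continuous_within_itvP F T0).1 cF.
have := @continuous_FTC2 R G F 0 T T0 cG; rewrite /itg /Rintegral => ->.
- by rewrite /= subrKC.
- split=> // s sI; have [] // := dF s _; by move: sI; rewrite ?inE/= ?in_itv/=.
- move=> s; rewrite ?inE/= ?in_itv/= => /dF ds.
  by rewrite derive1E; exact: derive_val.
Qed.

End patching.

Section kernel_volterra.
Context {R : realType}.
Variables (lambda mu r : R).
Hypotheses (lambda0 : 0 < lambda) (mu0 : 0 < mu) (r0 : 0 < r).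
Local Notation alpha := (lambda / (lambda + mu)).
Implicit Types (x xi s t T zeta a b : R) (c k : R -> R) (K Ku Kv : R -> R -> R).

Let lm0 : 0 < lambda + mu. Proof. exact: addr_gt0. Qed.
Let lmn0 : lambda + mu != 0. Proof. by rewrite gt_eqF. Qed.
Let ln0 : lambda != 0. Proof. by rewrite gt_eqF. Qed.
Let mn0 : mu != 0. Proof. by rewrite gt_eqF. Qed.
Let rn0 : r != 0. Proof. by rewrite gt_eqF. Qed.
Let alpha0 : 0 < alpha. Proof. by rewrite divr_gt0. Qed.
Let alpha1 : alpha < 1. Proof. by rewrite ltr_pdivrMr// mul1r ltrDl. Qed.

Lemma path_continuous K a b p q A : {within tri, continuous (fun z => K z.1 z.2)} ->
  (forall s, A s -> tri (p + a * s, q + b * s)) ->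
  {within A, continuous (fun s => K (p + a * s) (q + b * s))}.
Proof.
move=> cK hA; apply: (@within_comp _ _ _ _ _ (fun s : R => (p + a * s, q + b * s)) _ _ hA cK) => s.
by apply: (@cvg_pair _ _ _ _ (nbhs (p + a * s)) (nbhs (q + b * s))); apply: cvgD;
  [exact: cvg_cst|apply: cvgMr|exact: cvg_cst|apply: cvgMr]; exact: cvg_id.
Qed.

Lemma within_scale (A : set R) (f : R -> R) a : {within A, continuous f} ->
  {within A, continuous (fun x => a * f x)}.
Proof.
move=> /subspace_continuousP cf; apply: (subspace_continuousP A _).2 => x Ax.
by apply: cvgM; [exact: cvg_cst|exact: cf].
Qed.

Lemma kernel_diag c Ku Kv x xi : C1_kernel lambda mu r c Ku Kv ->
  0 <= xi <= x -> x <= 1 -> Kv x xi = Kv (x - xi) 0.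
Proof.
move=> [Kux [Kuxi [Kvx [Kvxi [_ C pde _]]]]].
have [cK cKx cKxi _] := C.
have strict x' xi' : 0 <= xi' -> xi' < x' -> x' <= 1 -> Kv x' xi' = Kv (x' - xi') 0.
  move=> p1 p2 p3.
  have tr s : 0 <= s <= xi' -> tri (x' - xi' + 1 * s, 0 + 1 * s).
    by move=> /andP[s0 s1]; split; rewrite /=; lra.
  have -> : Kv x' xi' = Kv (x' - xi' + 1 * xi') (0 + 1 * xi') by congr Kv; ring.
  have -> : Kv (x' - xi') 0 = Kv (x' - xi' + 1 * 0) (0 + 1 * 0) by congr Kv; ring.
  have := @path_ftc _ (fun s => Kv (x' - xi' + 1 * s) (0 + 1 * s)) (fun=> 0) xi' p1.
  rewrite itg0 addr0; apply.
  - by apply: path_continuous => // s /=; rewrite in_itv/=; exact: tr.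
  - by apply: continuous_subspaceT => z; exact: cvg_cst.
  move=> s /andP[s0 s1].
  have := @path_derive _ Kv Kvx Kvxi (x' - xi') 0 1 1 s C.
  have [|| _ e0] := pde (x' - xi' + 1 * s) (0 + 1 * s); [lra|lra|].
  rewrite (_ : 1 * _ + 1 * _ = 0).
    by apply; lra.
  move: e0; move: (Kvx _ _) (Kvxi _ _) => z1 z2 e0.
  by apply: (mulfI mn0); rewrite mulrDr (mul1r z1) e0; ring.
move=> /andP[p1]; rewrite le_eqVlt => /predU1P[<- p3|]; last exact: strict.
rewrite subrr; move: p1; rewrite le_eqVlt => /predU1P[<-//|p1].
(* A path along the diagonal runs in the boundary of the triangle, where no derivative is given. The
   nearby path from (s, 0) to (xi, xi - s) lies inside, and s tends to 0. *)
pose F s := Kv (xi + 0 * s) (xi + -1 * s) - Kv (0 + 1 * s) (0 + 0 * s).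
have cF : {within `[0, xi], continuous F}.
  move=> z; apply: continuousB.
    by apply: path_continuous => // s /=; rewrite in_itv/= => /andP[s0 s1]; split; rewrite /=; lra.
  by apply: path_continuous => // s /=; rewrite in_itv/= => /andP[s0 s1]; split; rewrite /=; lra.
have [_ F0 _] := (continuous_within_itvP F p1).1 cF.
have F0' : F s @[s --> 0^'+] --> (0 : R).
  apply: (@cvg_trans _ ((fun=> 0 : R) @ 0^'+)); last exact: cvg_cst.
  apply: near_eq_cvg; near=> s.
  have s0 : 0 < s by near: s; exact: nbhs_right_gt.
  have s1 : s < xi by near: s; exact: nbhs_right_lt.
  rewrite /F strict//; [|lra|lra|lra].
  have -> : xi + 0 * s - (xi + -1 * s) = 0 + 1 * s by ring.
  by rewrite mul0r addr0 subrr.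
have : F 0 = 0 by exact: (cvg_unique _ F0 F0').
by rewrite /F !mulr0 !addr0 => /eqP; rewrite subr_eq0 => /eqP.
Unshelve. all: by end_near. Qed.

Section C1.
Variables (c : R -> R) (Ku Kv : R -> R -> R).
Hypothesis C : C1_kernel lambda mu r c Ku Kv.
Local Notation k := (patch01 c).
Local Notation kappa := (patch01 (Kv ^~ 0)).
Local Notation Ku1 := (patch01 (Ku 1)).

Lemma kernel_lbm : [/\ lbm1 k, lbm1 kappa & lbm1 Ku1].
Proof.
have [Kux [Kuxi [Kvx [Kvxi [[cu _ _ _] [cv _ _ _] _ bc]]]]] := C.
split; apply: lbm_patch01.
(* Continuity of c is read off from K^u on the diagonal, where the boundary condition makes it a
   multiple of c. *)
- have ck : {within `[0, 1], continuous (fun x => - (lambda + mu) * Ku (0 + 1 * x) (0 + 1 * x))}.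
    apply: within_scale.
    by apply: path_continuous => // s /=; rewrite in_itv/= => /andP[s0 s1]; split; rewrite /=; lra.
  apply: subspace_eq_continuous ck => x; rewrite inE/= in_itv/= => x01.
  rewrite /from_subspace.
  have -> : Ku (0 + 1 * x) (0 + 1 * x) = Ku x x by congr Ku; ring.
  by rewrite (bc x x01).1; field.
- apply: (@subspace_eq_continuous _ _ _ (fun x => Kv (0 + 1 * x) (0 + 0 * x))).
    by move=> x _; rewrite mul0r addr0 add0r mul1r.
  by apply: path_continuous => // s /=; rewrite in_itv/= => /andP[s0 s1]; split; rewrite /=; lra.
apply: (@subspace_eq_continuous _ _ _ (fun x => Ku (1 + 0 * x) (0 + 1 * x))).
  by move=> x _; rewrite mul0r addr0 add0r mul1r.
by apply: path_continuous => // s /=; rewrite in_itv/= => /andP[s0 s1]; split; rewrite /=; lra.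
Qed.

Lemma kernel_char s T : 0 < s < 1 -> 0 <= T -> 0 <= s - lambda * T -> s + mu * T <= 1 ->
  (lambda + mu) * Ku (s + mu * T) (s - lambda * T) = - k s +
  (lambda + mu) * itg 0 T (fun z => k (s - lambda * z) * kappa ((lambda + mu) * z)).
Proof.
move=> /andP[s0 s1] T0 h1 h2.
have [Kux [Kuxi [Kvx [Kvxi [Cu _ pde bc]]]]] := C.
have [cu cux cuxi _] := Cu.
have sb (z q : R) : 0 < q -> 0 <= z <= T -> q * z <= q * T by move=> q0 /andP[_ ?]; rewrite ler_pM2l.
have tr z : 0 <= z <= T -> tri (s + mu * z, s + - lambda * z).
  move=> zT; have := sb z _ lambda0 zT; have := sb z _ mu0 zT; case/andP: zT => z0 _.
  have := mulr_ge0 (ltW lambda0) z0; have := mulr_ge0 (ltW mu0) z0.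
  by split; rewrite /=; [apply/andP; split|]; lra.
pose G z := mu * Kux (s + mu * z) (s + - lambda * z) + - lambda * Kuxi (s + mu * z) (s + - lambda * z).
have -> : Ku (s + mu * T) (s - lambda * T) = Ku (s + mu * 0) (s + - lambda * 0) + itg 0 T G.
  rewrite -mulNr; apply: (@path_ftc _ (fun z => Ku (s + mu * z) (s + - lambda * z)) G T T0).
  - by apply: path_continuous => // z /=; rewrite in_itv/=; exact: tr.
  - by apply: within_continuousD; apply: within_scale;
      apply: path_continuous => // y /=; rewrite in_itv/=; exact: tr.
  move=> z /andP[z0 zT]; apply: path_derive => //.
  - have : lambda * z < lambda * T by rewrite ltr_pM2l.
    by lra.
  - by have := mulr_gt0 lambda0 z0; have := mulr_gt0 mu0 z0; lra.
  have : mu * z < mu * T by rewrite ltr_pM2l.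
  by lra.
rewrite !mulr0 !addr0 (bc s _).1 ?(ltW s0) ?(ltW s1)// patch01E ?(ltW s0) ?(ltW s1)//.
rewrite mulrDr mulrCA divff// mulr1; congr (_ + _ * _).
apply: itg_ext => z zT; have [/=tr1 tr2] := tr z zT.
have [pz _] := pde _ _ tr1 tr2.
have -> : G z = c (s + - lambda * z) * Kv (s + mu * z) (s + - lambda * z) by rewrite /G pz; ring.
rewrite (kernel_diag C tr1 tr2).
case/andP: (tr1) => tr3 tr4.
rewrite -(mulNr lambda) !patch01E//; last 2 first.
- rewrite (_ : (lambda + mu) * z = s + mu * z - (s + - lambda * z)); last by ring.
  by rewrite subr_ge0 tr4/= (le_trans _ tr2)// gerBl.
- by rewrite tr3 (le_trans tr4).
by congr (_ * Kv _ _); ring.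
Qed.

Lemma C1_kernel_volterra : volterra_kernel lambda mu r k kappa Ku1.
Proof.
have [lk lkappa lKu] := kernel_lbm.
have [_ [_ [_ [_ [_ _ _ bc]]]]] := C.
split=> [zeta /andP[z0 z1]|xi /andP[x0 x1]].
- rewrite (patch01E (Kv ^~ 0)) ?z0//= (bc zeta _).2 ?z0//.
  rewrite (_ : _ * (_ * Ku _ _) = (lambda + mu) * Ku zeta 0); last by field; rewrite ?ln0 ?rn0 ?lmn0 ?mn0.
  (* At zeta = 0 the characteristic shrinks to a corner of the triangle, outside the range of
     [kernel_char]; the boundary condition on the diagonal is then the claim. *)
  move: z0; rewrite le_eqVlt => /predU1P[<-|z0].
    rewrite mulr0 itg_nil// addr0 (bc 0 _).1 ?lexx//= patch01E ?lexx//=.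
    by rewrite mulrC mulfVK.
  (* The characteristic leaving the diagonal at alpha * zeta reaches (zeta, 0) after the parameter
     length T. *)
  set T := zeta / (lambda + mu).
  have := @kernel_char (alpha * zeta) T.
  have -> : alpha * zeta + mu * T = zeta by rewrite /T; field.
  have -> : alpha * zeta - lambda * T = 0 by rewrite /T; field.
  move=> -> //; first last.
  + by rewrite divr_ge0 ?ltW.
  + by rewrite mulr_gt0//= (lt_le_trans _ z1)// gtr_pMl.
  congr (_ + _).
  have := @itg_affine _ (lambda + mu) 0 0 T (fun z => k (alpha * (zeta - z)) * kappa z) lm0.
  rewrite mulr0 addr0 addr0 (_ : (lambda + mu) * T = zeta); last by rewrite /T; field.
  move=> e1; rewrite (_ : itg 0 T _ = itg 0 T (fun x => k (alpha * (zeta - ((lambda + mu) * x + 0))) * kappa ((lambda + mu) * x + 0))); last first.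
    by apply: itg_ext => x _; rewrite addr0; congr (k _ * _); field.
  rewrite e1; last by lbm.
  rewrite mulrA divff// mul1r.
  have := @itg_refl _ 0 zeta zeta (fun x => kappa (zeta - x) * k (alpha * x)).
  rewrite subrr subr0 => <-; last by lbm.
  by apply: itg_ext => x _; rewrite mulrC; congr (kappa _ * _); ring.
rewrite (patch01E (Ku 1)) ?x0//.
move: x1; rewrite le_eqVlt => /predU1P[->|x1].
  rewrite itg_nil// addr0 (bc 1 _).1 ?lexx ?ler01//= mulrC mulfVK//.
  rewrite (_ : alpha * _ = 1); last by field; rewrite ?ln0 ?lmn0.
  by rewrite patch01E// ler01 lexx.
(* Traced back from (1, xi), the characteristic meets the diagonal at (s, s) after the parameter
   length T. *)
set T := (1 - xi) / (lambda + mu).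
set s := alpha * (1 + mu * lambda^-1 * xi).
have := @kernel_char s T.
have -> : s + mu * T = 1 by rewrite /s /T; field; rewrite ?ln0 ?lmn0.
have -> : s - lambda * T = xi by rewrite /s /T; field; rewrite ?ln0 ?lmn0.
move=> -> //; first last.
- by rewrite divr_ge0 ?ltW// subr_gt0.
- rewrite (_ : s = (lambda + mu * xi) / (lambda + mu)); last by rewrite /s; field; rewrite ?ln0 ?lmn0.
  rewrite ltr_pdivrMr// mul1r ltrD2l gtr_pMr// x1 andbT divr_gt0//.
  by rewrite ltr_wpDr// mulr_ge0// ltW.
congr (_ + _).
have := @itg_affine_neg _ (- (lambda + mu)) 1 0 T (fun z => kappa (1 - z) * k (alpha * (z + mu * lambda^-1 * xi))).
rewrite oppr_lt0 mulr0 add0r opprK (_ : - (lambda + mu) * T + 1 = xi); last by rewrite /T; field.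
move=> /(_ lm0) e1.
rewrite (_ : itg 0 T _ = itg 0 T (fun x => kappa (1 - (- (lambda + mu) * x + 1)) * k (alpha * (- (lambda + mu) * x + 1 + mu * lambda^-1 * xi)))); last first.
  by apply: itg_ext => x _; rewrite mulrC; congr (kappa _ * k _); rewrite /s; field; rewrite ?ln0.
by rewrite e1; [rewrite mulrA divff// mul1r|lbm].
Qed.

End C1.

Lemma eq_of_small (p q C : R) : (forall e, 0 < e -> e <= 1 -> `|p - q| <= C * e) -> p = q.
Proof.
move=> H; apply/eqP; rewrite -subr_eq0 -normr_le0; apply/ler_addgt0Pr => e e0.
have C0 : 0 <= C by have := H 1 ltr01 (lexx 1); rewrite mulr1; exact: le_trans.
set e' := Num.min 1 (e / (C + 1)).
have C1 : 0 < C + 1 by rewrite ltr_wpDl.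
have e'0 : 0 < e' by rewrite lt_min ltr01 divr_gt0.
have e'1 : e' <= 1 by rewrite ge_min lexx.
rewrite add0r; apply: (le_trans (H e' e'0 e'1)).
apply: (@le_trans _ _ ((C + 1) * (e / (C + 1)))); last by rewrite mulrC divfK ?gt_eqF.
by apply: ler_pM => //; [exact: ltW|rewrite lerDl|rewrite /e' ge_min lexx orbT].
Qed.

Lemma itg_product_close (f g f' g' : R -> R) (a b B e : R) :
  lbm1 f -> lbm1 g -> lbm1 f' -> lbm1 g' -> a <= b -> b <= a + 1 -> 0 <= e -> e <= 1 ->
  (forall x, a <= x <= b -> [/\ `|f x| <= B, `|g x| <= B, `|f' x - f x| <= e & `|g' x - g x| <= e]) ->
  `|itg a b (fun x => f' x * g' x) - itg a b (fun x => f x * g x)| <= (2 * B + 1) * e.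
Proof.
move=> lf lg lf' lg' ab ba e0 e1 H.
have B0 : 0 <= B by have [] := H a; rewrite ?lexx//; move=> /(le_trans (normr_ge0 _)).
have K0 : 0 <= (2 * B + 1) * e by rewrite mulr_ge0// addr_ge0// mulr_ge0.
rewrite -itgB; [|by lbm|by lbm].
apply: le_trans (itg_norm _ _ _) _; first by lbm.
apply: (@le_trans _ _ (itg a b (fun=> (2 * B + 1) * e))).
  apply: itg_le; [by lbm|by lbm|move=> x /H[h1 h2 h3 h4]].
  rewrite (_ : _ - _ = f' x * (g' x - g x) + (f' x - f x) * g x); last by ring.
  rewrite (_ : _ * e = (B + 1) * e + e * B); last by ring.
  rewrite (le_trans (ler_normD _ _))// !normrM; apply: lerD; apply: ler_pM => //.
  rewrite -(subrKC (f x) (f' x)) (le_trans (ler_normD _ _))// lerD//.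
  exact: le_trans e1.
by rewrite itg_cst// ler_piMr// lerBlDl.
Qed.

(** Every term of the Volterra equations moves by at most a constant times e when coefficient and
    kernels move by e; the products use the bound B of the limits. Measurability of the limits and
    the constancy of K^v along diagonals pass to the limit in the same way. *)
Lemma kernel_volterraP k Ku Kv : kernel lambda mu r k Ku Kv ->
  [/\ lbm1 (patch01 k), lbm1 (patch01 (Kv ^~ 0)), lbm1 (patch01 (Ku 1)),
    volterra_kernel lambda mu r (patch01 k) (patch01 (Kv ^~ 0)) (patch01 (Ku 1)) &
    forall xi, 0 <= xi <= 1 -> Kv 1 xi = Kv (1 - xi) 0].
Proof.
move=> H.
have close (f g : R -> R) e : 0 < e -> (forall x, 0 <= x <= 1 -> `|f x - g x| <= e) ->
    forall x, `|patch01 f x - patch01 g x| <= e.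
  by move=> e0 h x; rewrite /patch01; case: ifP => [/h//|_]; rewrite subrr normr0 ltW.
have A e : 0 < e -> exists c' Ku' Kv', [/\ C1_kernel lambda mu r c' Ku' Kv',
    (forall x, `|patch01 c' x - patch01 k x| <= e),
    (forall x, `|patch01 (Kv' ^~ 0) x - patch01 (Kv ^~ 0) x| <= e),
    (forall x, `|patch01 (Ku' 1) x - patch01 (Ku 1) x| <= e) &
    forall xi, 0 <= xi <= 1 -> `|Kv 1 xi - Kv (1 - xi) 0| <= 2 * e].
  move=> e0; have [c' [Ku' [Kv' [C h1 h2]]]] := H e e0; exists c', Ku', Kv'; split => //.
  - exact: close.
  - by apply: close => // x /andP[x0 x1]; have [] := h2 x 0; rewrite ?lexx ?x0.
  - by apply: close => // x /andP[x0 x1]; have [] := h2 1 x; rewrite ?lexx ?x0.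
  move=> xi /andP[x0 x1].
  have [|//|_ a1] := h2 1 xi; first by rewrite x0.
  have [||_ a2] := h2 (1 - xi) 0; [by rewrite lexx subr_ge0|by rewrite gerBl|].
  have := kernel_diag C (_ : 0 <= xi <= 1) (lexx 1); rewrite x0 => /(_ x1) e1.
  rewrite (_ : _ - _ = (Kv' (1 - xi) 0 - Kv (1 - xi) 0) - (Kv' 1 xi - Kv 1 xi)); last by rewrite e1; ring.
  by rewrite (le_trans (ler_normB _ _))// mulr_natl mulr2n lerD.
have lk : lbm1 (patch01 k).
  by apply: lbm_uniform_limit => e /A [c' [Ku' [Kv' [/kernel_lbm[a1 a2 a3] h1 _ _ _]]]]; exists (patch01 c').
have lv : lbm1 (patch01 (Kv ^~ 0)).
  by apply: lbm_uniform_limit => e /A [c' [Ku' [Kv' [/kernel_lbm[a1 a2 a3] _ h1 _ _]]]]; exists (patch01 (Kv' ^~ 0)).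
have lu : lbm1 (patch01 (Ku 1)).
  by apply: lbm_uniform_limit => e /A [c' [Ku' [Kv' [/kernel_lbm[a1 a2 a3] _ _ h1 _]]]]; exists (patch01 (Ku' 1)).
split=> //; last first.
  move=> xi x01; apply: (@eq_of_small _ _ 2) => e /A [c' [Ku' [Kv' [_ _ _ _ h]]]] _; exact: h.
have [B1 hB1] := lk.2 1; have [B2 hB2] := lv.2 1.
set B := Num.max B1 B2.
have kB x : 0 <= x <= 1 -> `|patch01 k x| <= B.
  by move=> /andP[x0 x1]; rewrite le_max hB1// ger0_norm.
have vB x : 0 <= x <= 1 -> `|patch01 (Kv ^~ 0) x| <= B.
  by move=> /andP[x0 x1]; rewrite le_max hB2 ?orbT// ger0_norm.
have tri_lim (p q p' q' z z' C0 C1 C2 e : R) : p' = - q' + z' -> `|p' - p| <= C0 * e ->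
    `|q' - q| <= C1 * e -> `|z' - z| <= C2 * e -> `|p - (- q + z)| <= (C0 + C1 + C2) * e.
  move=> e1 h0 h1 h2.
  rewrite (_ : p - (- q + z) = - (p' - p) - (q' - q) + (z' - z)); last by rewrite e1; ring.
  rewrite 2!mulrDl (le_trans (ler_normD _ _))// lerD// (le_trans (ler_normB _ _))// lerD//.
  by rewrite normrN.
have sc (w x x' e : R) : 0 <= w -> `|x' - x| <= e -> `|w * x' - w * x| <= w * e.
  by move=> w0 h; rewrite -mulrBr normrM ger0_norm// ler_wpM2l.
split=> [zeta /andP[z0 z1]|xi /andP[z0 z1]].
- apply: (@eq_of_small _ _ ((lambda + mu) * mu / (lambda * r) + 1 + (2 * B + 1))) => e e0 e1.
  have [c' [Ku' [Kv' [C h1 h2 h3 _]]]] := A e e0.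
  have [l1 l2 l3] := kernel_lbm C.
  apply: (tri_lim _ _ _ _ _ _ _ _ _ _ ((C1_kernel_volterra C).1 zeta _)); first by rewrite z0.
  + by apply: sc => //; apply: divr_ge0; apply: mulr_ge0; exact: ltW.
  + by rewrite mul1r.
  apply: itg_product_close => //; [by lbm|by lbm|by lbm|by lbm|by rewrite add0r|exact: ltW|].
  move=> x /andP[x0 x1]; split=> //; [apply: vB|apply: kB].
    by rewrite subr_ge0 x1/= lerBlDr (le_trans z1)// lerDl.
  have ax : alpha * x <= x by rewrite ler_piMl// ltW.
  by rewrite mulr_ge0 ?(ltW alpha0)//= (le_trans ax)// (le_trans x1).
apply: (@eq_of_small _ _ ((lambda + mu) + 1 + (2 * B + 1))) => e e0 e1.
have [c' [Ku' [Kv' [C h1 h2 h3 _]]]] := A e e0.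
have [l1 l2 l3] := kernel_lbm C.
apply: (tri_lim _ _ _ _ _ _ _ _ _ _ ((C1_kernel_volterra C).2 xi _)); first by rewrite z0.
+ by apply: sc => //; exact: ltW.
+ by rewrite mul1r.
apply: itg_product_close => //; [by lbm|by lbm|by lbm|by lbm|by rewrite lerDr|exact: ltW|].
move=> x /andP[x0 x1]; have xx := le_trans z0 x0; split=> //; [apply: vB|apply: kB].
  by rewrite subr_ge0 x1/= gerBl.
rewrite (_ : alpha * _ = (lambda * x + mu * xi) / (lambda + mu)); last by field; rewrite ln0 lmn0.
have l0 := ltW lambda0; have q0 := ltW mu0.
have n0 : 0 <= lambda * x + mu * xi by rewrite addr_ge0// mulr_ge0.
rewrite divr_ge0 ?(ltW lm0)//= ler_pdivrMr// mul1r.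
by apply: lerD; rewrite ler_piMr.
Qed.

End kernel_volterra.

(** * Interpolation of DeepONets *)

(** A new node is fitted by adding a multiple of the product that vanishes at the old ones. *)
Lemma poly_interpolation (F : fieldType) (f : F -> F) (s : seq F) :
  exists p : {poly F}, forall a, a \in s -> p.[a] = f a.
Proof.
elim: s => [|a s [p hp]]; first by exists 0.
have [as_|as_] := boolP (a \in s).
  by exists p => b; rewrite inE => /predU1P[->|]; exact: hp.
pose q := \prod_(b <- s) ('X - b%:P).
have rq b : root q b = (b \in s) by rewrite root_prod_XsubC.
have qa : q.[a] != 0 by rewrite -rootE rq.
exists (p + ((f a - p.[a]) / q.[a]) *: q) => b; rewrite inE hornerD hornerZ => /predU1P[->|bs].
  by rewrite divfK// subrKC.
by rewrite hp// (eqP (_ : root q b)) ?rq// mulr0 addr0.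
Qed.

Section deeponet_slice.
Context {R : realType}.

(* c need not be C^1, but only its values at the sensors matter, and a polynomial
   interpolates them. *)
Lemma don_eval_lbm (N : deeponet (R := R)) (c : R -> R) : don_C1 N ->
  lbm1 (patch01 (don_eval N c 1)).
Proof.
move=> CN.
have [p hp] := poly_interpolation c (codom (@don_sensor R N)).
have C1p : C1_01 (fun z : R => p.[z]).
  exists (fun z : R => p^`().[z]); split.
  - by apply: continuous_subspaceT; exact: continuous_horner.
  - by apply: continuous_subspaceT; exact: continuous_horner.
  - by move=> x _; exact: is_derive_poly.
have -> : don_eval N c = don_eval N (fun z : R => p.[z]).
  apply/funext => x; apply/funext => xi; apply: eq_bigr => i _; congr (nn_eval _ _ _ * _).
  by apply/rowP => j; rewrite !mxE hp// codom_f.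
have [Kx [Kxi [cK _ _ _]]] := CN _ C1p.
apply: lbm_patch01.
have cs : {within `[0, 1], continuous (fun s => don_eval N (horner p) (1 + 0 * s) (0 + 1 * s))}.
  apply: (@path_continuous R (don_eval N (horner p))) => // s /=.
  by rewrite in_itv/= => /andP[s0 s1]; split; rewrite /=; lra.
apply: subspace_eq_continuous cs => s _.
by rewrite /from_subspace mul0r addr0 add0r mul1r.
Qed.

End deeponet_slice.

(** * Norms along a trajectory *)

Section norms.
Context {R : realType}.
Local Notation leb := (@lebesgue_measure R).
Implicit Types (f g : R -> R) (w : R -> R -> R) (x t s a M : R).

(* Every nondegenerate interval contains a rational, so that A is a countable
   union of intervals. *)
Lemma thick_measurable (A : set R) :
  (forall t, A t -> exists2 s, s != t &
    forall p, (t <= p <= s) || (s <= p <= t) -> A p) -> measurable A.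
Proof.
move=> H.
pose C (q : rat) := [set t | forall p, (t <= p <= ratr q) || (ratr q <= p <= t) -> A p].
have -> : A = \bigcup_q C q.
  apply/seteqP; split=> [t At|t [q _] /(_ t)]; last first.
    by apply; rewrite lexx andbT /=; exact: le_total.
  have [s st hs] := H t At.
  have [ts|] := ltP t s.
    have [q] := rat_in_itvoo ts; rewrite in_itv/= => /andP[q1 q2]; exists q => // p.
    move=> /orP[|]/andP[p1 p2]; apply: hs; apply/orP; left; apply/andP; split; lra.
  rewrite le_eqVlt (negbTE st)/= => ts.
  have [q] := rat_in_itvoo ts; rewrite in_itv/= => /andP[q1 q2]; exists q => // p.
  move=> /orP[|]/andP[p1 p2]; apply: hs; apply/orP; right; apply/andP; split; lra.
apply: bigcupT_measurable_rat => q; apply: is_interval_measurable => x y hx hy z.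
move=> /andP[xz zy] p /orP[/andP[p1 p2]|/andP[p1 p2]].
  by apply: hx; rewrite p2 (le_trans xz).
by apply: hy; rewrite p1 (le_trans p2 zy) orbT.
Qed.

Lemma enormL2E f : lbm1 (patch01 f) -> enormL2 f = (Num.sqrt (itg 0 1 (fun x => f x ^+ 2)))%:E.
Proof.
move=> lf; rewrite /enormL2 Lnorm.unlock/=.
have -> : (\int[leb]_x `|(patch (fun=> 0%R) `[0%R, 1%R] f x)%:E| `^ 2 =
   (itg 0 1 (fun x => f x ^+ 2))%:E)%E.
  rewrite (@itg_ext _ _ _ _ (fun x => patch01 f x ^+ 2)); last by move=> x xI; rewrite patch01E.
  rewrite itgE; last by lbm.
  rewrite [RHS]integral_mkcond; apply: eq_integral => x _.
  rewrite abse_EFin poweR_EFin powR_mulrn// real_normK ?num_real//.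
  rewrite /patch; case: ifPn => xI; last by rewrite expr0n.
  by rewrite patch01E//; move: xI; rewrite inE/= in_itv.
rewrite poweR_EFin powR12_sqrt//.
by apply: itg_ge0 => x _; exact: sqr_ge0.
Qed.

Lemma normL2_sqr f : lbm1 (patch01 f) -> normL2 f ^+ 2 = itg 0 1 (fun x => f x ^+ 2).
Proof.
by move=> lf; rewrite /normL2 enormL2E//= sqr_sqrtr//; apply: itg_ge0 => x _; exact: sqr_ge0.
Qed.

Lemma normooE f M : (forall x, 0 <= x <= 1 -> `|f x| <= M) -> enormoo f = (normoo f)%:E.
Proof.
move=> fM; rewrite /normoo fineK// fin_numE; apply/andP; split.
  apply/eqP => e; have : (`|f 0|%:E <= enormoo f)%E.
    by apply: ereal_sup_ubound; exists 0 => //=; rewrite in_itv/= lexx ler01.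
  by rewrite e leeNy_eq.
apply/eqP => e; have : (enormoo f <= M%:E)%E.
  by apply: ge_ereal_sup => z [x]/=; rewrite in_itv/= => /fM xM <-; rewrite lee_fin.
by rewrite e leye_eq.
Qed.

Lemma normoo_ge f M x : (forall x, 0 <= x <= 1 -> `|f x| <= M) -> 0 <= x <= 1 -> `|f x| <= normoo f.
Proof.
move=> fM xI; rewrite -lee_fin -(normooE fM); apply: ereal_sup_ubound.
by exists x => //=; rewrite in_itv.
Qed.

Lemma normoo_le f M : (forall x, 0 <= x <= 1 -> `|f x| <= M) -> normoo f <= M.
Proof.
move=> fM; rewrite -lee_fin -(normooE fM); apply: ge_ereal_sup => z [x]/=.
by rewrite in_itv/= => /fM xM <-; rewrite lee_fin.
Qed.

Lemma normoo_ge0 f M : (forall x, 0 <= x <= 1 -> `|f x| <= M) -> 0 <= normoo f.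
Proof.
by move=> fM; apply: le_trans (normoo_ge fM (_ : 0 <= 0 <= 1)) => //; rewrite lexx ler01.
Qed.

Lemma normoo_gt f M a : (forall x, 0 <= x <= 1 -> `|f x| <= M) -> a < normoo f ->
  exists2 x, 0 <= x <= 1 & a < `|f x|.
Proof.
move=> fM; rewrite -lte_fin -(normooE fM) => /ereal_sup_gt[z [x]/=].
by rewrite in_itv/= => xI <-; rewrite lte_fin => ax; exists x.
Qed.

Lemma normL2_le_normoo f M : lbm1 (patch01 f) -> (forall x, 0 <= x <= 1 -> `|f x| <= M) ->
  normL2 f <= normoo f.
Proof.
move=> lf fM; have n0 := normoo_ge0 fM.
rewrite -(@ler_pXn2r _ 2)// ?nnegrE//; last by rewrite /normL2 enormL2E//= sqrtr_ge0.
rewrite normL2_sqr// (@itg_ext _ _ _ _ (fun x => patch01 f x ^+ 2)); last by move=> x xI; rewrite patch01E.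
rewrite (_ : normoo f ^+ 2 = itg 0 1 (fun=> normoo f ^+ 2)); last by rewrite itg_cst// subr0 mulr1.
apply: itg_le; [by lbm|by lbm|move=> x xI].
by rewrite patch01E// -real_normK ?num_real// lerXn2r ?nnegrE// (normoo_ge fM).
Qed.

(** Square integrability is checked through a majorant g of phi^2 whose integrals over [0, T] are
    bounded; the integral over the half-line is the supremum of those. *)
Lemma time_L2_LooP (phi g : R -> R) C M :
  measurable_fun (setT : set (measurableTypeR R)) (patch (fun=> 0) `[0, +oo[ phi) ->
  lbm1 g -> (forall t, 0 <= g t) -> (forall t, 0 <= t -> phi t ^+ 2 <= g t) ->
  (forall T, 0 <= T -> itg 0 T g <= C) ->
  (forall t, 0 <= t -> `|phi t| <= M) -> time_L2_Loo phi.
Proof.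
move=> mphi lg g0 phig gC phiM; set P := patch _ _ _ in mphi *.
have mP2 : measurable_fun (setT : set (measurableTypeR R)) (fun t => P t ^+ 2).
  exact: measurable_funX.
have PE t : P t = if 0 <= t then phi t else 0.
  by rewrite /P /patch mem_setE in_itv/= andbT.
have Pg t : P t ^+ 2 <= (if 0 <= t then g t else 0).
  by rewrite PE; case: ifP => [/phig//|_]; rewrite expr0n.
split; apply/andP; (split; first by rewrite inE); rewrite inE/= /finite_norm Lnorm.unlock/=.
  apply: poweR_lty; apply: (@le_lt_trans _ _ C%:E); last by rewrite ltry.
  apply: (@le_trans _ _ (\int[leb]_(t in `[0%R, +oo[) (g t)%:E)%E).
    rewrite [leRHS]integral_mkcond; apply: ge0_le_integral => //.
    - apply/measurable_EFinP.
      apply: eq_measurable_fun mP2 => t _.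
      by rewrite powR_mulrn// real_normK// num_real.
    - apply: (measurable_restrictT _ _).1; first exact: measurable_itv.
      by apply/measurable_EFinP; exact: lbm_measurable.
    move=> t _; apply: (@le_trans _ _ (P t ^+ 2)%:E).
      by rewrite lee_fin powR_mulrn// real_normK// num_real.
    apply: (@le_trans _ _ (if 0 <= t then g t else 0)%:E); first by rewrite lee_fin Pg.
    by rewrite [leRHS]/patch mem_setE in_itv/= andbT; case: ifP.
  rewrite ge0_integral_ereal_sup//; last exact: lbm_measurable.
  apply: ge_ereal_sup => _ [n _ <-].
  by rewrite -itgE// lee_fin gC.
case: ifP => _; last by rewrite ltry.
apply: (@le_lt_trans _ _ (Num.max M 0)%:E); last by rewrite ltry.
apply/ess_sup_inf.ess_supP; apply: nearW => t; rewrite [leLHS]/= lee_fin le_max -[patch _ _ _ _]/(P t) PE.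
by case: ifP => [/phiM->//|_]; rewrite normr0 lexx orbT.
Qed.

Definition patchQ w x t : R := if (0 <= x <= 1) && (0 <= t) then w x t else 0.

Lemma patchQE w x t : 0 <= x <= 1 -> 0 <= t -> patchQ w x t = w x t.
Proof. by rewrite /patchQ => -> ->. Qed.

Lemma patchQ_patch01 w t : 0 <= t -> patchQ w ^~ t = patch01 (w ^~ t).
Proof. by move=> t0; apply/funext => x; rewrite /patchQ /patch01 t0 andbT. Qed.

Lemma lbm2_patchQ w : locally_bounded_measurable w -> lbm2 (patchQ w).
Proof.
move=> [mw bw]; split.
  have mQ : measurable ((`[0, 1] : set R) `*` (`[0, +oo[ : set R) :
      set (measurableTypeR R * measurableTypeR R)).
    by apply: measurableX; exact: measurable_itv.
  have := (measurable_restrictT _ mQ).1 mw.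
  apply: eq_measurable_fun => -[x t] _.
  rewrite /patchQ /patch; congr (if _ then _ else _).
  apply/idP/idP; rewrite inE/= !in_itv/= andbT; first by case=> -> ->.
  by move=> /andP[-> ->].
move=> M; have [B hB] := bw M; exists (Num.max B 0) => -[x t].
rewrite /psize/= ge_max => /andP[_ tM]; rewrite /patchQ le_max; case: ifP => [/andP[x01 t0]|_].
  by rewrite hB// t0 -(ger0_norm t0).
by rewrite normr0 lexx orbT.
Qed.

Lemma segment01 (k x s z : R) : 0 <= x <= 1 -> 0 <= x + k * s <= 1 -> 0 <= z <= s ->
  0 <= x + k * z <= 1.
Proof.
move=> /andP[x0 x1] /andP[y0 y1] /andP[z0 zs]; have [k0|k0] := leP 0 k.
  have := mulr_ge0 k0 z0; have : k * z <= k * s by rewrite ler_wpM2l.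
  by move=> *; apply/andP; split; lra.
have : k * z <= 0 by rewrite nmulr_rle0.
have : k * s <= k * z by rewrite ler_nM2l.
by move=> *; apply/andP; split; lra.
Qed.

Lemma transport_patch (k : R) w (f F : R -> R -> R) : transport k w f ->
  (forall x t, 0 <= x <= 1 -> 0 <= t -> f x t = F x t) ->
  forall x t s, 0 <= t -> 0 <= s -> 0 <= x <= 1 -> 0 <= x + k * s <= 1 ->
  patchQ w (x + k * s) (t + s) = patchQ w x t + itg 0 s (fun z => F (x + k * z) (t + z)).
Proof.
move=> tw fF x t s t0 s0 xI yI; rewrite (patchQE w yI (addr_ge0 t0 s0)) (patchQE w xI t0) tw//; congr (_ + _).
apply: itg_ext => z zI; rewrite fF//; first exact: segment01 zI.
by rewrite addr_ge0//; case/andP: zI.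
Qed.

(** The source is bounded on bounded times, so w is Lipschitz along characteristics even where it is
    discontinuous across them. The measurability of the sup norms rests on this. *)
Lemma transport_lipschitz (k : R) w (f F : R -> R -> R) : lbm2 F -> transport k w f ->
  (forall x t, 0 <= x <= 1 -> 0 <= t -> f x t = F x t) ->
  forall T, exists2 L, 0 <= L & forall x t s, 0 <= t -> 0 <= s -> t + s <= T ->
    0 <= x <= 1 -> 0 <= x + k * s <= 1 -> `|w (x + k * s) (t + s) - w x t| <= L * s.
Proof.
move=> lF tw fF T; have [B hB] := lF.2 (Num.max 1 T).
exists (Num.max B 0) => [|x t s t0 s0 tsT /andP[x0 x1] /andP[y0 y1]]; first by rewrite le_max lexx orbT.
rewrite tw ?x0 ?y0// addrC addKr -/(itg 0 s (fun z => f (x + k * z) (t + z))).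
have inx z : 0 <= z <= s -> 0 <= x + k * z <= 1.
  by apply: segment01; rewrite ?x0 ?y0.
rewrite (@itg_ext _ _ _ _ (fun z => F (x + k * z) (t + z))); last first.
  by move=> z /[dup] /inx xz /andP[z0 _]; rewrite fF// addr_ge0.
apply: le_trans (itg_norm _ _ _) _; first by lbm.
rewrite -[s in leRHS]subr0 -itg_cst//.
apply: itg_le; [by lbm|by lbm|move=> z /[dup] /inx /andP[z0 z1] /andP[z2 z3]].
rewrite le_max; have := hB (x + k * z, t + z); rewrite /psize/= ge_max => -> //.
rewrite !le_max (ger0_norm z0) z1/= ger0_norm ?addr_ge0//.
by rewrite (le_trans _ tsT) ?orbT// lerD2l.
Qed.

End norms.

(** * Sup norms in time: measurability, integrability and decay *)

Section decay.
Context {R : realType}.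
Local Notation TR := (measurableTypeR R).
Variables (w : R -> R -> R) (k : R).
Hypotheses (lw : locally_bounded_measurable w) (k0 : k != 0).
Hypothesis wL : forall T, exists2 L, 0 <= L & forall x t s : R, 0 <= t -> 0 <= s -> t + s <= T ->
  0 <= x <= 1 -> 0 <= x + k * s <= 1 -> `|w (x + k * s) (t + s) - w x t| <= L * s.
Implicit Types (x t s a T p : R).

Let wb T : exists M, forall t, 0 <= t <= T -> forall x, 0 <= x <= 1 -> `|w x t| <= M.
Proof. by have [M hM] := lw.2 T; exists M => t tT x xI; exact: hM. Qed.

Lemma normoo_norm_ge t x : 0 <= t -> 0 <= x <= 1 -> `|w x t| <= normoo (w ^~ t).
Proof.
move=> t0 xI; have [M hM] := wb t; apply: normoo_ge (hM t _) xI.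
by rewrite t0 lexx.
Qed.

Lemma normoo_time_ge0 t : 0 <= t -> 0 <= normoo (w ^~ t).
Proof. by move=> t0; have [M hM] := wb t; apply: normoo_ge0 (hM t _); rewrite t0 lexx. Qed.

(* A value exceeding a persists along the characteristic through it, forward or
   backward in time, whichever stays in the domain. *)
Lemma level_thick t x a : 0 < t -> 0 <= x <= 1 -> a < `|w x t| ->
  exists2 s, s != t & forall p, (t <= p <= s) || (s <= p <= t) ->
    0 < p /\ exists2 x', 0 <= x' <= 1 & a < `|w x' p|.
Proof.
move=> t0 /andP[x0 x1] aw.
have [L L0 hL] := wL (t + 1).
set g := (`|w x t| - a) / (2 * (L + 1)).
have L1 : 0 < L + 1 by rewrite ltr_wpDl.
have g0 : 0 < g by rewrite divr_gt0 ?subr_gt0// mulr_gt0.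
have Lg s : 0 <= s <= g -> L * s < `|w x t| - a.
  move=> /andP[s0 sg]; have da : 0 < `|w x t| - a by rewrite subr_gt0.
  have : (L + 1) * s <= (L + 1) * g by rewrite ler_pM2l.
  have -> : (L + 1) * g = (`|w x t| - a) / 2 by rewrite /g; field; rewrite gt_eqF.
  lra.
have kn0 : 0 < `|k| by rewrite normr_gt0.
have ki : `|k| * (2 * `|k|)^-1 = 2^-1 by field; rewrite normr_eq0.
(* Within the time b the value of |w| stays above a, the characteristic moves by at most 1/2, and
   times stay positive and below t + 1. *)
set b := Num.min g (Num.min (Num.min 1 (t / 2)) (2 * `|k|)^-1).
have b0 : 0 < b by rewrite !lt_min g0 ltr01 divr_gt0// invr_gt0 mulr_gt0.
have [bg b1 bt bk] : [/\ b <= g, b <= 1, b <= t / 2 & `|k| * b <= 2^-1].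
  rewrite /b; split; rewrite ?ge_min ?lexx ?orbT//.
  by rewrite -ki ler_pM2l// !ge_min lexx !orbT.
have close p q : `|p - q| < `|q| - a -> a < `|p|.
  by have := ler_normB q p; have := lerB_normD q (p - q); rewrite subrKC => h _ ?; lra.
have close' p q : `|q - p| < `|q| - a -> a < `|p|.
  by rewrite distrC; exact: close.
(* In the first case the forward characteristic moves towards the farther end of [0, 1], in the
   second the backward one does. *)
have [xh|xh] : (0 <= k /\ x <= 2^-1 \/ k <= 0 /\ 2^-1 <= x) \/
    (0 <= k /\ 2^-1 <= x \/ k <= 0 /\ x <= 2^-1).
- by case: (leP 0 k) => hk; case: (leP x 2^-1) => hx; [left; left|right; left|right; right|left; right];
    split; rewrite ?ltW.
- exists (t + b); first by rewrite gt_eqF// ltrDl.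
  move=> p /orP[/andP[p1 p2]|/andP[p1 p2]]; last first.
    by have := le_trans p1 p2; rewrite gerDl leNgt b0.
  split; first exact: lt_le_trans p1.
  set s := p - t; have s0 : 0 <= s by rewrite subr_ge0.
  have sb : s <= b by rewrite lerBlDl.
  have ks : `|k| * s <= 2^-1 by apply: le_trans bk; rewrite ler_wpM2l.
  have xi : 0 <= x + k * s <= 1.
    case: xh => -[hk hx]; move: ks.
      rewrite ger0_norm// => ks; have := mulr_ge0 hk s0 => ?; apply/andP; split; lra.
    rewrite ler0_norm// mulNr => ks; have : k * s <= 0 by rewrite mulr_le0_ge0.
    by move=> ?; apply/andP; split; lra.
  exists (x + k * s) => //; rewrite -[p](subrKC t) -/s.
  apply: close; apply: le_lt_trans (Lg s _); last by rewrite s0 (le_trans sb).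
  by apply: hL; rewrite ?x0 ?(ltW t0)// lerD2l (le_trans sb).
exists (t - b); first by rewrite lt_eqF// gtrBl.
move=> p /orP[/andP[p1 p2]|/andP[p1 p2]].
  by have := le_trans p1 p2; rewrite leNgt gtrBl b0.
have p0 : 0 < p by lra.
split=> //.
set s := t - p; have s0 : 0 <= s by rewrite subr_ge0.
have sb : s <= b by rewrite /s; lra.
have ks : `|k| * s <= 2^-1 by apply: le_trans bk; rewrite ler_wpM2l.
have xi : 0 <= x - k * s <= 1.
  case: xh => -[hk hx]; move: ks.
    rewrite ger0_norm// => ks; have := mulr_ge0 hk s0 => ?; apply/andP; split; lra.
  rewrite ler0_norm// mulNr => ks; have : k * s <= 0 by rewrite mulr_le0_ge0.
  by move=> ?; apply/andP; split; lra.
exists (x - k * s) => //.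
apply: close'; apply: le_lt_trans (Lg s _); last by rewrite s0 (le_trans sb).
have := hL (x - k * s) p s (ltW p0) s0; rewrite subrK subrKC; apply => //.
  by rewrite lerDl.
by rewrite x0.
Qed.

(** A supremum over uncountably many x gives no measurability in t by itself. Here each superlevel
    set contains, with any positive time, a nondegenerate interval ending there, which is what
    [thick_measurable] asks. *)
Lemma normoo_measurable :
  measurable_fun (setT : set TR) (patch (fun=> 0) `[0, +oo[ (fun t => normoo (w ^~ t))).
Proof.
set P := patch _ _ _.
have PE t : P t = if 0 <= t then normoo (w ^~ t) else 0.
  by rewrite /P /patch mem_setE in_itv/= andbT.
have P0 t : 0 <= P t by rewrite PE; case: ifP => // /normoo_time_ge0.
apply: (measurability _ (RGenOInfty.measurableE R)) => _ [_ [a ->] <-]; rewrite setTI.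
have [a0|a0] := leP 0 a; last first.
  rewrite (_ : _ @^-1` _ = setT); first exact: measurableT.
  by apply/seteqP; split=> // t _ /=; rewrite in_itv/= andbT (lt_le_trans a0).
(* Time 0 is set apart as a single point: a backward characteristic would leave the domain there. *)
pose A := [set t | 0 < t /\ a < normoo (w ^~ t)].
rewrite (_ : _ @^-1` _ = A `|` (if a < P 0 then [set 0] else set0)); last first.
  apply/seteqP; split=> t /=; rewrite in_itv/= andbT.
    have [t0|t0|->] := ltgtP t 0; last by move=> aP; right; rewrite aP.
      by rewrite PE leNgt t0/= ltNge a0.
    by rewrite PE (ltW t0) => aw; left.
  case=> [[t0 aw]|]; first by rewrite PE (ltW t0).
  by case: ifP => // aP ->.
apply: measurableU; last by case: ifP.
apply: thick_measurable => t [t0 aw].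
have [M hM] := wb t.
have [|x xI ax] := @normoo_gt R (w ^~ t) M a _ aw; first by move=> x; apply: hM; rewrite lexx (ltW t0).
have [s st hs] := level_thick t0 xI ax; exists s => // p /hs[p0 [x' xI' ax']].
by split=> //; apply: (lt_le_trans ax'); apply: normoo_norm_ge => //; exact: ltW.
Qed.

Variables (q : R -> R) (B G T0 h : R).
Hypotheses (lq : lbm1 q) (q0 : forall s, 0 <= q s) (qB : forall T, 0 <= T -> itg 0 T q <= B).
Hypotheses (G0 : 0 <= G) (T00 : 0 <= T0) (h0 : 0 <= h).
Hypothesis wq : forall x t, 0 <= x <= 1 -> T0 < t -> w x t ^+ 2 <= G * itg (t - T0) (t + h) q.

Let n t := normoo (w ^~ t).

Lemma normoo_sqr_le t : T0 < t -> n t ^+ 2 <= G * itg (t - T0) (t + h) q.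
Proof.
move=> tT; have t0 := le_lt_trans T00 tT.
have I0 : 0 <= itg (t - T0) (t + h) q by apply: itg_ge0.
rewrite -[leRHS]sqr_sqrtr ?mulr_ge0// lerXn2r ?nnegrE ?sqrtr_ge0//.
  exact/normoo_time_ge0/ltW.
apply: normoo_le => x xI; rewrite -sqrtr_sqr; apply: ler_wsqrtr; exact: wq.
Qed.

Let window_le t : T0 < t -> itg (t - T0) (t + h) q <= B.
Proof.
move=> tT; apply: le_trans (qB (_ : 0 <= t + h)); last by rewrite addr_ge0// (le_trans T00)// ltW.
by apply: itg_sub => //; rewrite subr_ge0 ltW.
Qed.

Let window_itg T : T0 <= T -> itg T0 T (fun t => itg (t - T0) (t + h) q) <= (T0 + h) * B.
Proof.
move=> TT.
rewrite (@itg_ext _ _ _ _ (fun t => itg (- T0) h (fun s => q (s + t)))); last first.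
  by move=> t _; rewrite itg_shift// addrC (addrC h).
rewrite (@itg_fubini _ (fun t s => q (s + t))); last by lbm.
apply: (@le_trans _ _ (itg (- T0) h (fun=> B))).
  apply: itg_le; [by lbm|by lbm|move=> s /andP[s0 s1]].
  rewrite (@itg_ext _ _ _ _ (fun t => q (t + s))); last by move=> t _; rewrite addrC.
  rewrite itg_shift//; apply: le_trans (qB (_ : 0 <= T + s)); last by lra.
  by apply: itg_sub => //; lra.
rewrite itg_cst; last by rewrite (le_trans _ h0)// oppr_le0.
by rewrite opprK mulrC (addrC h).
Qed.

Lemma decay_L2_Loo : time_L2_Loo (fun t => normL2 (w ^~ t)) /\ time_L2_Loo n.
Proof.
have lp := lbm2_patchQ lw.
have lp1 t : 0 <= t -> lbm1 (patch01 (w ^~ t)).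
  by move=> t0; rewrite -patchQ_patch01//; lbm.
have [M hM] := wb T0.
have M0 : 0 <= M.
  by apply: le_trans (hM 0 _ 0 _); rewrite ?lexx ?ler01 ?T00.
(* A majorant of the squared sup norm: local boundedness up to T0, then the window of q. The latter
   is integrable because, by Fubini, each value of q is counted in windows of total length T0 +
   h. *)
pose g t := if (t <= T0)%R then M ^+ 2 else G * itg (t - T0) (t + h) q.
have lg : lbm1 g by rewrite /g; lbm.
have B0 : 0 <= B by apply: le_trans (qB (lexx 0)); apply: itg_ge0.
have g0 t : 0 <= g t.
  by rewrite /g; case: ifP => _; [exact: sqr_ge0|apply: mulr_ge0 => //; apply: itg_ge0].
have ng t : 0 <= t -> n t ^+ 2 <= g t.
  move=> t0; rewrite /g; have [tT|Tt] := leP t T0; last exact: normoo_sqr_le.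
  rewrite lerXn2r ?nnegrE ?normoo_time_ge0//; apply: normoo_le => x xI.
  by apply: (hM t) => //; rewrite t0.
have gC T : 0 <= T -> itg 0 T g <= M ^+ 2 * T0 + G * ((T0 + h) * B).
  move=> TT.
  have E1 T' : 0 <= T' <= T0 -> itg 0 T' g <= M ^+ 2 * T0.
    move=> /andP[p1 p2]; apply: (@le_trans _ _ (itg 0 T' (fun=> M ^+ 2))).
      apply: itg_le; [by []|by lbm|move=> t /andP[_ tT]].
      by rewrite /g (le_trans tT p2).
    by rewrite itg_cst// subr0 ler_wpM2l// sqr_ge0.
  have Y0 : 0 <= G * ((T0 + h) * B) by rewrite !mulr_ge0// addr_ge0.
  have [TT0|T0T] := leP T T0.
    by apply: (le_trans (E1 T _)); [rewrite TT|rewrite lerDl].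
  rewrite (@itg_split _ T0) ?T00 ?(ltW T0T)//; apply: lerD; first by apply: E1; rewrite lexx T00.
  rewrite (@itg_ext_oo _ _ _ _ (fun t => G * itg (t - T0) (t + h) q)).
  - rewrite itgZ; last by lbm.
    by rewrite ler_wpM2l// window_itg// ltW.
  - exact: lg.
  - by lbm.
  - by move=> t /andP[tT _]; rewrite /g leNgt tT.
have nb t : 0 <= t -> `|n t| <= Num.sqrt (M ^+ 2 + G * B).
  move=> t0; rewrite -sqrtr_sqr; apply: ler_wsqrtr; apply: (le_trans (ng t t0)).
  rewrite /g; case: (leP t T0) => [_|Tt]; first by rewrite lerDl mulr_ge0.
  apply: (@le_trans _ _ (G * B)); last by rewrite lerDr sqr_ge0.
  by rewrite ler_wpM2l// window_le.
have L2n t : 0 <= t -> 0 <= normL2 (w ^~ t) <= n t.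
  move=> t0; have [M' hM'] := wb t.
  have nn : normL2 (w ^~ t) <= n t by apply: (@normL2_le_normoo _ (w ^~ t) M' (lp1 t t0)) => x; apply: hM'; rewrite t0 lexx.
  by apply/andP; split => //; rewrite /normL2 (enormL2E (lp1 t t0))/=; exact: sqrtr_ge0.
split; last exact: time_L2_LooP normoo_measurable lg g0 ng gC nb.
apply: (time_L2_LooP _ lg g0 _ gC) => [|t t0|t t0].
- have [m1 _] : lbm1 (fun t => itg 0 1 (fun x => patchQ w x t ^+ 2)).
    by lbm.
  have ms : measurable_fun (setT : set TR) (fun t => Num.sqrt (itg 0 1 (fun x => patchQ w x t ^+ 2))).
    apply: (measurableT_comp _ m1); apply: (continuous_measurable_fun _).
    exact: sqrt_continuous.
  apply: (measurable_restrictT _ _).1; first exact: measurable_itv.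
  apply: (eq_measurable_fun _ _ (measurable_funS _ _ ms)) => //.
  move=> t; rewrite inE/= in_itv/= andbT => t0.
  rewrite /normL2 (enormL2E (lp1 t t0))/=; congr Num.sqrt; apply: itg_ext => x xI.
  by rewrite patchQE.
- apply: le_trans (ng t t0); have /andP[a1 a2] := L2n t t0.
  by rewrite lerXn2r ?nnegrE// normoo_time_ge0.
- apply: le_trans (nb t t0); have /andP[a1 a2] := L2n t t0.
  by rewrite !ger0_norm// normoo_time_ge0.
Qed.

(** The integral of q over [0, T] is monotone and bounded in T, so the integrals over windows moving
    to infinity tend to 0. *)
Lemma decay_vanishes : n t @[t --> +oo] --> (0 : R).
Proof.
pose I T := itg 0 T q.
have Isub a b : 0 <= a -> a <= b -> itg a b q = I b - I a.
  by move=> a0 ab; rewrite /I (@itg_split _ a 0 b) ?a0// addrC addKr.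
have Imono a b : 0 <= a -> a <= b -> I a <= I b.
  by move=> a0 ab; rewrite -subr_ge0 -Isub//; apply: itg_ge0.
have cauchy e : 0 < e -> exists2 T1, 0 <= T1 & forall b, 0 <= b -> I b <= I T1 + e.
  move=> e0; have hs : has_sup (I @` [set T | 0 <= T]).
    split; first by exists (I 0), 0 => //=.
    by exists B => _ [T /= T0' <-]; exact: qB.
  have [_ [T1 /= T10 <-] hT] := sup_adherent e0 hs; exists T1 => // b b0.
  rewrite -lerBlDr; apply: le_trans (ltW hT); rewrite lerD2r.
  by apply: (ub_le_sup hs.2); exists b.
apply/cvgrPdist_le => e e0; rewrite -[e]/(e : R).
have G1 : 0 < G + 1 by rewrite ltr_wpDl.
have [T1 T10 hT1] := cauchy (e ^+ 2 / (G + 1)) (divr_gt0 (exprn_gt0 2 e0) G1).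
near=> t.
have tT : T0 + T1 < t by near: t; apply: nbhs_pinfty_gt; exact: num_real.
have tT0 : T0 < t by apply: le_lt_trans tT; rewrite lerDl.
have t0 : 0 <= t := le_trans T00 (ltW tT0).
have th : t - T0 <= t + h by rewrite lerD2l; apply: (le_trans _ h0); rewrite oppr_le0.
rewrite sub0r normrN ger0_norm; last exact: normoo_time_ge0.
rewrite -(@ler_pXn2r _ 2)// ?nnegrE ?(ltW e0)//; last exact: normoo_time_ge0.
apply: (le_trans (normoo_sqr_le tT0)).
apply: (@le_trans _ _ (G * (e ^+ 2 / (G + 1)))).
  rewrite ler_wpM2l// Isub//; last by rewrite subr_ge0 ltW.
  rewrite lerBlDr; apply: le_trans (hT1 _ _) _; first by rewrite addr_ge0.
  by rewrite addrC lerD2l Imono// lerBrDl ltW.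
by rewrite mulrCA ler_piMr ?sqr_ge0// ler_pdivrMr// mul1r lerDl.
Unshelve. all: by end_near. Qed.

End decay.

(** * The closed-loop system *)

Section solution.
Context {R : realType}.
Variables (lambda mu r cbar rho gamma gamma1 : R).
Hypotheses (lambda0 : 0 < lambda) (mu0 : 0 < mu) (r0 : 0 < r) (cbar0 : 0 < cbar).
Hypotheses (rho0 : 0 < rho) (gamma0 : 0 < gamma) (gamma10 : 0 < gamma1).
Local Notation d := (lambda^-1).
Local Notation h := (mu^-1).
Variables (E : R) (c : R -> R) (u v uh vh ch : R -> R -> R) (Ku Kv : R -> R -> R -> R).
Variables (Nu Nv : deeponet (R := R)).
Hypotheses (E0 : 0 < E) (E1 : E <= 1).
Hypothesis Esmall : 12 * E ^+ 2 * (ctr_const lambda mu r cbar * (d + h)) <= 2^-1.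
Hypotheses (Cu : don_C1 Nu) (Cv : don_C1 Nv).
Hypotheses (lc : lbm1 (patch01 c)) (hcbar : (enormoo c <= cbar%:E)%E).
Hypotheses (mu_ : locally_bounded_measurable u) (mv_ : locally_bounded_measurable v).
Hypotheses (muh : locally_bounded_measurable uh) (mvh : locally_bounded_measurable vh).
Hypothesis mch : locally_bounded_measurable ch.
Hypothesis kernels : forall t, 0 <= t -> kernel lambda mu r (ch ^~ t) (Ku t) (Kv t).
Hypothesis accurate : forall t, 0 <= t -> don_accurate Nu Nv E (ch ^~ t) (Ku t) (Kv t).
Hypothesis hplant : plant lambda mu r c (control Nu Nv uh vh ch) u v.
Hypothesis hid : identifier lambda mu r rho (control Nu Nv uh vh ch) u v uh vh ch.
Hypothesis hupd : update_law gamma gamma1 cbar u v vh ch.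
Hypothesis hch0 : (enormoo (ch ^~ 0%R) <= cbar%:E)%E.
Implicit Types (x t s : R).

Local Notation pu := (patchQ u).
Local Notation pv := (patchQ v).
Local Notation puh := (patchQ uh).
Local Notation pvh := (patchQ vh).
Local Notation pch := (patchQ ch).
Local Notation pc := (patch01 c).
Let e x t := pu x t - puh x t.
Let ep x t := pv x t - pvh x t.
Local Notation m := (energy pu pv).

Let lu : lbm2 pu. Proof. exact: lbm2_patchQ. Qed.
Let lv : lbm2 pv. Proof. exact: lbm2_patchQ. Qed.
Let luh : lbm2 puh. Proof. exact: lbm2_patchQ. Qed.
Let lvh : lbm2 pvh. Proof. exact: lbm2_patchQ. Qed.
Let lch : lbm2 pch. Proof. exact: lbm2_patchQ. Qed.
Let le : lbm2 e. Proof. by rewrite /e; lbm. Qed.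
Let lep : lbm2 ep. Proof. by rewrite /ep; lbm. Qed.
Let lm : lbm1 m. Proof. by rewrite /energy; lbm. Qed.

Let enormoo_le (f : R -> R) x : (enormoo f <= cbar%:E)%E -> 0 <= x <= 1 -> `|f x| <= cbar.
Proof.
move=> hf xI; rewrite -lee_fin; apply: le_trans hf; apply: ereal_sup_ubound.
by exists x => //=; rewrite in_itv.
Qed.

Let mE t : 0 <= t -> normvarpi2 u v t = m t.
Proof. by move=> t0; apply: itg_ext => x xI; rewrite !patchQE. Qed.

Let Fuh x t := rho * e x t * m t.
Let Fv x t := pc x * pu x t.
Let Fvh x t := pch x t * pu x t + rho * ep x t * m t.

Let Fu_ : forall x t, 0 <= x <= 1 -> 0 <= t -> 0 = (fun _ _ : R => 0 : R) x t.
Proof. by []. Qed.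
Let Fv_ x t : 0 <= x <= 1 -> 0 <= t -> c x * u x t = Fv x t.
Proof. by move=> xI t0; rewrite /Fv patch01E// patchQE. Qed.
Let Fuh_ x t : 0 <= x <= 1 -> 0 <= t -> rho * (u x t - uh x t) * normvarpi2 u v t = Fuh x t.
Proof. by move=> xI t0; rewrite /Fuh /e mE// !patchQE. Qed.
Let Fvh_ x t : 0 <= x <= 1 -> 0 <= t ->
  ch x t * u x t + rho * (v x t - vh x t) * normvarpi2 u v t = Fvh x t.
Proof. by move=> xI t0; rewrite /Fvh /ep mE// !patchQE. Qed.
Let lF0 : lbm2 (fun _ _ : R => 0 : R). Proof. exact: lbm_cst. Qed.
Let lFuh : lbm2 Fuh. Proof. by rewrite /Fuh; lbm. Qed.
Let lFv : lbm2 Fv. Proof. by rewrite /Fv; lbm. Qed.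
Let lFvh : lbm2 Fvh. Proof. by rewrite /Fvh; lbm. Qed.

Let right x s : 0 <= s -> 0 <= x -> x + lambda * s <= 1 -> 0 <= x <= 1 /\ 0 <= x + lambda * s <= 1.
Proof.
move=> s0 x0 x1; have ls : 0 <= lambda * s by rewrite mulr_ge0// ltW.
by split; apply/andP; split => //; [apply: le_trans x1; rewrite lerDl|rewrite addr_ge0].
Qed.
Let left x s : 0 <= s -> x <= 1 -> 0 <= x - mu * s -> 0 <= x <= 1 /\ 0 <= x + - mu * s <= 1.
Proof.
move=> s0 x1 x0; have ls : 0 <= mu * s by rewrite mulr_ge0// ltW.
by rewrite mulNr; split; apply/andP; split => //;
  [apply: le_trans x0 _; rewrite gerBl|apply: le_trans x1; rewrite gerBl].
Qed.

Let tu x t s : 0 <= t -> 0 <= s -> 0 <= x -> x + lambda * s <= 1 ->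
  pu (x + lambda * s) (t + s) = pu x t.
Proof.
move=> t0 s0 x0 x1; have [xI yI] := right s0 x0 x1; have [Tu _ _ _] := hplant.
by rewrite (transport_patch Tu Fu_)// itg0 addr0.
Qed.

Let tv x t s : 0 <= t -> 0 <= s -> x <= 1 -> 0 <= x - mu * s ->
  pv (x - mu * s) (t + s) =
  pv x t + itg 0 s (fun z => pc (x - mu * z) * pu (x - mu * z) (t + z)).
Proof.
move=> t0 s0 x1 x0; have [xI yI] := left s0 x1 x0; have [_ Tv _ _] := hplant.
rewrite -mulNr (transport_patch Tv Fv_)//; congr (_ + _).
by apply: itg_ext => z _; rewrite mulNr.
Qed.

Let te x t s : 0 <= t -> 0 <= s -> 0 <= x -> x + lambda * s <= 1 ->
  e (x + lambda * s) (t + s) =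
  e x t + itg 0 s (fun z => rho * e (x + lambda * z) (t + z) * - m (t + z)).
Proof.
move=> t0 s0 x0 x1; have [xI yI] := right s0 x0 x1; have [Tu _ _ _] := hid.
rewrite {1}/e tu// (transport_patch Tu Fuh_)// opprD addrA; congr (_ + _).
by rewrite -itgN; [apply: itg_ext => z _; rewrite /Fuh mulrN|lbm].
Qed.

Let tep x t s : 0 <= t -> 0 <= s -> x <= 1 -> 0 <= x - mu * s ->
  ep (x - mu * s) (t + s) =
  ep x t + itg 0 s (fun z => (pc (x - mu * z) - pch (x - mu * z) (t + z)) * pu (x - mu * z) (t + z)
    - rho * ep (x - mu * z) (t + z) * m (t + z)).
Proof.
move=> t0 s0 x1 x0; have [xI yI] := left s0 x1 x0; have [_ Tv _ _] := hid.
rewrite {1}/ep tv// -mulNr (transport_patch Tv Fvh_)// opprD addrACA; congr (_ + _).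
rewrite -itgB; [|by lbm|by lbm].
by apply: itg_ext => z _; rewrite /Fvh mulNr; ring.
Qed.

Let I0 : 0 <= (0 : R) <= 1. Proof. by rewrite lexx ler01. Qed.
Let I1 : 0 <= (1 : R) <= 1. Proof. by rewrite lexx ler01. Qed.

Let bu t : 0 < t -> pu 0 t = r * pv 0 t.
Proof. by move=> t0; have [_ _ b _] := hplant; rewrite !patchQE ?(ltW t0)//; exact: b. Qed.
Let be t : 0 < t -> e 0 t = r * ep 0 t.
Proof.
move=> t0; have [_ _ b _] := hid; rewrite /e /ep bu// mulrBr.
by rewrite !(@patchQE _ uh) ?(@patchQE _ vh) ?(ltW t0)// b.
Qed.
Let bep t : 0 < t -> ep 1 t = 0.
Proof.
move=> t0; have [_ _ _ b] := hid; have [_ _ _ b'] := hplant.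
by rewrite /ep !patchQE ?(ltW t0)// b// b'// subrr.
Qed.

Let upd x t : 0 <= x <= 1 -> 0 <= t ->
  pch x t = pch x 0 + itg 0 t (fun s =>
    Proj cbar (gamma1 * expR (gamma * x) * ep x s * pu x s) (pch x s)).
Proof.
move=> xI t0; rewrite !patchQE// hupd//; congr (_ + _).
by apply: itg_ext => s /andP[s0 _]; rewrite /ep !patchQE.
Qed.

Let cb x : 0 <= x <= 1 -> `|pc x| <= cbar.
Proof. by move=> xI; rewrite patch01E// enormoo_le. Qed.

Let chb x t : 0 <= x <= 1 -> 0 <= t -> `|pch x t| <= cbar.
Proof.
move=> xI t0.
apply: (@Proj_bound _ cbar (pch x) (fun s => gamma1 * expR (gamma * x) * ep x s * pu x s) t (ltW cbar0) t0).
- by rewrite /Proj; lbm.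
- by rewrite patchQE// (enormoo_le hch0).
- by move=> s /andP[s0 _]; exact: upd.
Qed.

Let control_kernel t : 0 < t -> exists kappa Ku1 Nu' Nv' : R -> R,
    [/\ [/\ lbm1 kappa, lbm1 Ku1, lbm1 Nu' & lbm1 Nv'],
        volterra_kernel lambda mu r (pch ^~ t) kappa Ku1,
        forall xi, 0 < xi < 1 -> `|Ku1 xi - Nu' xi| <= E /\ `|kappa (1 - xi) - Nv' xi| <= E &
        pv 1 t = itg 0 1 (fun xi => Nu' xi * (pu xi t - e xi t) + Nv' xi * (pv xi t - ep xi t))].
Proof.
move=> t0; have t0' := ltW t0.
have [lk lkap lKu VK diag] := kernel_volterraP lambda0 mu0 r0 (kernels t0').
exists (patch01 (Kv t ^~ 0)), (patch01 (Ku t 1)), (patch01 (don_eval Nu (ch ^~ t) 1)),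
  (patch01 (don_eval Nv (ch ^~ t) 1)); split.
- by split=> //; exact: don_eval_lbm.
- by rewrite patchQ_patch01.
- move=> xi /andP[x0 x1]; have [|//|a1 a2] := accurate t0' (_ : 0 <= xi <= 1).
    by rewrite !ltW.
  rewrite !patch01E ?(ltW x0) ?(ltW x1)//; last by rewrite subr_ge0 gerBl !ltW.
  by rewrite -diag// !ltW.
have [_ _ _ b'] := hplant; rewrite patchQE// b'//.
apply: itg_ext => xi xI; rewrite !(@patch01E _ _ xi)// /e /ep.
by rewrite !patchQE//; ring.
Qed.

Local Notation Q := (traceQ lambda r pu pv).
Local Notation Bq := (trace_bound lambda mu r cbar rho gamma gamma1 pc pu pv e ep pch).
Local Notation G := (decay_gain lambda mu r cbar).
Let T0 := 2 * h + 3 * d.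

Let Q_le T : 0 <= T -> itg 0 T (fun s => trace lambda r pu pv s ^+ 2) <= Bq.
Proof.
move=> TT; apply: le_trans (trace_total lambda0 mu0 r0 cbar0 rho0 gamma0 gamma10 E0 E1 lc
  lu lv le lep lch cb chb tu tv bu te tep be bep upd control_kernel Esmall T).
by apply: traceQ_sub => //; rewrite oppr_le0 invr_ge0 ltW.
Qed.

Let gain0 : 0 <= G. Proof. exact: decay_gain_ge0 lambda0 mu0 r0 cbar0. Qed.
Let T00 : 0 <= T0.
Proof. by rewrite addr_ge0// mulr_ge0// invr_ge0 ltW. Qed.
Let h0 : 0 <= h. Proof. by rewrite invr_ge0 ltW. Qed.

Let dec x t : 0 <= x <= 1 -> T0 < t ->
  [/\ u x t ^+ 2 <= 4 * G * Q (t - T0) (t + h), v x t ^+ 2 <= 4 * G * Q (t - T0) (t + h),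
      uh x t ^+ 2 <= 4 * G * Q (t - T0) (t + h) & vh x t ^+ 2 <= 4 * G * Q (t - T0) (t + h)].
Proof.
move=> xI tT; have t0 := ltW (le_lt_trans T00 tT).
have [] := decay lambda0 mu0 r0 cbar0 rho0 E1 lc
  lu lv le lep lch cb chb tu tv bu te tep be bep control_kernel xI tT.
have -> : uh x t = pu x t - e x t by rewrite /e subKr patchQE.
have -> : vh x t = pv x t - ep x t by rewrite /ep subKr patchQE.
rewrite -/T0 -mulrA -(patchQE u xI t0) -(patchQE v xI t0).
have : 0 <= G * Q (t - T0) (t + h) by rewrite mulr_ge0// traceQ_ge0.
move: (G * _) (pu x t) (pv x t) (e x t) (ep x t) => K a b a' b' K0 h1 h2 h3 h4.
(* The estimates u^ and v^ are differences, and (a - a')^2 <= 2 a^2 + 2 a'^2 accounts for the factor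
   4. *)
have := sqr_ge0 (a + a'); have := sqr_ge0 (b + b').
by split; nra.
Qed.

Let conclusion w k : locally_bounded_measurable w -> k != 0 ->
  (forall T, exists2 L, 0 <= L & forall x t s : R, 0 <= t -> 0 <= s -> t + s <= T ->
    0 <= x <= 1 -> 0 <= x + k * s <= 1 -> `|w (x + k * s) (t + s) - w x t| <= L * s) ->
  (forall x t, 0 <= x <= 1 -> T0 < t -> w x t ^+ 2 <= 4 * G * Q (t - T0) (t + h)) ->
  (time_L2_Loo (fun t => normL2 (w ^~ t)) /\ time_L2_Loo (fun t => normoo (w ^~ t))) /\
  (normoo (w ^~ t) @[t --> +oo] --> (0 : R)).
Proof.
move=> lw k0 wL wq.
have ly : lbm1 (trace lambda r pu pv) by exact: lbm_trace.
have lq : lbm1 (fun s => trace lambda r pu pv s ^+ 2) by lbm.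
have q0 s : 0 <= trace lambda r pu pv s ^+ 2 by exact: sqr_ge0.
have G4 : 0 <= 4 * G by rewrite mulr_ge0.
split; first exact: (decay_L2_Loo lw k0 wL lq q0 Q_le G4 T00 h0 wq).
exact: (decay_vanishes lw lq q0 Q_le G4 T00 h0 wq).
Qed.

Let ln0 : lambda != 0. Proof. by rewrite gt_eqF. Qed.
Let mn0 : - mu != 0. Proof. by rewrite oppr_eq0 gt_eqF. Qed.

Lemma solution_decay :
  let in_L2_Loo w := time_L2_Loo (fun t => normL2 (w ^~ t)) /\
                     time_L2_Loo (fun t => normoo (w ^~ t)) in
  let vanishes w := normoo (w ^~ t) @[t --> +oo] --> (0 : R) in
  [/\ in_L2_Loo u, in_L2_Loo v, in_L2_Loo uh & in_L2_Loo vh] /\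
  [/\ vanishes u, vanishes v, vanishes uh & vanishes vh].
Proof.
move=> /=; have [Tu Tv _ _] := hplant; have [Tuh Tvh _ _] := hid.
have [] := conclusion mu_ ln0 (transport_lipschitz lF0 Tu Fu_).
  by move=> x t xI tT; have [] := dec xI tT.
have [] := conclusion mv_ mn0 (transport_lipschitz lFv Tv Fv_).
  by move=> x t xI tT; have [] := dec xI tT.
have [] := conclusion muh ln0 (transport_lipschitz lFuh Tuh Fuh_).
  by move=> x t xI tT; have [] := dec xI tT.
have [] := conclusion mvh mn0 (transport_lipschitz lFvh Tvh Fvh_).
  by move=> x t xI tT; have [] := dec xI tT.
by [].
Qed.

(** * The stability estimate in the original variables *)

Local Notation St := (S_fun c u v uh vh ch).
Local Notation Et t := (m t + eN e t + epN ep t + ctN pc pch t).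

Let normL2p w t : lbm2 (patchQ w) -> 0 <= t ->
  normL2 (w ^~ t) ^+ 2 = itg 0 1 (fun x => patchQ w x t ^+ 2).
Proof.
move=> lw t0; rewrite normL2_sqr; last by rewrite -patchQ_patch01//; lbm.
by apply: itg_ext => x xI; rewrite patchQE.
Qed.

Let SE t : 0 <= t -> St t = m t + itg 0 1 (fun x => puh x t ^+ 2) +
  itg 0 1 (fun x => pvh x t ^+ 2) + ctN pc pch t.
Proof.
move=> t0; rewrite /S_fun !normL2p// (energy_split lu lv).
congr (_ + _ + _ + _); rewrite normL2_sqr.
  by apply: itg_ext => x xI; rewrite patch01E// patchQE.
have : lbm1 (fun x => pc x - pch x t) by lbm.
apply: lbm_ext => x; rewrite /patch01 /patchQ t0 andbT.
by case: ifP => // _; rewrite subr0.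
Qed.

Let itg_sqrB (f g : R -> R) : lbm1 f -> lbm1 g ->
  itg 0 1 (fun x => (f x - g x) ^+ 2) <=
  2 * itg 0 1 (fun x => f x ^+ 2) + 2 * itg 0 1 (fun x => g x ^+ 2).
Proof.
move=> lf lg; rewrite -!itgZ; [|by lbm|by lbm]; rewrite -itgD; [|by lbm|by lbm].
apply: itg_le; [by lbm|by lbm|move=> x _].
by have := sqr_ge0 (f x + g x); nra.
Qed.

Let E_ge0 t : [/\ 0 <= itg 0 1 (fun x => pu x t ^+ 2), 0 <= itg 0 1 (fun x => pv x t ^+ 2),
  0 <= eN e t, 0 <= epN ep t & 0 <= ctN pc pch t].
Proof. by split; apply: itg_ge0 => x _; exact: sqr_ge0. Qed.

Let uh_le t : itg 0 1 (fun x => puh x t ^+ 2) <= 2 * itg 0 1 (fun x => pu x t ^+ 2) + 2 * eN e t.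
Proof.
rewrite (@itg_ext _ _ _ _ (fun x => (pu x t - e x t) ^+ 2)); last by move=> x _; rewrite /e subKr.
by apply: itg_sqrB; lbm.
Qed.
Let vh_le t : itg 0 1 (fun x => pvh x t ^+ 2) <= 2 * itg 0 1 (fun x => pv x t ^+ 2) + 2 * epN ep t.
Proof.
rewrite (@itg_ext _ _ _ _ (fun x => (pv x t - ep x t) ^+ 2)); last by move=> x _; rewrite /ep subKr.
by apply: itg_sqrB; lbm.
Qed.
Let e_le t : eN e t <= 2 * itg 0 1 (fun x => pu x t ^+ 2) + 2 * itg 0 1 (fun x => puh x t ^+ 2).
Proof. by apply: itg_sqrB; lbm. Qed.
Let ep_le t : epN ep t <= 2 * itg 0 1 (fun x => pv x t ^+ 2) + 2 * itg 0 1 (fun x => pvh x t ^+ 2).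
Proof. by apply: itg_sqrB; lbm. Qed.

Let S_le t : 0 <= t -> St t <= 3 * Et t.
Proof.
move=> t0; rewrite SE// (energy_split lu lv).
move: (E_ge0 t) (uh_le t) (vh_le t); move: (eN e t) (epN ep t) (ctN pc pch t)
  (itg _ _ _) (itg _ _ _) (itg _ _ _) (itg _ _ _) => a b a' b' x1 x2 x3 [] *.
lra.
Qed.

Let E_le t : 0 <= t -> Et t <= 3 * St t.
Proof.
move=> t0; rewrite SE// (energy_split lu lv).
have z1 : 0 <= itg 0 1 (fun x => puh x t ^+ 2) by apply: itg_ge0 => x _; exact: sqr_ge0.
have z2 : 0 <= itg 0 1 (fun x => pvh x t ^+ 2) by apply: itg_ge0 => x _; exact: sqr_ge0.
move: (E_ge0 t) (e_le t) (ep_le t) z1 z2; move: (eN e t) (epN ep t) (ctN pc pch t)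
  (itg _ _ _) (itg _ _ _) (itg _ _ _) (itg _ _ _) => a b a' b' x1 x2 x3 [] *.
lra.
Qed.

(** S and the functional with e, epsilon in place of u^, v^ bound each other up to a factor 3,
    whence 9 in front and 3 in the exponent. The absolute values make the bound monotone in the
    initial size. *)
Lemma solution_stability t : 0 <= t ->
  St t <= 9 * `|stability_gain lambda mu r cbar gamma gamma1| * St 0 *
    expR (3 * `|stability_rate lambda mu r cbar rho gamma gamma1| * St 0).
Proof.
move=> t0; apply: (le_trans (S_le t0)).
have := energy_bound lambda0 mu0 r0 cbar0 rho0 gamma0 gamma10 E0 E1 lc
  lu lv le lep lch cb chb tu tv bu te tep be bep upd control_kernel Esmall t0.
have := E_le (lexx 0); rewrite -/(size0 pc pu pv e ep pch).
have Z0 : 0 <= size0 pc pu pv e ep pch.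
  have [a1 a2 a3 a4 a5] := E_ge0 0.
  by rewrite /size0 (energy_split lu lv) !addr_ge0.
move: (size0 _ _ _ _ _ _) (stability_gain _ _ _ _ _ _) (stability_rate _ _ _ _ _ _ _) (St 0) Z0
  => Z g k S Z0 ZS EB.
have S0 : 0 <= 3 * S := le_trans Z0 ZS.
rewrite (_ : 9 * _ * _ * _ = 3 * (`|g| * (3 * S) * expR (`|k| * (3 * S)))); last first.
  by rewrite (_ : 3 * `|k| * S = `|k| * (3 * S)); ring.
rewrite ler_wpM2l//; apply: (le_trans EB).
apply: (@le_trans _ _ (`|g| * Z * expR (k * Z))).
  by rewrite ler_wpM2r ?expR_ge0// ler_wpM2r// ler_norm.
apply: ler_pM; rewrite ?expR_ge0//; first exact: mulr_ge0.
  by rewrite ler_wpM2l.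
rewrite ler_expR; apply: (@le_trans _ _ (`|k| * Z)); first by rewrite ler_wpM2r// ler_norm.
by rewrite ler_wpM2l.
Qed.

End solution.

Theorem theorem4 (R : realType)
  (tau c0 gamma0 vf rhom rhos vs ps lambda mu r cbar rho gamma gamma1 : R)
  (c : R -> R)
  (htau : 0 < tau) (hc0 : 0 < c0) (hgamma0 : 0 < gamma0)
  (hvf : 0 < vf) (hrhom : 0 < rhom) (hrhos : 0 < rhos)
  (hvs : vs = V_eq vf rhom gamma0 rhos)
  (hps : ps = c0 * rhos `^ gamma0)
  (hlambda : lambda = vs) (hlambda0 : 0 < lambda)
  (hmu : mu = gamma0 * ps - vs) (hmu0 : 0 < mu)
  (hr : r = (rhos * V_eq vf rhom gamma0 rhos + vs) / vs)
  (hc : forall x, c x = - (1 / tau) * expR (- (x / (tau * vs))))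
  (hcbar0 : 0 < cbar) (hcbar : (enormoo c <= cbar%:E)%E)
  (hrho : 0 < rho) (hgamma : 0 < gamma) (hgamma1 : 0 < gamma1) :
  exists2 E0 : R, 0 < E0 &
  forall E : R, 0 < E -> E < E0 ->
  forall Nu Nv : deeponet (R := R), don_C1 Nu -> don_C1 Nv ->
  exists k1 k2 theta1 theta2 : R,
    [/\ 0 < k1, 0 < k2, 0 < theta1 & 0 < theta2] /\
    forall (u v uh vh ch : R -> R -> R) (Ku Kv : R -> R -> R -> R),
      (* regularity *)
      locally_bounded_measurable u -> locally_bounded_measurable v ->
      locally_bounded_measurable uh -> locally_bounded_measurable vh ->
      locally_bounded_measurable ch ->
      (* exact kernels and accuracy of their approximation *)
      (forall t, 0 <= t -> kernel lambda mu r (ch ^~ t) (Ku t) (Kv t)) ->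
      (forall t, 0 <= t -> don_accurate Nu Nv E (ch ^~ t) (Ku t) (Kv t)) ->
      (* closed loop *)
      plant lambda mu r c (control Nu Nv uh vh ch) u v ->
      identifier lambda mu r rho (control Nu Nv uh vh ch) u v uh vh ch ->
      update_law gamma gamma1 cbar u v vh ch ->
      (* initial conditions *)
      [lipschitz ch x 0 | x in `[0, 1]] ->
      (enormoo (ch ^~ 0%R) <= cbar%:E)%E ->
      (enormL2 (uh ^~ 0%R) < +oo)%E -> (enormL2 (vh ^~ 0%R) < +oo)%E ->
      let in_L2_Loo w := time_L2_Loo (fun t => normL2 (w ^~ t)) /\
                         time_L2_Loo (fun t => normoo (w ^~ t)) in
      let vanishes w := normoo (w ^~ t) @[t --> +oo] --> (0 : R) in
      [/\ [/\ in_L2_Loo u, in_L2_Loo v, in_L2_Loo uh & in_L2_Loo vh],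
          [/\ vanishes u, vanishes v, vanishes uh & vanishes vh] &
          (forall t, 0 < t ->
             S_fun c u v uh vh ch t <=
             2 * (k2 / k1) * theta2 * S_fun c u v uh vh ch 0 *
             expR (theta1 * k2 * S_fun c u v uh vh ch 0))].

Proof.
have r0 : 0 < r.
  have vs0 : 0 < vs by rewrite -hlambda.
  by rewrite hr -hvs divr_gt0// addr_gt0// mulr_gt0.
have lc : lbm1 (patch01 c).
  apply: (@lbm_ext _ _ _ _ (fun x : R => if (0 <= x) && (x <= 1)
    then - (1 / tau) * expR (- (x * (tau * vs)^-1)) else 0)).
    by move=> x; rewrite /patch01; case: ifP => // _; rewrite hc.
  by lbm.
set K := ctr_const lambda mu r cbar * (lambda^-1 + mu^-1).
have K0 : 0 < K.
  have l0 := ltW hlambda0; have m0 := ltW hmu0.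
  have p1 : 0 < r ^+ 2 * lambda by rewrite mulr_gt0// exprn_gt0.
  have p2 : 0 <= 2 * (mu^-1 * cbar ^+ 2 * r ^+ 2).
    apply: mulr_ge0 => //; apply: mulr_ge0; last exact: sqr_ge0.
    by apply: mulr_ge0; rewrite ?invr_ge0 ?sqr_ge0.
  apply: mulr_gt0; last by rewrite addr_gt0// invr_gt0.
  by rewrite /ctr_const ltr_wpDr// ltr_wpDr// mulr_ge0.
(* E <= 1 bounds the approximate kernels by the exact bound plus 1, and gives E^2 <= E, so that E <
   1 / (24 K) yields 12 E^2 K <= 1/2. *)
exists (Num.min 1 (24 * K)^-1); first by rewrite lt_min ltr01 invr_gt0 mulr_gt0.
move=> E E0; rewrite lt_min => /andP[E1 EK] Nu Nv CNu CNv.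
have Esmall : 12 * E ^+ 2 * K <= 2^-1.
  have k24 : 0 < 24 * K by rewrite mulr_gt0.
  have : E * (24 * K) < 1 by move: EK; rewrite -(ltr_pM2r k24) (mulVf (lt0r_neq0 k24)).
  have : E ^+ 2 * K <= E * K by rewrite ler_wpM2r ?(ltW K0)// expr2 ler_piMl ?ltW.
  lra.
set g := stability_gain lambda mu r cbar gamma gamma1.
set k := stability_rate lambda mu r cbar rho gamma gamma1.
(* With k1 = k2 = 1 all constants go into theta1 and theta2; the added 1 makes them strictly
   positive. *)
exists 1, 1, (1 + 3 * `|k|), (1 + 9 * `|g|); split.
  by split=> //; rewrite ltr_wpDr// mulr_ge0.
move=> u v uh vh ch Ku Kv mu_ mv muh mvh mch hK hA hp hi hu _ hch0 _ _ L V.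
have [dL dV] := solution_decay hlambda0 hmu0 r0 hcbar0 hrho hgamma hgamma1 E0 (ltW E1) Esmall
  CNu CNv lc hcbar mu_ mv muh mvh mch hK hA hp hi hu hch0.
split=> // t t0.
apply: (le_trans (solution_stability hlambda0 hmu0 r0 hcbar0 hrho hgamma hgamma1 E0 (ltW E1) Esmall
  CNu CNv lc hcbar mu_ mv muh mvh mch hK hA hp hi hu hch0 (ltW t0))).
rewrite -/g -/k divr1 !mulr1.
have S0 : 0 <= S_fun c u v uh vh ch 0 by rewrite /S_fun !addr_ge0// sqr_ge0.
have g0 : 0 <= `|g| := normr_ge0 g.
apply: ler_pM; rewrite ?expR_ge0//.
- by rewrite !mulr_ge0.
- by rewrite ler_wpM2r//; lra.
- by rewrite ler_expR ler_wpM2r// lerDr.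
Qed.
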